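(* Let $\mathbb{K}\in\{\mathbb{R},\mathbb{C}\}$ and let $H$ be an infinite-dimensional, separable Hilbert space over $\mathbb{K}$ with topological dual $H'$. (i) If $X$ is a symmetric $H$-valued Gaussian field, then its covariance function is given by $(f,g)\mapsto (Af,g)_{H'}$, $f,g\in H'$, for some non-negative, self-adjoint, trace class operator $A$ on $H'$. (ii) If $A$ is a non-negative, self-adjoint, trace class operator on $H'$, then there exists a symmetric $H$-valued Gaussian field $X$ with covariance function $(f,g)\mapsto (Af,g)_{H'}$, $f,g\in H'$. In either case, $X$ is non-degenerate if and only if $A$ is positive.
   Context: Probability spaces $(\Omega,\mathcal F,\mathbb P)$ (with expectation $\mathbb E$) are assumed large enough to support the random elements considered. An $H$-valued random field is a Borel measurable map $X:\Omega\to H$; equivalently (as $H$ is separable), $f(X)$ is a $\mathbb{K}$-valued random variable for every $f\in H'$. It is a Gaussian field if $f(X)$ is a $\mathbb{K}$-valued Gaussian random variable for every $f\in H'$, where a complex random variable is Gaussian if its real and imaginary parts are jointly Gaussian (degenerate Gaussians, i.e. variance zero, are allowed). A $\mathbb{K}$-valued Gaussian random variable $\xi$ is symmetric if it is centred ($\mathbb E\xi=0$) when $\mathbb K=\mathbb R$, and proper (i.e. $\mathbb E\xi=0$ and $\mathbb E[\xi^2]=0$) when $\mathbb K=\mathbb C$. A Gaussian field $X$ is symmetric if $f(X)$ is symmetric for every $f\in H'$. The covariance function of $X$ is $c_X(f,g)=\operatorname{cov}(f(X),g(X))=\mathbb E\big[(f(X)-\mathbb Ef(X))\overline{(g(X)-\mathbb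 Eg(X))}\big]$ for $f,g\in H'$. For $f\in H'$ let $h_f\in H$ be its Riesz representative, $f(x)=(x,h_f)_H$ for all $x \in H$ (inner products are linear in the first argument); the dual $H'$ is a Hilbert space over $\mathbb K$ with $(f,g)_{H'}=(h_g,h_f)_H$. $A$ is non-negative if $(Af,f)_{H'}\ge 0$ for all $f\in H'$, and positive if $(Af,f)_{H'}>0$ for all $f\in H'\setminus\{0\}$. $X$ is non-degenerate if $\operatorname{Var} f(X)>0$ for all $f\in H'\setminus\{0\}$. *)

(* Defs.v *)
From HB Require Import structures.
From mathcomp Require Import all_boot all_order all_algebra.
From mathcomp Require Import complex.
From mathcomp Require Import all_classical all_reals all_analysis.

Set Implicit Arguments.
Unset Strict Implicit.
Unset Printing Implicit Defensive.

Import Order.TTheory GRing.Theory Num.Theory.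
Import numFieldNormedType.Exports.

Local Open Scope classical_set_scope.
Local Open Scope ring_scope.

Variant scalar_kind := RealScalars | ComplexScalars.

Definition scalars (k : scalar_kind) (R : realType) : numFieldType :=
  match k with RealScalars => R | ComplexScalars => R[i] end.

Definition reK {k : scalar_kind} {R : realType} : scalars k R -> R :=
  match k with RealScalars => id | ComplexScalars => @complex.Re R end.

Definition conjK {k : scalar_kind} {R : realType} :
    scalars k R -> scalars k R :=
  match k with RealScalars => id | ComplexScalars => @Num.conj R[i] end.

(* The topological dual, as a linear subspace of the space of all functions. *)
Section Dual.
Context {K : numFieldType} (V : normedModType K).

Definition continuous_functional : {pred V -> K^o} :=
  fun f => `[< linear f /\ continuous f >].

Fact continuous_functional_submod : submod_closed continuous_functional.
Proof.
split=> [|a f g /asboolP[lf cf] /asboolP[lg cg]]; apply/asboolP; split.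
- by move=> b u v; rewrite /= scaler0 addr0.
- by move=> x; exact: cvg_cst.
- move=> b u v; rewrite !fctE lf lg !scalerDr !scalerA mulrC -!addrA.
  by congr (_ + _); rewrite addrCA.
- move=> x; apply: (@cvgD _ K^o) => //; last exact: cg.
  by apply: (@cvgZr _ K^o); exact: cf.
Qed.

HB.instance Definition _ := GRing.isSubmodClosed.Build K (V -> K^o)
  continuous_functional continuous_functional_submod.

Record dual := Dual {
  dual_fun :> V -> K^o;
  _ : dual_fun \in continuous_functional }.

HB.instance Definition _ := [isSub for dual_fun].
HB.instance Definition _ := [Choice of dual by <:].
HB.instance Definition _ := [SubChoice_isSubLmodule of dual by <:].

End Dual.

Definition infinite_dimensional (K : fieldType) (V : lmodType K) : Prop :=
  ~ exists (n : nat) (v : 'I_n -> V),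
      forall x, exists c : 'I_n -> K, x = \sum_i c i *: v i.

Definition separable (T : topologicalType) : Prop :=
  exists D : set T, countable D /\ dense D.

(* Operators on an inner product space.  The form [ip] is a bare function so
   that these notions apply both to H and to its dual. *)
Section Operators.
Context {k : scalar_kind} {R : realType}.
Local Notation K := (scalars k R).
Context {V : lmodType K} (ip : V -> V -> K).

Definition ip_norm (v : V) : R := Num.sqrt (reK (ip v v)).

Definition bounded_operator (A : V -> V) : Prop :=
  exists M : R, forall v, ip_norm (A v) <= M * ip_norm v.

Definition adjoint_operators (A B : V -> V) : Prop :=
  forall u v, ip (A u) v = ip u (B v).

Definition self_adjoint (A : V -> V) : Prop := adjoint_operators A A.

(* In the order of a numFieldType, 0 <= z and 0 < z entail that z is real. *)
Definition nonnegative_operator (A : V -> V) : Prop :=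
  forall v, 0 <= ip (A v) v.

Definition positive_operator (A : V -> V) : Prop :=
  forall v, v != 0 -> 0 < ip (A v) v.

Definition orthonormal_basis (e : nat -> V) : Prop :=
  (forall i j, ip (e i) (e j) = (i == j)%:R) /\
  (forall (v : V) (eps : R), 0 < eps ->
    exists (n : nat) (c : nat -> K),
      ip_norm (v - \sum_(i < n) c i *: e i) < eps).

(* B is the absolute value |A| = sqrt (A^* A). *)
Definition operator_abs (A B : V -> V) : Prop :=
  [/\ bounded_operator B, self_adjoint B, nonnegative_operator B &
      exists A' : V -> V,
        adjoint_operators A A' /\ forall v, B (B v) = A' (A v)].

(* The trace of |A| is finite.  Orthonormal bases being indexed by nat, this
   is meant for separable spaces of infinite dimension. *)
Definition trace_class (A : V -> V) : Prop :=
  bounded_operator A /\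
  exists (B : {linear V -> V}) (e : nat -> V),
    [/\ operator_abs A B, orthonormal_basis e &
        (\sum_(0 <= n <oo) (reK (ip (B (e n)) (e n)))%:E < +oo)%E].

End Operators.

Section DualInnerProduct.
Context {k : scalar_kind} {R : realType}.
Local Notation K := (scalars k R).
Context {H : normedModType K} (ip : H -> H -> K).

Definition riesz (f : dual H) : H := xget 0 [set h | forall x, f x = ip x h].

Definition dual_ip (f g : dual H) : K := ip (riesz g) (riesz f).

End DualInnerProduct.

Section RandomVariables.
Context {R : realType} {d : measure_display} {Omega : measurableType d}.
Variable P : probability Omega R.

(* normal_prob m s has standard deviation s, but it is not the Dirac measure
   when s = 0. *)
Definition real_gaussian (U : Omega -> R) : Prop :=
  measurable_fun setT U /\
  exists m s : R, 0 <= s /\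
    forall B : set R, measurable B ->
      pushforward P U B = if s == 0 then \d_m B else normal_prob m s B.

Definition jointly_gaussian (U V : Omega -> R) : Prop :=
  forall a b : R, real_gaussian (fun w => a * U w + b * V w).

Definition gaussian {k : scalar_kind} : (Omega -> scalars k R) -> Prop :=
  match k return (Omega -> scalars k R) -> Prop with
  | RealScalars => real_gaussian
  | ComplexScalars => fun Z : Omega -> R[i] =>
      jointly_gaussian (fun w => complex.Re (Z w)) (fun w => complex.Im (Z w))
  end.

Definition expectationK {k : scalar_kind} :
    (Omega -> scalars k R) -> scalars k R :=
  match k return (Omega -> scalars k R) -> scalars k R with
  | RealScalars => fun Z => fine 'E_P[Z]
  | ComplexScalars => fun Z : Omega -> R[i] =>
      Complex (fine 'E_P[fun w => complex.Re (Z w)])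
              (fine 'E_P[fun w => complex.Im (Z w)])
  end.

Definition covarianceK {k : scalar_kind} (Y Z : Omega -> scalars k R) :
    scalars k R :=
  expectationK (fun w => (Y w - expectationK Y) * conjK (Z w - expectationK Z)).

Definition symmetric_rv {k : scalar_kind} : (Omega -> scalars k R) -> Prop :=
  match k return (Omega -> scalars k R) -> Prop with
  | RealScalars => fun Z => expectationK Z = 0
  | ComplexScalars => fun Z =>
      expectationK Z = 0 /\ expectationK (fun w => Z w ^+ 2) = 0
  end.

End RandomVariables.

Section RandomFields.
Context {k : scalar_kind} {R : realType} {H : normedModType (scalars k R)}.
Context {d : measure_display} {Omega : measurableType d}.
Variables (P : probability Omega R) (X : Omega -> H).

Definition random_field : Prop :=
  measurable_fun setT (X : Omega -> g_sigma_algebraType (@open H)).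

Definition gaussian_field : Prop :=
  random_field /\ forall f : dual H, gaussian P (fun w => f (X w)).

Definition symmetric_gaussian_field : Prop :=
  gaussian_field /\ forall f : dual H, symmetric_rv P (fun w => f (X w)).

Definition covariance_function (f g : dual H) : scalars k R :=
  covarianceK P (fun w => f (X w)) (fun w => g (X w)).

Definition nondegenerate_field : Prop :=
  forall f : dual H, f != 0 -> 0 < covariance_function f f.

End RandomFields.

(* Main.v *)
Require Import Defs.
From HB Require Import structures.
From mathcomp Require Import all_boot all_order all_algebra.
From mathcomp Require Import complex ring lra zify.
From mathcomp Require Import all_classical all_reals all_analysis.
From mathcomp Require Import measurable_realfun.

Set Implicit Arguments.
Unset Strict Implicit.
Unset Printing Implicit Defensive.

Import Order.TTheory GRing.Theory Num.Theory.
Import numFieldNormedType.Exports.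

Local Open Scope classical_set_scope.
Local Open Scope ring_scope.

(** The covariance of a symmetric field is a non-negative hermitian form on the
    dual, and the question is which of these forms occur.

    Covariance of a field.  The operator is forced: [A f] is the functional
    sending [y] to the covariance of [f] with the inner product against [y].
    Everything hinges on the trace, the sum over an orthonormal basis [e] of
    the variances of the coordinates of [X], being finite.  These
    coordinates are centred Gaussian variables whose squares sum to
    [|X w|^2], which is finite at each [w] but not known to be integrable.
    Since the fourth moment of a centred Gaussian variable is a fixed multiple
    of the square of its variance, a truncation of [|X|^2] on an event of
    small probability bounds the sum of the variances
    ([gaussian_square_sums_bounded]).  Boundedness of the form, hence of [A],
    follows from the integrability of [|X|^2], and [A] is its own absolute
    value ([covariance_operator]).

    Field with a given covariance.  The trace condition is about the absolute
    value of [A], so it must first be known that this is [A] itself when [A]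
    is non-negative: two non-negative bounded self-adjoint operators with the
    same square coincide ([nonnegative_root_unique]), because a bound on their
    difference always implies a strictly better one.  Hence
    [<A eps_n, eps_n>] is summable for some orthonormal basis [eps]
    ([trace_class_nonneg]); this basis need not diagonalize [A], so the
    coordinates of the field have to be correlated.  They are obtained from
    independent standard Gaussian variables by a Cholesky factorization of
    the form ([gaussian_process]).  The independent variables live on the
    space of fair coin tosses: a sequence of coins splits into two independent
    ones, hence into countably many ([fair_coins_split]), and each is turned
    into a Gaussian variable by a quantile function ([quantile_law]).  As the
    expected square sum of the coordinates is the trace, the series
    of the field converges almost surely; a functional of the field is a
    pointwise limit of finite combinations of the coordinates, so its law is
    the limit of centred Gaussian laws ([gauss_law_cvg]).

    Complex scalars are handled through real parts.  A scalar variable [Z] is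
    proper Gaussian as soon as every [Re (a Z)] is centred Gaussian with
    standard deviation proportional to [|a|] ([gaussian_of_real_parts]), and a
    hermitian form is determined by the real numbers it takes on the diagonal
    ([semi_inner_polarization]).  The real and imaginary coordinates of a
    scalar are the real parts of its products with the entries of [units],
    which makes both cases of the theorem instances of one computation.

    Once the covariance is [dual_ip (A f) g], non-degeneracy and positivity
    are the same condition. *)

(** * Integration against normal laws *)

Section NormalDensity.
Context {R : realType}.
Local Notation leb := (@lebesgue_measure R).

(** The density of [normal_prob] is also its Radon-Nikodym derivative, up to a
    null set, and integrals of non-negative functions change of variables
    along the latter. *)
Lemma ge0_integral_normal_prob (m s : R) (f : _ -> \bar R) :
  measurable_fun setT f -> (forall x, 0 <= f x)%E ->
  (\int[normal_prob m s]_x f x =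
   \int[leb]_x (f x * (normal_pdf m s x)%:E))%E.
Proof.
move=> mf f0.
have dom := normal_prob_dominates m s.
rewrite -(Radon_Nikodym_SigmaFinite.change_of_variables dom)//=.
have mpdf : measurable_fun setT (fun x => (normal_pdf m s x)%:E).
  by apply/measurable_EFinP; exact: measurable_normal_pdf.
have RNi := Radon_Nikodym_SigmaFinite.f_integrable dom.
apply: ae_eq_integral => //.
- by apply: emeasurable_funM => //; exact: (measurable_int _ RNi).
- exact: emeasurable_funM.
- apply: ae_eqe_mul2l => /=.
  apply: integral_ae_eq => //=.
  by move=> E _ mE; rewrite -Radon_Nikodym_SigmaFinite.f_integral.
Qed.

(** By uniqueness of Lebesgue measure: the rescaled image measure gives each
    half-open interval its length. *)
Lemma lebesgue_measure_affine (s m : R) (A : set R) : 0 < s -> measurable A ->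
  leb ((fun x => s * x + m) @^-1` A) = (s^-1%:E * leb A)%E.
Proof.
move=> s0 mA.
have maff : measurable_fun setT (fun x : measurableTypeR R => s * x + m : measurableTypeR R).
  by apply: measurable_funD => //; exact: measurable_funM.
pose mu1 : {measure set (measurableTypeR R) -> \bar R} :=
  mscale (NngNum (ltW s0)) (pushforward leb (fun x => s * x + m : measurableTypeR R)).
have H : leb A = mu1 maff A.
  apply: lebesgue_measure_unique => // _ [[a b]] _ <-.
  rewrite /mu1/= /pushforward /mscale/=.
  rewrite [X in (_ * leb X)%E](_ : _ = `](a - m) / s, (b - m) / s]%classic); last first.
    apply/seteqP; split => x /=; rewrite !in_itv/= ltr_pdivrMr// ler_pdivlMr//;
    by rewrite ltrBlDr lerBrDr mulrC.
  rewrite !lebesgue_measure_itv/= !lte_fin ltr_pM2r ?invr_gt0// ltrD2r.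
  case: ifPn => ab; last by rewrite mule0.
  by rewrite -EFinM; congr EFin; field; exact: lt0r_neq0.
rewrite H /mu1/= /pushforward /mscale/= muleA -EFinM mulVf ?mul1e//.
exact: lt0r_neq0.
Qed.

End NormalDensity.

Section NormalAffine.
Context {R : realType}.
Local Notation leb := (@lebesgue_measure R).
Local Notation gam := (@normal_prob R 0 1).

Lemma ge0_integral_affine (s m : R) (B : set R) (g : _ -> \bar R) :
  0 < s -> measurable B -> measurable_fun setT g -> (forall x, 0 <= g x)%E ->
  (\int[leb]_(x in B) g x =
   s%:E * \int[leb]_(x in (fun x => (s * x + m)%R) @^-1` B) g (s * x + m)%R)%E.
Proof.
move=> s0 mB mg g0.
have maff : measurable_fun setT (fun x : measurableTypeR R => s * x + m : measurableTypeR R).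
  by apply: measurable_funD => //; exact: measurable_funM.
pose mu1 : {measure set (measurableTypeR R) -> \bar R} :=
  mscale (NngNum (ltW s0)) (pushforward leb (fun x => s * x + m : measurableTypeR R)).
rewrite (eq_measure_integral (mu1 maff)); last first.
  move=> A mA _.
  have -> : mu1 maff A = (s%:E * leb ((fun x : R => s * x + m)%R @^-1` A))%E by [].
  rewrite lebesgue_measure_affine//.
  by rewrite muleA -EFinM divff ?mul1e// lt0r_neq0.
rewrite ge0_integral_mscale//=; last exact: measurable_funTS.
rewrite ge0_integral_pushforward//=; exact: measurable_funTS.
Qed.

Lemma normal_pdf_gt0E (m s x : R) : 0 < s -> normal_pdf m s x =
  (s * Num.sqrt (pi *+ 2))^-1 * expR (- (x - m) ^+ 2 / (s ^+ 2 *+ 2)).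
Proof.
move=> s0; rewrite normal_pdfE ?lt0r_neq0//; congr (_^-1 * _).
by rewrite -mulrnAr sqrtrM ?sqr_ge0// sqrtr_sqr gtr0_norm.
Qed.

Lemma normal_prob_affine (m s : R) (B : set R) : 0 < s -> measurable B ->
  normal_prob m s B = gam ((fun x => s * x + m) @^-1` B).
Proof.
move=> s0 mB; rewrite /normal_prob (@ge0_integral_affine s m)//; last 2 first.
  by apply/measurable_EFinP; exact: measurable_normal_pdf.
  by move=> x; rewrite lee_fin normal_pdf_ge0.
have maff : measurable_fun setT (fun x : measurableTypeR R => s * x + m : measurableTypeR R).
  by apply: measurable_funD => //; exact: measurable_funM.
have mf : measurable ((fun x => s * x + m) @^-1` B).
  by rewrite -[X in measurable X]setTI; exact: maff.
rewrite -ge0_integralZl//; last 3 first.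
- apply/measurable_EFinP; apply: measurable_funTS.
  by apply: measurableT_comp => //; exact: measurable_normal_pdf.
- by move=> x _; rewrite lee_fin normal_pdf_ge0.
- by rewrite lee_fin ltW.
apply: eq_integral => x _; rewrite -EFinM; congr EFin.
rewrite !normal_pdf_gt0E// expr1n mul1r invfM !mulrA divff ?mul1r ?lt0r_neq0//.
congr (_ * expR _); rewrite addrK subr0; field.
exact: lt0r_neq0.
Qed.

Lemma normal_probN (B : set R) : measurable B ->
  gam ((-%R : R -> R) @^-1` B) = gam B.
Proof.
move=> mB; rewrite /normal_prob.
have mN : measurable_fun setT (-%R : measurableTypeR R -> measurableTypeR R).
  exact: measurable_funN.
have mp : measurable_fun setT (fun x : R => (normal_pdf 0 1 x)%:E).
  by apply/measurable_EFinP; exact: measurable_normal_pdf.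
rewrite [RHS](eq_measure_integral (pushforward leb (-%R : measurableTypeR R -> measurableTypeR R))); last first.
  by move=> A mA _; rewrite -[LHS]lebesgue_measureN.
rewrite ge0_integral_pushforward//=; last 2 first.
  exact: measurable_funTS.
  by move=> x _; rewrite lee_fin normal_pdf_ge0.
apply: eq_integral => x _; congr EFin.
by rewrite !normal_pdf_gt0E// !subr0 sqrrN.
Qed.

(** Completing the square in [x]: the joint density of [x] and [z], where [z] is
    normal around [a x], factors into the law of [z] and the conditional law
    of [x]. *)
Lemma normal_pdf_convolution (a b x z : R) : 0 < b ->
  let s := Num.sqrt (a ^+ 2 + b ^+ 2) in
  normal_pdf 0 1 x * normal_pdf (a * x) b z =
  normal_pdf 0 s z * normal_pdf (a * z / s ^+ 2) (b / s) x.
Proof.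
move=> b0 s.
have s2 : s ^+ 2 = a ^+ 2 + b ^+ 2 by rewrite sqr_sqrtr// addr_ge0 ?sqr_ge0.
have s0 : 0 < s by rewrite sqrtr_gt0 ltr_wpDl ?sqr_ge0// exprn_gt0.
have bs0 : 0 < b / s by rewrite divr_gt0.
rewrite !normal_pdf_gt0E// expr1n mul1r mulrACA [RHS]mulrACA -!expRD.
congr (_ * expR _).
  set q := Num.sqrt _.
  have q0 : q != 0 by rewrite lt0r_neq0// sqrtr_gt0 mulrn_wgt0// pi_gt0.
  by field; rewrite q0 !lt0r_neq0.
rewrite exprMn exprVn s2; field.
by rewrite -s2 !lt0r_neq0// exprn_gt0.
Qed.

(** A combination of two independent standard normal variables is normal.
    Condition on the first one, exchange the integrals and integrate out the
    conditional density given by [normal_pdf_convolution]. *)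
Lemma normal_prob_convolution (a b : R) (B : set R) : 0 < b -> measurable B ->
  (gam \x gam)%E [set xy | B (a * xy.1 + b * xy.2)] =
  gam ((fun z => Num.sqrt (a ^+ 2 + b ^+ 2) * z) @^-1` B).
Proof.
move=> b0 mB; set s := Num.sqrt _.
have s0 : 0 < s by rewrite sqrtr_gt0 ltr_wpDl ?sqr_ge0// exprn_gt0.
have fE (x z : R) : b * z + a * x = a * x + b * z by rewrite addrC.
set S := [set xy | _].
have mS : measurable S.
  have mS' : measurable_fun [set: R * R] (fun xy : R * R => a * xy.1 + b * xy.2).
    by apply: measurable_funD; exact: measurable_funM.
  by have := mS' measurableT _ mB; rewrite setTI.
have xsE x : normal_prob (a * x) b B = gam (xsection S x).
  rewrite normal_prob_affine//; congr (gam _).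
  by apply/seteqP; split => y; rewrite /xsection/= ?inE/= fE.
transitivity (\int[gam]_x normal_prob (a * x) b B)%E.
  by apply: eq_integral => x _; rewrite xsE.
pose F (xz : R * R) := (\1_B xz.2 * normal_pdf (a * xz.1) b xz.2 * normal_pdf 0 1 xz.1)%:E.
have mF : measurable_fun setT F.
  apply/measurable_EFinP; apply: measurable_funM; last first.
    by apply: measurableT_comp => //; exact: measurable_normal_pdf.
  apply: measurable_funM.
    by apply: measurableT_comp => //; exact: measurable_indic.
  rewrite (_ : (fun _ => _) = (fun xz : R * R => (b * Num.sqrt (pi *+ 2))^-1 *
     expR (- (xz.2 - a * xz.1) ^+ 2 / (b ^+ 2 *+ 2)))); last first.
    by apply/funext => xz; rewrite normal_pdf_gt0E.
  apply: measurable_funM => //; apply: measurableT_comp => //.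
  apply: measurable_funM => //; apply: measurableT_comp => //.
  apply: measurable_funX; apply: measurable_funB => //.
  exact: measurable_funM.
have F0 xz : (0 <= F xz)%E.
  by rewrite lee_fin !mulr_ge0// normal_pdf_ge0.
have E1 (x : R) : (normal_prob (a * x) b B * (normal_pdf 0 1 x)%:E = \int[leb]_z F (x, z))%E.
  rewrite /normal_prob muleC -ge0_integralZl//=; last 3 first.
  - apply/measurable_EFinP; apply: measurable_funTS; exact: measurable_normal_pdf.
  - by move=> z _; rewrite lee_fin normal_pdf_ge0.
  - by rewrite lee_fin normal_pdf_ge0.
  rewrite integral_mkcond; apply: eq_integral => z _.
  rewrite patchE /F/= indicE; case: ifPn => _; rewrite ?mul0r// mul1r.
  by rewrite -EFinM mulrC.
transitivity (\int[leb]_x \int[leb]_z F (x, z))%E.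
  rewrite ge0_integral_normal_prob//.
    by apply: eq_integral => x _; rewrite E1.
  rewrite (_ : (fun _ => _) = gam \o xsection S); last exact/funext.
  exact: measurable_fun_xsection.
transitivity (\int[leb]_z \int[leb]_x F (x, z))%E.
  exact: (@fubini_tonelli _ _ _ _ _ leb leb F).
transitivity (normal_prob 0 s B); last first.
  rewrite (@normal_prob_affine 0 s)//; congr (gam _).
  by apply/seteqP; split => y /=; rewrite addr0.
rewrite /normal_prob [RHS]integral_mkcond; apply: eq_integral => z _.
rewrite /F patchE/= -/s.
under eq_integral do rewrite -mulrA [normal_pdf (a * _) _ _ * _]mulrC normal_pdf_convolution// -/s mulrA EFinM.
rewrite ge0_integralZl//=; last 3 first.
- by apply/measurable_EFinP; exact: measurable_normal_pdf.
- by move=> x _; rewrite lee_fin normal_pdf_ge0.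
- by rewrite lee_fin mulr_ge0// normal_pdf_ge0.
rewrite integral_normal_pdf mule1 indicE; case: ifPn => _; rewrite ?mul0r ?mul1r//.
Qed.

End NormalAffine.

(** * Moments of the standard normal law *)

Section NormalMoments.
Context {R : realType}.
Local Notation leb := (@lebesgue_measure R).
Local Notation gam := (@normal_prob R 0 1).

Lemma measurable_expR_sqr :
  measurable_fun setT (fun x : R => expR (x ^+ 2 / 4)).
Proof.
apply: measurableT_comp; first exact: measurable_expR.
by apply: measurable_funM; [exact: measurable_funX|exact: measurable_cst].
Qed.

(** The integrand times the standard normal density is a multiple of the
    density of the normal law of variance [2]. This exponential moment is
    what makes the second and fourth moments finite. *)
Lemma normal_integral_expR_sqr :
  (\int[gam]_x (expR (x ^+ 2 / 4))%:E = (Num.sqrt 2)%:E)%E.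
Proof.
rewrite ge0_integral_normal_prob//; last first.
  by apply/measurable_EFinP; exact: measurable_expR_sqr.
have s2 : 0 < Num.sqrt 2 :> R by rewrite sqrtr_gt0.
transitivity (\int[leb]_x ((Num.sqrt 2)%:E * (normal_pdf 0 (Num.sqrt 2) x)%:E))%E.
  apply: eq_integral => x _; rewrite -!EFinM; congr EFin.
  rewrite !normal_pdf_gt0E// mul1r mulrCA -expRD invfM !mulrA divff ?lt0r_neq0// mul1r.
  congr (_ * expR _); rewrite subr0 sqr_sqrtr// expr1n !mulr2n; by field.
rewrite ge0_integralZl//; last 2 first.
- by apply/measurable_EFinP; exact: measurable_normal_pdf.
- by move=> x _; rewrite lee_fin normal_pdf_ge0.
by rewrite integral_normal_pdf mule1.
Qed.

Lemma expr4_le_expR (x : R) : x ^+ 4 <= 64 * expR (x ^+ 2 / 4).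
Proof.
have -> : x ^+ 2 / 4 = x ^+ 2 / 8 + x ^+ 2 / 8 by field.
have h := expR_ge1Dx (x ^+ 2 / 8); have h2 := sqr_ge0 x.
rewrite expRD -[x ^+ 4]/(x ^+ (2 * 2)%N) exprM; nra.
Qed.

Lemma normal_moment4_lty : (\int[gam]_x (x ^+ 4)%:E < +oo)%E.
Proof.
apply: (@le_lt_trans _ _ (\int[gam]_x (64%:E * (expR (x ^+ 2 / 4))%:E))%E).
  apply: ge0_le_integral => //.
  - by move=> x _; rewrite lee_fin exprn_even_ge0.
  - by apply/measurable_EFinP; exact: measurable_funX.
  - apply/measurable_EFinP; apply: measurable_funM; first exact: measurable_cst.
    exact: measurable_expR_sqr.
  - by move=> x _; rewrite -EFinM lee_fin expr4_le_expR.
rewrite ge0_integralZl//; first by rewrite normal_integral_expR_sqr -EFinM ltry.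
by apply/measurable_EFinP; exact: measurable_expR_sqr.
Qed.

(** The moments are [1] and [3]. They are kept as names because finiteness and
    [0 < normal_moment2] carry all arguments, which avoids computing integrals. *)
Definition normal_moment2 : R := fine (\int[gam]_x (x ^+ 2)%:E).
Definition normal_moment4 : R := fine (\int[gam]_x (x ^+ 4)%:E).

Lemma normal_moment4E : (\int[gam]_x (x ^+ 4)%:E = normal_moment4%:E)%E.
Proof.
rewrite fineK// ge0_fin_numE ?normal_moment4_lty//.
by apply: integral_ge0 => x _; rewrite lee_fin exprn_even_ge0.
Qed.

Lemma normal_moment2E : (\int[gam]_x (x ^+ 2)%:E = normal_moment2%:E)%E.
Proof.
rewrite fineK// ge0_fin_numE; last first.
  by apply: integral_ge0 => x _; rewrite lee_fin sqr_ge0.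
apply: (@le_lt_trans _ _ (\int[gam]_x (1 + (x ^+ 4)%:E))%E).
  apply: ge0_le_integral => //.
  - by move=> x _; rewrite lee_fin sqr_ge0.
  - by apply/measurable_EFinP; exact: measurable_funX.
  - apply: emeasurable_funD => //.
    by apply/measurable_EFinP; exact: measurable_funX.
  - move=> x _; rewrite -EFinD lee_fin -[x ^+ 4]/(x ^+ (2 * 2)%N) exprM.
    have := sqr_ge0 x; nra.
rewrite ge0_integralD//=; last 2 first.
- by move=> x _; rewrite lee_fin exprn_even_ge0.
- by apply/measurable_EFinP; exact: measurable_funX.
rewrite integral_cst// [X in (_ * X)%E]probability_setT mule1 normal_moment4E.
by rewrite -EFinD ltry.
Qed.

Lemma normal_moment4_ge0 : 0 <= normal_moment4.
Proof.
by rewrite -lee_fin -normal_moment4E integral_ge0// => x _; rewrite lee_fin exprn_even_ge0.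
Qed.

(** Otherwise [x ^+ 2] would vanish almost everywhere, and the normal law would
    be carried by a point, which is Lebesgue-negligible. *)
Lemma normal_moment2_gt0 : 0 < normal_moment2.
Proof.
rewrite lt0r -!lee_fin -normal_moment2E integral_ge0 ?andbT//; last first.
  by move=> x _; rewrite lee_fin sqr_ge0.
apply/eqP => n0.
have m2 : measurable_fun setT (fun x : R => (x ^+ 2)%:E).
  by apply/measurable_EFinP; exact: measurable_funX.
have I0 : (\int[gam]_x `|(x ^+ 2)%:E| = 0)%E.
  transitivity (\int[gam]_x (x ^+ 2)%:E)%E; last by rewrite normal_moment2E n0.
  by apply: eq_integral => x _; rewrite gee0_abs// lee_fin sqr_ge0.
have [N [mN N0 sN]] := (@ae_eq_integral_abs _ _ _ gam setT measurableT _ m2).1 I0.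
have g0 : gam [set 0 : R] = 0%E.
  have /null_content_dominatesP H := @normal_prob_dominates R 0 1.
  by apply: H => //; exact: lebesgue_measure_set1.
have : (gam (N `|` [set (0%R : R)]) <= 0)%E.
  apply: (@le_trans _ _ (gam N + gam [set (0%R : R)])%E).
    by apply: (measureU2 gam) => //; exact: measurable_set1.
  by rewrite N0 g0 adde0.
rewrite (_ : N `|` _ = setT) ?probability_setT; first by rewrite lee_fin ler10.
apply/seteqP; split => // x _ /=.
have [->|x0] := eqVneq x 0; first by right.
left; apply: sN => /= /(_ I) /eqP; rewrite eqe sqrf_eq0 (negbTE x0)//.
Qed.

End NormalMoments.

(** * Centred Gaussian laws *)

Definition mfun_of d d' (T : measurableType d) (T' : measurableType d')
  (f : T -> T') (mf : measurable_fun setT f) : {mfun T >-> T'} :=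
  mfun_Sub (mem_set mf).

Section WeakLimits.
Context {R : realType}.

Lemma probability_eq_cdf (m1 m2 : probability (measurableTypeR R) R) :
  (forall t, m1 `]-oo, t]%classic = m2 `]-oo, t]%classic) ->
  forall B, measurable B -> m1 B = m2 B.
Proof.
move=> h B mB.
pose G : set (set (measurableTypeR R)) := [set A | exists x : R, A = `]x, +oo[%classic].
pose g : (set (measurableTypeR R))^nat := fun n => `](- (n%:R : R)), +oo[%classic.
refine (@measure_unique _ R (measurableTypeR R) G g _ _ _ _ m1 m2 _ _ B mB).
- exact: RGenOInfty.measurableE.
- move=> _ _ [x ->] [y ->]; exists (Num.max x y); apply/seteqP; split => z /=.
    by rewrite !in_itv/= !andbT gt_max => -[-> ->].
  by rewrite !in_itv/= !andbT gt_max => /andP[-> ->].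
- by move=> i; exists (- i%:R).
- apply/seteqP; split => // x _; exists (Num.truncn `|x|).+1 => //=.
  rewrite /g/= in_itv/= andbT ltrNl.
  by rewrite (le_lt_trans _ (truncnS_gt _))// -normrN ler_norm.
- move=> A [t ->].
  have E (m : probability (measurableTypeR R) R) :
      m `]t, +oo[%classic = (1 - m `]-oo, t]%classic)%E.
    by rewrite -probability_setC// setCitvl.
  by rewrite [LHS]E [RHS]E h.
- by move=> k; apply: (le_lt_trans (probability_le1 m1 _)); [exact: measurable_itv|exact: ltry].
Qed.

(** The indicator of a closed half-line is the decreasing limit of the powers of
    a continuous function that is [1] on it and less than [1] elsewhere. *)
Lemma probability_eq_continuous (m1 m2 : probability (measurableTypeR R) R) :
  (forall g : R -> R, continuous g -> (forall x, 0 <= g x <= 1) ->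
    (\int[m1]_x (g x)%:E = \int[m2]_x (g x)%:E)%E) ->
  forall B, measurable B -> m1 B = m2 B.
Proof.
move=> h; apply: probability_eq_cdf => t.
(* equal to 1 up to t, and to a decreasing exponential afterwards *)
pose q (x : R) := expR (- ((x - t) + `|x - t|)).
have q01 x : 0 < q x <= 1.
  rewrite expR_gt0/= -[leRHS]expR0 ler_expR oppr_le0.
  by have := ler_norm (- (x - t)); rewrite normrN -subr_ge0 opprK addrC.
have cq : continuous q.
  move=> x; apply: (cvg_comp _ expR); last exact: continuous_expR.
  have ctx : (y - t) @[y --> x] --> x - t.
    by apply: (@cvgB _ R^o); [exact: cvg_id|exact: cvg_cst].
  apply: (@cvgN _ R^o); apply: (@cvgD _ R^o) => //.
  exact: (@cvg_norm _ R^o).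
have mq : measurable_fun setT q by exact: continuous_measurable_fun.
have lim_m (m : probability (measurableTypeR R) R) :
    (\int[m]_x ((q x) ^+ n)%:E @[n --> \oo] --> m `]-oo, t]%classic)%E.
  have [] := @dominated_convergence _ _ _ m setT measurableT
    (fun n x => ((q x) ^+ n)%:E) (fun x => (\1_`]-oo, t]%classic x)%:E) (cst 1%E).
  - by move=> n; apply/measurable_EFinP; exact: measurable_funX.
  - by apply/measurable_EFinP; exact: measurable_indic.
  - apply: aeW => /= x _; apply: cvg_EFin; first by near=> n.
    rewrite /comp/= indicE mem_setE in_itv/=.
    have [xt|tx] := leP x t.
      have -> : q x = 1 by rewrite /q ler0_norm ?subr_le0// subrr oppr0 expR0.
      rewrite (_ : (fun _ => _) = cst 1); first exact: cvg_cst.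
      by apply/funext => n; rewrite expr1n.
    apply: cvg_expr; rewrite ger0_norm; last by case/andP: (q01 x) => /ltW.
    by rewrite -[ltRHS]expR0 ltr_expR oppr_lt0 addr_gt0 ?normr_gt0 ?subr_gt0 ?subr_eq0 ?gt_eqF.
  - exact: finite_measure_integrable_cst.
  - apply: aeW => /= x n _; have /andP[q0 q1] := q01 x.
    by rewrite lee_fin ger0_norm ?exprn_ge0 ?exprn_ile1 ?(ltW q0).
  by move=> _ _; rewrite integral_indic// setIT.
suff E : (fun n => \int[m1]_x (q x ^+ n)%:E)%E = (fun n => \int[m2]_x (q x ^+ n)%:E)%E.
  by have := lim_m m1; rewrite E => l1; exact: (cvg_unique _ l1 (lim_m m2)).
apply/funext => n; apply: (h (fun x => q x ^+ n)).
  move=> x; apply: (cvg_comp q (fun y => y ^+ n)); first exact: cq.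
  exact: exprn_continuous.
move=> x; have /andP[q0 q1] := q01 x.
by rewrite exprn_ge0 ?exprn_ile1 ?(ltW q0).
Unshelve. all: by end_near.
Qed.

End WeakLimits.

Section GaussLaw.
Context {R : realType} {d : measure_display} {T : measurableType d}.
Variable P : probability T R.
Local Notation gam := (@normal_prob R 0 1).

(** The law of [s] times a standard normal variable. Unlike [normal_prob 0 s],
    this is the Dirac measure when [s = 0], so degenerate variables need no
    case distinction and such laws are closed under limits. *)
Definition gauss_law (U : T -> R) (s : R) : Prop :=
  measurable_fun setT U /\
  forall B, measurable B -> P (U @^-1` B) = gam ((fun x => s * x) @^-1` B).

Lemma measurable_scale (s : R) :
  @measurable_fun _ _ (measurableTypeR R) (measurableTypeR R) setT (fun x => s * x).
Proof. exact: measurable_funM. Qed.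

Lemma ge0_integral_gauss_law (U : T -> R) (s : R) (f : R -> \bar R) :
  gauss_law U s -> measurable_fun [set: measurableTypeR R] f -> (forall x, 0 <= f x)%E ->
  (\int[P]_w f (U w) = \int[gam]_x f (s * x)%R)%E.
Proof.
move=> [mU lU] mf f0.
have mU' : @measurable_fun _ _ T (measurableTypeR R) setT U by exact: mU.
pose p1 := distribution P (@mfun_of _ _ T (measurableTypeR R) U mU').
pose p2 := distribution gam (@mfun_of _ _ (measurableTypeR R) (measurableTypeR R) _ (@measurable_scale s)).
transitivity (\int[p1]_x f x)%E; first by rewrite ge0_integral_distribution.
transitivity (\int[p2]_x f x)%E; last by rewrite ge0_integral_distribution.
by apply: eq_measure_integral => A mA _; exact: lU.
Qed.

Lemma gauss_law_ae (U V : T -> R) (s : R) : gauss_law U s ->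
  measurable_fun setT V -> {ae P, forall w, U w = V w} -> gauss_law V s.
Proof.
move=> [mU lU] mV UV; split=> // B mB; rewrite -lU//.
have mUB : measurable (U @^-1` B) by rewrite -[X in measurable X]setTI; exact: mU.
have mVB : measurable (V @^-1` B) by rewrite -[X in measurable X]setTI; exact: mV.
have ind (S : set T) : measurable S -> P S = (\int[P]_w (\1_S w)%:E)%E.
  by move=> mS; rewrite integral_indic// setIT.
rewrite !ind//; apply: ae_eq_integral => //.
- by apply/measurable_EFinP; exact: measurable_indic.
- by apply/measurable_EFinP; exact: measurable_indic.
apply: filterS UV => w UVw _; rewrite !indicE; congr ((nat_of_bool _)%:R)%:E.
by apply/idP/idP; rewrite !inE/= UVw.
Qed.

(** Expectations of bounded continuous functions pass to the limit on both sides
    by dominated convergence: along [U_] under [P], and along [s_ n * x] under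
    the standard normal law. They determine the limit law. *)
Lemma gauss_law_cvg (U_ : nat -> T -> R) (U : T -> R) (s_ : nat -> R) (s : R) :
  (forall n, gauss_law (U_ n) (s_ n)) -> measurable_fun setT U ->
  (forall w, U_ n w @[n --> \oo] --> U w) ->
  s_ n @[n --> \oo] --> s -> gauss_law U s.
Proof.
move=> lU mU UU ss; split=> //.
have mU' : @measurable_fun _ _ T (measurableTypeR R) setT U by exact: mU.
pose p1 := distribution P (@mfun_of _ _ T (measurableTypeR R) U mU').
pose p2 := distribution gam (@mfun_of _ _ (measurableTypeR R) (measurableTypeR R) _ (@measurable_scale s)).
have dom (d' : measure_display) (T' : measurableType d') (p : probability T' R)
   (V_ : nat -> T' -> R) (V : T' -> R) (g : R -> R) : continuous g ->
  (forall x, 0 <= g x <= 1) ->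
  (forall n, measurable_fun setT (V_ n)) -> measurable_fun setT V ->
  (forall w, V_ n w @[n --> \oo] --> V w) ->
  (\int[p]_x (g (V_ n x))%:E @[n --> \oo] --> \int[p]_x (g (V x))%:E)%E.
  move=> cg g01 mV_ mV cV.
  have mg : measurable_fun setT g by exact: continuous_measurable_fun.
  have [] // := @dominated_convergence _ _ _ p setT measurableT
    (fun n x => (g (V_ n x))%:E) (fun x => (g (V x))%:E) (cst 1%E).
  - by move=> n; apply/measurable_EFinP; exact: measurableT_comp.
  - by apply/measurable_EFinP; exact: measurableT_comp.
  - apply: aeW => /= x _; apply: cvg_EFin; first by near=> n.
    by apply: (cvg_comp (V_ ^~ x) g (cV x)); exact: cg.
  - exact: finite_measure_integrable_cst.
  - apply: aeW => /= x n _; have /andP[q0 q1] := g01 (V_ n x).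
    by rewrite lee_fin ger0_norm.
suff H : forall B, measurable B -> p1 B = p2 B by exact: H.
apply: probability_eq_continuous => g cg g01.
have mg : measurable_fun setT g by exact: continuous_measurable_fun.
have mgE : measurable_fun [set: measurableTypeR R] (EFin \o g) by exact/measurable_EFinP.
rewrite /p1 /p2 !ge0_integral_distribution//=; last 2 first.
  by move=> x; rewrite lee_fin; case/andP: (g01 x).
  by move=> x; rewrite lee_fin; case/andP: (g01 x).
have h1 := dom _ _ P U_ U g cg g01 (fun n => (lU n).1) mU UU.
have h2 : (\int[gam]_x (g (s_ n * x)%R)%:E @[n --> \oo] --> \int[gam]_x (g (s * x)%R)%:E)%E.
  have cvs (x : R) : s_ n * x @[n --> \oo] --> s * x.
    by apply: cvgM => //; exact: cvg_cst.
  exact: (dom _ (measurableTypeR R) gam (fun n x => s_ n * x) (fun x => s * x) g cg g01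
    (fun n => @measurable_scale (s_ n)) (@measurable_scale s) cvs).
suff E : (fun n => \int[P]_w (g (U_ n w))%:E)%E = (fun n => \int[gam]_x (g (s_ n * x)%R)%:E)%E.
  by rewrite E in h1; exact: (cvg_unique _ h1 h2).
apply/funext => n; apply: (ge0_integral_gauss_law (f := EFin \o g) (lU n)) => //.
by move=> x; rewrite lee_fin; case/andP: (g01 x).
Unshelve. all: by end_near.
Qed.

End GaussLaw.

(** * Moments of centred Gaussian variables *)

Section SquareIntegrable.
Context {R : realType} {d : measure_display} {T : measurableType d}.
Variable P : probability T R.

Definition square_integrable (U : T -> R) : Prop :=
  measurable_fun setT U /\ (\int[P]_w (U w ^+ 2)%:E < +oo)%E.

Lemma square_integrableM (U V : T -> R) : square_integrable U ->
  square_integrable V -> P.-integrable setT (fun w => (U w * V w)%:E).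
Proof.
move=> [mU U2] [mV V2]; apply/integrableP; split.
  by apply/measurable_EFinP; exact: measurable_funM.
apply: (@le_lt_trans _ _ (\int[P]_w ((U w ^+ 2)%:E + (V w ^+ 2)%:E))%E).
  apply: ge0_le_integral => //.
  - by apply: measurableT_comp => //; apply/measurable_EFinP; exact: measurable_funM.
  - by apply: emeasurable_funD; apply/measurable_EFinP; exact: measurable_funX.
  - move=> w _; rewrite -EFinD lee_fin normrM.
    rewrite -[X in _ <= X + _]real_normK ?num_real// -[X in _ <= _ + X]real_normK ?num_real//.
    have := normr_ge0 (U w); have := normr_ge0 (V w); nra.
rewrite ge0_integralD//.
- by rewrite lte_add_pinfty.
- by move=> w _; rewrite lee_fin sqr_ge0.
- by apply/measurable_EFinP; exact: measurable_funX.
- by move=> w _; rewrite lee_fin sqr_ge0.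
- by apply/measurable_EFinP; exact: measurable_funX.
Qed.

Lemma square_integrable_cst (c : R) : square_integrable (cst c).
Proof.
split; first exact: measurable_cst.
rewrite (eq_integral (cst (c ^+ 2)%:E))//.
by rewrite integral_cst//= [X in (_ * X)%E]probability_setT mule1 ltry.
Qed.

Lemma square_integrable1 (U : T -> R) : square_integrable U ->
  P.-integrable setT (fun w => (U w)%:E).
Proof.
move=> sU; have := square_integrableM sU (square_integrable_cst 1).
by under eq_fun do rewrite /cst/= mulr1.
Qed.

End SquareIntegrable.

Section GaussMoments.
Context {R : realType} {d : measure_display} {T : measurableType d}.
Variable P : probability T R.
Local Notation gam := (@normal_prob R 0 1).

Lemma gauss_law_moment2 (U : T -> R) (s : R) : gauss_law P U s ->
  (\int[P]_w (U w ^+ 2)%:E = (s ^+ 2 * normal_moment2)%:E)%E.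
Proof.
move=> lU.
have m2 : measurable_fun [set: measurableTypeR R] (fun x : R => (x ^+ 2)%:E).
  by apply/measurable_EFinP; exact: measurable_funX.
rewrite (ge0_integral_gauss_law (f := fun x => (x ^+ 2)%:E) lU)//; last first.
  by move=> x; rewrite lee_fin sqr_ge0.
under eq_integral do rewrite exprMn EFinM.
rewrite ge0_integralZl//.
- by rewrite normal_moment2E.
- by move=> x _; rewrite lee_fin sqr_ge0.
- by rewrite lee_fin sqr_ge0.
Qed.

Lemma gauss_law_moment4 (U : T -> R) (s : R) : gauss_law P U s ->
  (\int[P]_w (U w ^+ 4)%:E = (s ^+ 4 * normal_moment4)%:E)%E.
Proof.
move=> lU.
have m2 : measurable_fun [set: measurableTypeR R] (fun x : R => (x ^+ 4)%:E).
  by apply/measurable_EFinP; exact: measurable_funX.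
rewrite (ge0_integral_gauss_law (f := fun x => (x ^+ 4)%:E) lU)//; last first.
  by move=> x; rewrite lee_fin exprn_even_ge0.
under eq_integral do rewrite exprMn EFinM.
rewrite ge0_integralZl//.
- by rewrite normal_moment4E.
- by move=> x _; rewrite lee_fin exprn_even_ge0.
- by rewrite lee_fin exprn_even_ge0.
Qed.

Lemma gauss_law_square_integrable (U : T -> R) (s : R) : gauss_law P U s ->
  square_integrable P U.
Proof. by move=> lU; split; [case: lU|rewrite (gauss_law_moment2 lU) ltry]. Qed.

Lemma gauss_lawN (U : T -> R) (s : R) : gauss_law P U s ->
  gauss_law P (fun w => - U w) s.
Proof.
move=> [mU lU]; split; first exact: measurable_funN.
move=> B mB.
have mNB : measurable ((-%R : R -> R) @^-1` B).
  by rewrite -[X in measurable X]setTI; exact: (@measurable_funN _ _ _ setT id).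
rewrite -[LHS]/(P (U @^-1` ((-%R : R -> R) @^-1` B))) lU//.
rewrite -[RHS]normal_probN//; last first.
  by rewrite -[X in measurable X]setTI; exact: (measurable_scale s).
apply: (congr1 gam); apply/seteqP; split => x /=; by rewrite mulrN.
Qed.

(** A centred Gaussian variable and its opposite have the same law, hence
    positive and negative parts have the same integral. *)
Lemma gauss_law_mean (U : T -> R) (s : R) : gauss_law P U s ->
  (\int[P]_w (U w)%:E = 0)%E.
Proof.
move=> lU; have iU := square_integrable1 (gauss_law_square_integrable lU).
(* the law only determines integrals of non-negative functions of U, so both
   parts of the integral are expressed through the positive part f *)
pose f (x : R) : \bar R := (Num.max x 0)%:E.
have mf : measurable_fun [set: measurableTypeR R] f.
  by apply/measurable_EFinP; exact: measurable_maxr.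
have f0 x : (0 <= f x)%E by rewrite lee_fin le_max lexx orbT.
have e1 := ge0_integral_gauss_law lU mf f0.
have e2 := ge0_integral_gauss_law (gauss_lawN lU) mf f0.
rewrite integralE.
have -> : (\int[P]_w ((fun w => (U w)%:E)^\+ w) = \int[P]_w f (U w))%E.
  by apply: eq_integral => w _; rewrite /f funeposE EFin_max.
have -> : (\int[P]_w ((fun w => (U w)%:E)^\- w) = \int[P]_w f (- U w)%R)%E.
  by apply: eq_integral => w _; rewrite /f funenegE EFin_max.
rewrite e1 e2 -e1 subee//.
have -> : (\int[P]_w f (U w) = \int[P]_w ((fun w => (U w)%:E)^\+ w))%E.
  by apply: eq_integral => w _; rewrite /f funeposE EFin_max.
exact: integrable_pos_fin_num.
Qed.

Lemma real_gaussian_centered (U : T -> R) : real_gaussian P U ->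
  fine 'E_P[U] = 0 -> exists2 s, 0 <= s & gauss_law P U s.
Proof.
move=> [mU [m [s [s0 lU]]]] EU.
have lUm : gauss_law P (fun w => U w - m) s.
  split; first exact: measurable_funB.
  move=> B mB.
  have mBm : measurable ((fun y : R => y - m) @^-1` B).
    by rewrite -[X in measurable X]setTI; exact: (@measurable_funB _ _ _ setT id (cst m)).
  rewrite -[LHS]/(pushforward P U ((fun y : R => y - m) @^-1` B)) lU//.
  case: eqVneq => [->|s1].
    rewrite diracE; have [mB'|mB'] := boolP (_ \in _).
      rewrite (_ : _ @^-1` _ = setT) ?probability_setT//.
      apply/seteqP; split => // x _ /=; move: mB'; rewrite inE/= subrr mul0r//.
    rewrite (_ : _ @^-1` _ = set0) ?measure0//.
    apply/seteqP; split => // x /=; rewrite mul0r => B0; move: mB'.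
    by rewrite notin_setE/= subrr.
  rewrite normal_prob_affine// ?lt_def ?s1//; congr (gam _).
  by apply/seteqP; split => x /=; rewrite addrK.
have iUm := square_integrable1 (gauss_law_square_integrable lUm).
suff m0 : m = 0.
  by exists s => //; move: lUm; rewrite m0; under eq_fun do rewrite subr0.
move: EU; rewrite unlock.
have -> : (\int[P]_w (U w)%:E = \int[P]_w ((U w - m)%:E + (cst m%:E w)))%E.
  by apply: eq_integral => w _; rewrite -EFinD subrK.
rewrite integralD//; last exact: finite_measure_integrable_cst.
by rewrite (gauss_law_mean lUm) integral_cst// [X in (_ * X)%E]probability_setT mule1 add0e.
Qed.

Lemma gauss_law_real_gaussian (U : T -> R) (s : R) : 0 <= s ->
  gauss_law P U s -> real_gaussian P U.
Proof.
move=> s0 [mU lU]; split=> //; exists 0, s; split=> // B mB.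
rewrite /pushforward lU//; case: eqVneq => [->|s1].
  rewrite diracE; have [mB'|mB'] := boolP (_ \in _).
    rewrite (_ : _ @^-1` _ = setT) ?probability_setT//.
    by apply/seteqP; split => // x _ /=; move: mB'; rewrite inE/= mul0r.
  rewrite (_ : _ @^-1` _ = set0) ?measure0//.
  apply/seteqP; split => // x /=; rewrite mul0r => B0; move: mB'.
  by rewrite notin_setE.
rewrite [RHS]normal_prob_affine// ?lt_def ?s1//; congr (gam _).
by apply/seteqP; split => x /=; rewrite addr0.
Qed.

End GaussMoments.

(** * Binary digits *)

Section BinaryDigits.
Context {R : realType}.
Implicit Types (u : R) (c w : nat -> bool) (n : nat).

(** The fractional part of [2 ^+ n * u], for [u] in the unit interval, computed by
    iterating the doubling map. *)
Fixpoint bin_rest n u : R :=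
  if n is n'.+1 then 2 * bin_rest n' u - ((1 / 2 <= bin_rest n' u)%R)%:R else u.

Definition bin_digit u n : bool := 1 / 2 <= bin_rest n u.

Fixpoint bin_value n c : R :=
  if n is n'.+1 then bin_value n' c + (c n')%:R / 2 ^+ n'.+1 else 0.

Lemma eq_bin_value n c w : (forall i, (i < n)%N -> c i = w i) ->
  bin_value n c = bin_value n w.
Proof.
elim: n => //= n ih h; rewrite ih ?h// => i ni; apply: h; exact: ltnW.
Qed.

Lemma bin_rest_itv n u : 0 <= u < 1 -> 0 <= bin_rest n u < 1.
Proof.
move=> u01; elim: n => //= n /andP[r0 r1].
case: (lerP (1 / 2) (bin_rest n u)) => h /=; lra.
Qed.

Lemma bin_digitsK n u : u = bin_value n (bin_digit u) + bin_rest n u / 2 ^+ n.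
Proof.
elim: n => [|n {1}->]/=; first by rewrite add0r expr0 divr1.
rewrite -addrA; congr (_ + _); rewrite -/(bin_digit u n) exprS; field.
by rewrite expf_neq0.
Qed.

(** The numbers with prescribed first [n] digits form a dyadic interval of
    length [2 ^- n]: this is what makes the digits of a uniform variable fair
    coins. *)
Lemma bin_digits_itv n u w : 0 <= u < 1 ->
  (forall i, (i < n)%N -> bin_digit u i = w i) <->
  bin_value n w <= u < bin_value n w + (2 ^+ n)^-1.
Proof.
move=> u01; split.
  move=> h; have := bin_digitsK n u; rewrite (eq_bin_value h) => {1 2}->.
  have /andP[r0 r1] := bin_rest_itv n u01.
  have p0 : 0 < (2 ^+ n)^-1 :> R by rewrite invr_gt0 exprn_gt0.
  by rewrite lerDl ltrD2l mulr_ge0 ?(ltW p0)//= -[ltRHS]mul1r ltr_pM2r.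
elim: n w => //= n ih w; rewrite exprS invfM => /andP[l1 l2].
have p0 : 0 < (2 ^+ n)^-1 :> R by rewrite invr_gt0 exprn_gt0.
have hn : forall i, (i < n)%N -> bin_digit u i = w i.
  by apply: ih; move: l1 l2; case: (w n) => /=; lra.
have uE := bin_digitsK n u; rewrite (eq_bin_value hn) in uE.
move=> i; rewrite ltnS leq_eqVlt => /orP[/eqP ->|]; last exact: hn.
rewrite /bin_digit; set r := bin_rest n u in uE *; set v := bin_value n w in uE l1 l2.
move: l1 l2; rewrite uE; set p := (2 ^+ n)^-1 in p0 *.
case: (w n) => /= l1 l2.
  by apply/idP; rewrite -(ler_pM2r p0); lra.
by apply/negbTE; rewrite -ltNge -(ltr_pM2r p0); lra.
Qed.

Lemma bin_value_itv n c : 0 <= bin_value n c <= 1 - (2 ^+ n)^-1.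
Proof.
elim: n => /= [|n /andP[h0 h1]]; first by rewrite expr0 invr1 subrr lexx.
have p0 : 0 < (2 ^+ n)^-1 :> R by rewrite invr_gt0 exprn_gt0.
rewrite exprS invfM; case: (c n) => /=; lra.
Qed.

Lemma exp2V_small (e : R) : 0 < e -> exists n, (2 ^+ n)^-1 < e.
Proof.
move=> e0; exists (Num.truncn e^-1).+1.
rewrite -[ltRHS]invrK ltf_pV2 ?posrE ?invr_gt0 ?exprn_gt0//.
apply: (lt_trans (truncnS_gt _)); rewrite -natrX ltr_nat.
exact: ltn_expl.
Qed.

(** The finite expansions increase to [u]. Phrasing [s < u] through finitely many
    digits lets events about [u] be read off the coins. *)
Lemma bin_digits_sup u s : 0 <= u < 1 ->
  (exists n, s < bin_value n (bin_digit u)) <-> s < u.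
Proof.
move=> u01; split=> [[n sn]|su].
- apply: (lt_le_trans sn); rewrite [leRHS](bin_digitsK n) lerDl.
  by have /andP[r0 _] := bin_rest_itv n u01; rewrite mulr_ge0// invr_ge0 exprn_ge0.
- have [|n hn] := @exp2V_small (u - s); first by rewrite subr_gt0.
  exists n; have := bin_digitsK n u; have /andP[r0 r1] := bin_rest_itv n u01.
  have p0 : 0 < (2 ^+ n)^-1 :> R by rewrite invr_gt0 exprn_gt0.
  have : bin_rest n u / 2 ^+ n <= 1 * (2 ^+ n)^-1 by rewrite ler_pM2r// ltW.
  lra.
Qed.

End BinaryDigits.

(** * Fair coin tosses *)

Definition cylinder (n : nat) (w : nat -> bool) : set (nat -> bool) :=
  [set c | forall i, (i < n)%N -> c i = w i].

Definition cylinders : set (set (nat -> bool)) :=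
  [set C | C = set0 \/ exists n w, C = cylinder n w].

(** The sigma-algebra generated by the cylinders is the product sigma-algebra. *)
Definition coins := g_sigma_algebraType cylinders.

Lemma measurable_cylinder n w : measurable (cylinder n w : set coins).
Proof. by apply: sub_sigma_algebra; right; exists n, w. Qed.

Lemma setI_closed_cylinders : setI_closed cylinders.
Proof.
move=> A B [->|[n [w ->]]]; first by rewrite set0I; left.
move=> [->|[m [v ->]]]; first by rewrite setI0; left.
have [[c [cw cv]]|h] := pselect (exists c, cylinder n w c /\ cylinder m v c).
  right; exists (maxn n m), c; apply/seteqP; split=> x.
    move=> [xw xv] i; rewrite leq_max => /orP[ni|mi].
      by rewrite xw// cw.
    by rewrite xv// cv.
  move=> xc; split=> i ni; rewrite xc ?leq_max ?ni ?orbT//; first exact: cw.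
  exact: cv.
by left; apply/seteqP; split=> // x [xw xv]; apply: h; exists x.
Qed.

Lemma measurable_finitely_determined (n : nat) (A : set (nat -> bool)) :
  (forall c c', (forall i, (i < n)%N -> c i = c' i) -> A c -> A c') ->
  measurable (A : set coins).
Proof.
move=> h.
rewrite (_ : A = \bigcup_(t in [set t : n.-tuple bool | A (nth false t)])
                    cylinder n (nth false t)).
  apply: (@fin_bigcup_measurable _ coins); first exact: finite_finset.
  by move=> t _; exact: measurable_cylinder.
apply/seteqP; split=> c.
  move=> Ac; have E i : (i < n)%N -> c i = nth false (mktuple (fun i : 'I_n => c i)) i.
    move=> ni; rewrite -[i in RHS]/(nat_of_ord (Ordinal ni)) -tnth_nth.
    by rewrite tnth_mktuple.
  by exists (mktuple (fun i : 'I_n => c i)) => //=; apply: h Ac.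
by move=> [t At] ct; apply: h At => i ni; rewrite ct.
Qed.

Lemma measurable_to_coins d (T : measurableType d) (f : T -> coins) :
  (forall n w, measurable (f @^-1` (cylinder n w))) -> measurable_fun setT f.
Proof.
move=> h; apply: (@measurability _ _ T coins setT f cylinders) => // _ [C [->|[n [w ->]]] <-].
  by rewrite preimage_set0 setI0.
by rewrite setTI.
Qed.

Lemma measure_eq_cylinders (R : realType) (m1 m2 : {measure set coins -> \bar R}) :
  (m1 setT < +oo)%E ->
  (forall n w, m1 (cylinder n w) = m2 (cylinder n w)) ->
  forall A, measurable A -> m1 A = m2 A.
Proof.
move=> m1oo h A mA.
have cT : cylinder 0 (fun=> false) = setT by apply/seteqP; split.
refine (@measure_unique _ R coins cylinders (fun=> setT) _ _ _ _ m1 m2 _ _ A mA) => //.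
- exact: setI_closed_cylinders.
- by move=> _; right; exists 0%N, (fun=> false); rewrite cT.
- by apply/seteqP; split=> // x _; exists 0%N.
- by move=> _ [->|[n [w ->]]]; rewrite ?measure0//; exact: h.
Qed.

Definition even_bits (c : coins) : coins := fun i => c i.*2.
Definition odd_bits (c : coins) : coins := fun i => c i.*2.+1.
(** The inverse of splitting a sequence into its even and odd terms. *)
Definition interleave (bc : coins * coins) : coins :=
  fun i => if odd i then bc.2 i./2 else bc.1 i./2.

Lemma even_bits_interleave b c : even_bits (interleave (b, c)) = b.
Proof.
by apply/funext => i; rewrite /even_bits /interleave odd_double doubleK.
Qed.

Lemma odd_bits_interleave b c : odd_bits (interleave (b, c)) = c.
Proof.
apply/funext => i; rewrite /odd_bits /interleave.
by rewrite oddS odd_double/= uphalf_double.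
Qed.

Lemma measurable_even_bits : measurable_fun setT even_bits.
Proof.
apply: measurable_to_coins => n w; apply: (@measurable_finitely_determined n.*2).
move=> c c' cc' cw i ni; rewrite -cw// /even_bits cc'//.
by rewrite ltn_double.
Qed.

Lemma measurable_odd_bits : measurable_fun setT odd_bits.
Proof.
apply: measurable_to_coins => n w; apply: (@measurable_finitely_determined n.*2).
move=> c c' cc' cw i ni; rewrite -cw// /odd_bits cc'//.
by rewrite ltn_Sdouble.
Qed.

Lemma interleave_cylinder n w : interleave @^-1` (cylinder n w) =
  cylinder (uphalf n) (even_bits w) `*` cylinder n./2 (odd_bits w).
Proof.
apply/seteqP; split=> -[b c] /=.
  move=> h; split=> i ni.
    have /h : (i.*2 < n)%N by move: ni; lia.
    by rewrite -[LHS]/(even_bits (interleave (b, c)) i) even_bits_interleave.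
  have /h : (i.*2.+1 < n)%N by move: ni; lia.
  by rewrite -[LHS]/(odd_bits (interleave (b, c)) i) odd_bits_interleave.
move=> [hb hc] i ni; rewrite /interleave; case: ifPn => oi /=.
  rewrite hc; last by move: ni oi; lia.
  by rewrite /odd_bits; congr w; move: oi; lia.
rewrite hb; last by move: ni oi; lia.
by rewrite /even_bits; congr w; move: oi; lia.
Qed.

Lemma measurable_interleave : measurable_fun setT interleave.
Proof.
apply: measurable_to_coins => n w; rewrite interleave_cylinder.
by apply: measurableX; exact: measurable_cylinder.
Qed.

Section FairCoins.
Context {R : realType}.
Local Notation leb := (@lebesgue_measure R).

Definition unif01 : set (measurableTypeR R) -> \bar R :=
  mrestr leb (measurable_itv `[0, 1[).
HB.instance Definition _ := Measure.on unif01.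
Lemma unif01_setT : unif01 setT = 1%E.
Proof.
by rewrite /unif01 /mrestr setTI lebesgue_measure_itv/= lte_fin ltr01 oppr0 adde0.
Qed.
HB.instance Definition _ := Measure_isProbability.Build _ _ _ unif01 unif01_setT.

Lemma measurable_bin_rest n : measurable_fun setT (bin_rest n : R -> R).
Proof.
elim: n => //= n ih; apply: measurable_funB; first exact: measurable_funM.
rewrite (_ : (fun _ => _) = \1_`[1 / 2, +oo[%classic \o bin_rest n).
  by apply: measurableT_comp => //; exact: measurable_indic.
by apply/funext => x; rewrite /= indicE mem_setE in_itv/= andbT.
Qed.

(** [bin_digit], with the measurable structures that make it a random variable
    under [unif01]. *)
Definition digits (u : measurableTypeR R) : coins := bin_digit u.

Lemma measurable_digits : measurable_fun setT digits.
Proof.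
apply: measurable_to_coins => n w; elim: n => [|n ih].
  by rewrite (_ : _ @^-1` _ = setT)//; apply/seteqP; split.
have mn : measurable ((bin_rest n : R -> R) @^-1` (if w n then `[1 / 2, +oo[ else `]-oo, 1 / 2[)%classic).
  rewrite -[X in measurable X]setTI; apply: measurable_bin_rest => //.
  by case: (w n).
rewrite (_ : _ @^-1` _ = digits @^-1` cylinder n w `&`
  ((bin_rest n : R -> R) @^-1` (if w n then `[1 / 2, +oo[ else `]-oo, 1 / 2[)%classic)).
  exact: measurableI.
apply/seteqP; split=> u /=.
  move=> h; split; first by move=> i ni; apply: h; exact: ltnW.
  have := h n (ltnSn n); rewrite /digits /bin_digit.
  by case: (w n); rewrite /= in_itv/= ?andbT// => /negbT; rewrite -ltNge.
move=> [h hn] i; rewrite ltnS leq_eqVlt => /orP[/eqP ->|]; last exact: h.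
move: hn; rewrite /digits /bin_digit.
by case: (w n); rewrite /= in_itv/= ?andbT// ltNge => /negbTE.
Qed.

Definition fair_coins : probability coins R := distribution unif01 (mfun_of measurable_digits).

Lemma fair_coinsE A : fair_coins A = leb ((@bin_digit R) @^-1` A `&` `[0, 1[).
Proof. by []. Qed.

(** The cylinder is the set of [u] in a dyadic interval. *)
Lemma fair_coins_cylinder n w : fair_coins (cylinder n w) = ((2 ^+ n)^-1)%:E.
Proof.
rewrite fair_coinsE.
have /andP[v0 v1] := @bin_value_itv R n w.
have p0 : 0 < (2 ^+ n)^-1 :> R by rewrite invr_gt0 exprn_gt0.
rewrite [X in leb X](_ : _ = `[bin_value n w, bin_value n w + (2 ^+ n)^-1[%classic).
  rewrite lebesgue_measure_itv/= lte_fin ltrDl p0.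
  by rewrite -EFinD addrAC subrr add0r.
apply/seteqP; split=> u /=; rewrite !in_itv/=.
  by move=> [h u01]; exact/(bin_digits_itv n w u01).
move=> h; have u01 : 0 <= u < 1 by move: h => /andP[h1 h2]; lra.
by split=> //; apply/(bin_digits_itv n w u01).
Qed.

(** A cylinder of length [n] pulls back under [interleave] to a product of two
    cylinders whose lengths add up to [n], so both measures agree on cylinders.
    This single splitting, iterated, is the source of all independence. *)
Lemma fair_coins_split (X : set (coins * coins)) : measurable X ->
  fair_coins [set c | X (even_bits c, odd_bits c)] = (fair_coins \x fair_coins)%E X.
Proof.
move=> mX.
(* it suffices to compare fair_coins with the law of an interleaved pair *)
pose m1 := distribution (fair_coins \x fair_coins)%E (mfun_of measurable_interleave).
have E : forall A, measurable A -> fair_coins A = m1 A.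
  apply: (@measure_eq_cylinders R fair_coins m1).
    by apply: (@le_lt_trans _ _ 1%E); [exact: probability_le1|exact: ltry].
  move=> n w.
  transitivity ((fair_coins \x fair_coins)%E (interleave @^-1` cylinder n w)); last by [].
  rewrite interleave_cylinder product_measure1E; try exact: measurable_cylinder.
  rewrite [LHS]fair_coins_cylinder.
  transitivity (((2 ^+ uphalf n)^-1)%:E * ((2 ^+ n./2)^-1)%:E : \bar R)%E; last first.
    by congr (_ * _)%E; apply/esym; exact: fair_coins_cylinder.
  rewrite -EFinM -invfM -exprD.
  by congr ((2 ^+ _)^-1)%:E; lia.
rewrite E.
  rewrite /m1/= /distribution /pushforward/=; congr (_ _).
  apply/seteqP; split=> -[b c] /=; rewrite even_bits_interleave odd_bits_interleave//.
rewrite -[X in measurable X]setTI.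
apply: (measurable_fun_pair measurable_even_bits measurable_odd_bits) => //.
Qed.

End FairCoins.

(** * Quantile functions of coin tosses *)

Section Quantile.
Context {R : realType}.
Variable m : probability (measurableTypeR R) R.
Local Notation fair_coins := (@fair_coins R).

Definition cdf_of (t : R) : R := fine (m `]-oo, t]%classic).

Lemma cdf_ofE t : (m `]-oo, t]%classic = (cdf_of t)%:E)%E.
Proof. by rewrite fineK// fin_num_measure. Qed.

Lemma cdf_of_itv t : 0 <= cdf_of t <= 1.
Proof. by rewrite -!lee_fin -cdf_ofE measure_ge0/= probability_le1. Qed.

Lemma cdf_of_le s t : s <= t -> cdf_of s <= cdf_of t.
Proof.
move=> st; rewrite -lee_fin -!cdf_ofE; apply: le_measure; rewrite ?inE//.
by apply: subset_itvl; rewrite bnd_simp.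
Qed.

Let mid : @measurable_fun _ _ (measurableTypeR R) R setT id.
Proof. exact: (@measurable_id _ (measurableTypeR R) setT). Qed.
Let idm : {RV m >-> R} := mfun_of mid.
Let idmE t : cdf idm t = (cdf_of t)%:E.
Proof. by rewrite -cdf_ofE. Qed.

Lemma cdf_of_right t s : cdf_of t < s -> exists2 t', t < t' & cdf_of t' < s.
Proof.
move=> ts; have := @cdf_right_continuous _ _ _ m idm t.
rewrite idmE => h.
have : \forall x \near t^'+, (cdf idm x < s%:E)%E.
  apply: (h [set y | (y < s%:E)%E]); apply: open_nbhs_nbhs; split => /=.
    exact: open_ereal_lt_ereal.
  by rewrite lte_fin.
move=> h'; have [x [tx xs]] : exists x, t < x /\ (cdf idm x < s%:E)%E.
  near t^'+ => x; exists x; split; first by near: x; exact: nbhs_right_gt.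
  by near: x.
by exists x => //; move: xs; rewrite idmE lte_fin.
Unshelve. all: by end_near.
Qed.

Lemma cdf_of_small e : 0 < e -> exists k : nat, cdf_of (- k%:R) < e.
Proof.
move=> e0; have h := @cvg_cdfNy0 _ _ _ m idm.
have : \forall x \near -oo%R, (cdf idm x < e%:E)%E.
  apply: (h [set y | (y < e%:E)%E]); apply: open_nbhs_nbhs; split => /=.
    exact: open_ereal_lt_ereal.
  by rewrite lte_fin.
move=> [M [_ hM]]; exists (Num.truncn `|M|).+1.
rewrite -lte_fin -idmE; apply: hM; rewrite ltrNl.
by rewrite (le_lt_trans _ (truncnS_gt _))// -normrN ler_norm.
Qed.

Lemma cdf_of_large e : 0 < e -> exists k : nat, 1 - e < cdf_of k%:R.
Proof.
move=> e0; have h := @cvg_cdfy1 _ _ _ m idm.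
have : \forall x \near +oo%R, ((1 - e)%:E < cdf idm x)%E.
  apply: (h [set y | ((1 - e)%:E < y)%E]); apply: open_nbhs_nbhs; split => /=.
    exact: open_ereal_gt_ereal.
  by rewrite lte_fin ltrBlDr ltrDl.
move=> [M [_ hM]]; exists (Num.truncn `|M|).+1.
rewrite -lte_fin -idmE; apply: hM.
by rewrite (le_lt_trans _ (truncnS_gt _))// ler_norm.
Qed.

(** The half-line of the [x] with [cdf_of x < u], where [u] is the number with
    binary digits [c]. In terms of [c] it is a countable union of conditions on
    finitely many coins, which gives measurability for free. *)
Definition below (c : coins) : set R := [set x | exists n, cdf_of x < bin_value n c].

Lemma below_down c x y : x <= y -> below c y -> below c x.
Proof. by move=> xy [n yn]; exists n; exact: (le_lt_trans (cdf_of_le xy)). Qed.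

Lemma measurable_below x : measurable ([set c | below c x] : set coins).
Proof.
rewrite (_ : [set _ | _] = \bigcup_n [set c : coins | cdf_of x < bin_value n c]).
  apply: bigcup_measurable => n _; apply: (@measurable_finitely_determined n).
  by move=> c c' cc' /=; rewrite (eq_bin_value cc').
by apply/seteqP; split=> [c [n cn]|c [n _ cn]]; exists n.
Qed.

Lemma fair_coins_below x : fair_coins [set c | below c x] = (1 - cdf_of x)%:E.
Proof.
have /andP[F0 F1] := cdf_of_itv x.
rewrite fair_coinsE.
rewrite [X in lebesgue_measure X](_ : _ = `]cdf_of x, 1[%classic).
  rewrite lebesgue_measure_itv/= lte_fin; case: ltP => [//|h].
  by rewrite (@le_anti _ R (cdf_of x) 1) ?F1// subrr.
apply/seteqP; split=> u /=; rewrite !in_itv/=.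
  by move=> [h /[dup] u01 /andP[_ ->]]; rewrite andbT; apply/(bin_digits_sup _ u01).
move=> /andP[h u1]; have u01 : 0 <= u < 1 by rewrite u1 (le_trans F0 (ltW h)).
by split=> //; apply/(bin_digits_sup _ u01).
Qed.

(** The sequences for which [below c] is neither empty nor the whole line, so
    that its supremum is meaningful. *)
Definition proper_coins : set coins :=
  [set c | (exists k : nat, below c (- k%:R)) /\ (exists k : nat, ~ below c k%:R)].

Lemma measurable_proper_coins : measurable proper_coins.
Proof.
rewrite (_ : proper_coins = \bigcup_k [set c | below c (- k%:R)] `&`
   \bigcup_k ~` [set c | below c k%:R]).
  apply: measurableI; apply: bigcup_measurable => n _; first exact: measurable_below.
  by apply: measurableC; exact: measurable_below.
apply/seteqP; split=> c; first by move=> [[k hk] [l hl]]; split; [exists k|exists l].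
by move=> [[k _ hk] [l _ hl]]; split; [exists k|exists l].
Qed.

(** By [fair_coins_below], since the distribution function tends to [0] and [1]
    at the two ends of the line. *)
Lemma negligible_improper_coins : fair_coins (~` proper_coins) = 0%E.
Proof.
apply/eqP; rewrite eq_le measure_ge0 andbT; apply/lee_addgt0Pr => e e0.
rewrite add0e.
have [k hk] := cdf_of_small (divr_gt0 e0 (ltr0n _ 2)).
have [l hl] := cdf_of_large (divr_gt0 e0 (ltr0n _ 2)).
have mA : measurable (~` [set c | below c (- k%:R)] : set coins).
  by apply: measurableC; exact: measurable_below.
have mB := @measurable_below l%:R.
apply: (@le_trans _ _ (fair_coins (~` [set c | below c (- k%:R)] `|` [set c | below c l%:R]))).
  apply: le_measure; rewrite ?inE.
  - by apply: measurableC; exact: measurable_proper_coins.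
  - exact: measurableU.
  - move=> c h; have [h1|h1] := pselect (below c (- k%:R)); last by left.
    by right; apply: contrapT => h2; apply: h; split; [exists k|exists l].
apply: (@le_trans _ _ (fair_coins (~` [set c | below c (- k%:R)%R]) + fair_coins [set c | below c l%:R%R])%E).
  exact: measureU2.
rewrite probability_setC; last exact: measurable_below.
rewrite !fair_coins_below -!EFinD lee_fin; lra.
Qed.

Definition quantile (c : coins) : R :=
  if pselect (proper_coins c) then sup (below c) else 0.

(** The supremum is strictly above any [t] in [below c]: by right continuity of
    the distribution function, [below c] also contains some point beyond [t]. *)
Lemma quantile_gt c t : proper_coins c -> t < quantile c <-> below c t.
Proof.
move=> pc; rewrite /quantile; case: pselect => // -[[k hk] [l hl]].
have hs : has_sup (below c).
  split; first by exists (- k%:R).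
  exists l%:R => x bx; rewrite leNgt; apply/negP => lx; apply: hl.
  exact: below_down (ltW lx) bx.
split=> [ts|[n tn]].
  have [|x bx] := sup_adherent (eps := sup (below c) - t) _ hs.
    by rewrite subr_gt0.
  by rewrite opprB addrC subrK => tx; exact: below_down (ltW tx) bx.
have [t' tt' t'n] := cdf_of_right tn.
by apply: (lt_le_trans tt'); apply: sup_upper_bound => //; exists n.
Qed.

Lemma measurable_quantile : measurable_fun setT quantile.
Proof.
apply: (@measurability _ _ coins (measurableTypeR R) setT quantile _ (RGenOInfty.measurableE R)).
move=> _ [_ [t ->] <-]; rewrite setTI.
have mp := measurable_proper_coins.
rewrite (_ : _ @^-1` _ = (proper_coins `&` [set c | below c t]) `|`
   (~` proper_coins `&` [set c | t < 0])).
  apply: measurableU; apply: measurableI => //; first exact: measurable_below.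
    exact: measurableC.
  have [t0|t0] := boolP (t < 0); first by rewrite (_ : [set _ | _] = setT)//; apply/seteqP; split.
  by rewrite (_ : [set _ | _] = set0)//; apply/seteqP; split=> // c.
apply/seteqP; split=> c /=; rewrite in_itv/= andbT.
  have [pc|pc] := pselect (proper_coins c).
    by move/(quantile_gt _ pc) => ?; left.
  by move=> tq; right; split => //; move: tq; rewrite /quantile; case: pselect.
move=> [[pc bc]|[pc t0]]; first exact/quantile_gt.
by rewrite /quantile; case: pselect.
Qed.

Lemma quantile_law (B : set R) : measurable B -> fair_coins (quantile @^-1` B) = m B.
Proof.
pose m' := distribution fair_coins (@mfun_of _ _ coins (measurableTypeR R) _ measurable_quantile).
have mp := measurable_proper_coins.
move: B; apply: (@probability_eq_cdf _ m' m) => t.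
rewrite cdf_ofE.
have E : fair_coins (quantile @^-1` `]t, +oo[%classic) = (1 - cdf_of t)%:E.
  rewrite -fair_coins_below.
  have mq : measurable (quantile @^-1` `]t, +oo[%classic).
    by rewrite -[X in measurable X]setTI; apply: measurable_quantile.
  have P0 (A : set coins) : measurable A -> fair_coins A = fair_coins (A `&` proper_coins).
    move=> mA; apply/eqP; rewrite eq_le; apply/andP; split; last first.
      by apply: le_measure; rewrite ?inE//; exact: measurableI.
    apply: (@le_trans _ _ (fair_coins (A `&` proper_coins) + fair_coins (~` proper_coins))%E).
      apply: (@le_trans _ _ (fair_coins ((A `&` proper_coins) `|` ~` proper_coins))).
        apply: le_measure; rewrite ?inE//.
          by apply: measurableU; [exact: measurableI|exact: measurableC].
        by move=> c Ac; have [pc|pc] := pselect (proper_coins c); [left|right].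
      by apply: measureU2; [exact: measurableI|exact: measurableC].
    by rewrite negligible_improper_coins adde0.
  rewrite [LHS]P0// [RHS]P0//; last exact: measurable_below.
  congr (fair_coins _); apply/seteqP; split=> c /= [].
    by rewrite in_itv/= andbT => tq pc; split=> //; exact/quantile_gt.
  by move=> bc pc; split=> //; rewrite in_itv/= andbT; exact/quantile_gt.
have X : m' `]-oo, t]%classic = (1 - m' `]t, +oo[%classic)%E.
  by rewrite -probability_setC// setCitvr.
rewrite [LHS]X.
have -> : m' `]t, +oo[%classic = (1 - cdf_of t)%:E by exact: E.
by rewrite -EFinB opprB addrC subrK.
Qed.

End Quantile.

(** * Independent Gaussian variables *)

Section GaussianNoise.
Context {R : realType}.
Local Notation gam := (@normal_prob R 0 1).
Local Notation fair_coins := (@fair_coins R).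

Lemma normal_prob_scale_abs (a : R) (B : set R) : measurable B ->
  gam ((fun x => `|a| * x) @^-1` B) = gam ((fun x => a * x) @^-1` B).
Proof.
move=> mB; have [a0|a0] := leP 0 a; first by rewrite ger0_norm.
rewrite ltr0_norm// -[RHS]normal_probN.
  by congr (gam _); apply/seteqP; split=> x /=; rewrite mulNr mulrN.
by rewrite -[X in measurable X]setTI; exact: (measurable_scale a).
Qed.

(** [normal_prob_convolution] extended to the degenerate case [b = 0]. *)
Lemma integral_normal_convolution (a b : R) (B : set R) : 0 <= b -> measurable B ->
  (\int[gam]_x gam [set y | B (a * x + b * y)%R] =
   gam ((fun z => (Num.sqrt (a ^+ 2 + b ^+ 2) * z)%R) @^-1` B))%E.
Proof.
rewrite le_eqVlt => /orP[/eqP <- mB|b0 mB].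
  rewrite expr0n/= addr0 sqrtr_sqr normal_prob_scale_abs//.
  have mS : @measurable _ (measurableTypeR R) ((fun x => a * x) @^-1` B).
    by rewrite -[X in measurable X]setTI; exact: (measurable_scale a).
  transitivity (\int[gam]_x (\1_((fun x => a * x)%R @^-1` B) x)%:E)%E; last first.
    by rewrite integral_indic// setIT.
  apply: eq_integral => x _; rewrite indicE; have [xB|xB] := boolP (x \in _).
    rewrite (_ : [set _ | _] = setT) ?probability_setT//.
    by apply/seteqP; split=> // y _ /=; move: xB; rewrite inE/= mul0r addr0.
  rewrite (_ : [set _ | _] = set0) ?measure0//.
  apply/seteqP; split=> // y /=; rewrite mul0r addr0 => yB.
  by move: xB; rewrite notin_setE.
rewrite -normal_prob_convolution//.
apply: eq_integral => x _; rewrite /comp/=; congr (gam _).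
by apply/seteqP; split=> y; rewrite /xsection/= inE.
Qed.

(** The even terms of [c] drive the first variable, the even terms of what
    remains the second one, and so on. *)
Definition gauss_noise (i : nat) (c : coins) : R :=
  quantile gam (even_bits (iter i odd_bits c)).

Lemma measurable_gauss_noise i : measurable_fun setT (gauss_noise i).
Proof.
have mi : measurable_fun setT (iter i odd_bits : coins -> coins).
  elim: i => [|i ih]; first exact: measurable_id.
  exact: (measurableT_comp measurable_odd_bits ih).
exact: (measurableT_comp (measurable_quantile gam) (measurableT_comp measurable_even_bits mi)).
Qed.

Lemma gauss_law_quantile : gauss_law fair_coins (quantile gam) 1.
Proof.
split; first exact: (measurable_quantile gam).
move=> B mB; rewrite (quantile_law gam)//; congr (gam _).
by apply/seteqP; split=> x /=; rewrite mul1r.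
Qed.

Lemma measurable_noise_sum n (a : nat -> R) :
  measurable_fun setT (fun c => \sum_(i < n) a i * gauss_noise i c).
Proof.
by apply: measurable_sum => i; apply: measurable_funM => //; exact: measurable_gauss_noise.
Qed.

(** Induction on [n], taking off the first variable: it depends on the even
    coins and the remaining ones on the odd coins, so by [fair_coins_split] the
    law of the sum is the convolution of two centred Gaussian laws. *)
Lemma gauss_law_noise_sum n (a : nat -> R) :
  gauss_law fair_coins (fun c => \sum_(i < n) a i * gauss_noise i c)
    (Num.sqrt (\sum_(i < n) a i ^+ 2)).
Proof.
elim: n a => [|n ih] a; split; do ?exact: measurable_noise_sum.
  move=> B mB; rewrite big_ord0 sqrtr0.
  have [B0|B0] := pselect (B 0).
    rewrite (_ : _ @^-1` _ = setT); last first.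
      by apply/seteqP; split=> // c _ /=; rewrite big_ord0.
    rewrite probability_setT (_ : _ @^-1` _ = setT) ?probability_setT//.
    by apply/seteqP; split=> // c _ /=; rewrite mul0r.
  rewrite (_ : _ @^-1` _ = set0); last first.
    by apply/seteqP; split=> // c /=; rewrite big_ord0.
  rewrite measure0 (_ : _ @^-1` _ = set0) ?measure0//.
  by apply/seteqP; split=> // c /=; rewrite mul0r.
move=> B mB.
have {ih} := ih (fun i => a i.+1).
rewrite !big_ord_recl.
set sg := Num.sqrt _; pose S c : R := \sum_(i < n) a i.+1 * gauss_noise i c.
rewrite -[in X in gauss_law _ X]/S => -[mS lS].
have sg0 : 0 <= sg by rewrite sqrtr_ge0.
have sgE : \sum_(i < n) a (lift ord0 i) ^+ 2 = sg ^+ 2.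
  by rewrite sqr_sqrtr// sumr_ge0// => i _; rewrite sqr_ge0.
rewrite sgE -integral_normal_convolution//.
pose X : set (coins * coins) := [set bc | B (a 0%N * quantile gam bc.1 + S bc.2)].
have mX : measurable X.
  have mf : measurable_fun setT (fun bc : coins * coins => a 0%N * quantile gam bc.1 + S bc.2).
    apply: measurable_funD; last exact: measurableT_comp.
    apply: measurable_funM => //.
    by apply: measurableT_comp => //; exact: (measurable_quantile gam).
  by rewrite -[X in measurable X]setTI; exact: mf.
transitivity (fair_coins [set c | X (even_bits c, odd_bits c)]).
  have E c : \sum_(i < n.+1) a i * gauss_noise i c =
      a 0%N * quantile gam (even_bits c) + S (odd_bits c).
    rewrite big_ord_recl; congr (_ + _); apply: eq_bigr => i _.
    by rewrite lift0 /gauss_noise iterSr.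
  by congr (fair_coins _); apply/seteqP; split=> c; rewrite /X/= E.
rewrite fair_coins_split//.
transitivity (\int[fair_coins]_b gam [set y | B (a 0%N * quantile gam b + sg * y)%R])%E.
  apply: eq_integral => b _.
  pose Bb := (fun y => a 0%N * quantile gam b + y) @^-1` B.
  have mBb : measurable Bb.
    rewrite -[X in measurable X]setTI.
    by apply: (@measurable_funD _ _ _ setT (cst _) id).
  transitivity (fair_coins (S @^-1` Bb)); last by rewrite lS.
  congr (fair_coins _); by apply/seteqP; split=> y; rewrite /xsection/= inE.
have mSet : measurable [set xy : measurableTypeR R * measurableTypeR R | B (a 0%N * xy.1 + sg * xy.2)].
  have mf : measurable_fun [set: measurableTypeR R * measurableTypeR R] (fun xy => a 0%N * xy.1 + sg * xy.2).
    by apply: measurable_funD; exact: measurable_funM.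
  by rewrite -[X in measurable X]setTI; exact: mf.
pose f (x : R) : \bar R := gam [set y | B (a 0%N * x + sg * y)].
have mf : measurable_fun [set: measurableTypeR R] f.
  rewrite (_ : f = gam \o xsection [set xy | B (a 0%N * xy.1 + sg * xy.2)]).
    exact: measurable_fun_xsection.
  apply/funext => x; rewrite /f/=; congr (gam _).
  by apply/seteqP; split=> y; rewrite /xsection/= inE.
rewrite (ge0_integral_gauss_law gauss_law_quantile mf)//.
by apply: eq_integral => x _; rewrite mul1r.
Qed.

End GaussianNoise.

(** * Gaussian processes with prescribed covariance *)

Section PsdForms.
Context {R : realType} {V : zmodType} (sc : R -> V -> V).

(** The scaling [sc] is a parameter because the real forms of interest live on a
    space of [scalars k R], on which the reals act through [ofR]. *)
Record psd_form (q : V -> V -> R) : Prop := PsdForm {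
  psdD : forall f g h, q (f + g) h = q f h + q g h;
  psdZ : forall r f h, q (sc r f) h = r * q f h;
  psdC : forall f g, q f g = q g f;
  psd_ge0 : forall f, 0 <= q f f }.

Lemma psd_form_add_scale q f r b : psd_form q ->
  q (f + sc r b) (f + sc r b) = q f f + 2 * r * q f b + r ^+ 2 * q b b.
Proof.
move=> [qD qZ qC _]; rewrite qD qZ ![q _ (f + _)]qC !qD !qZ [q b f]qC; ring.
Qed.

(** If [q f b] were not [0], [q] would become negative on [f + r b] for [r] far
    enough on the suitable side. *)
Lemma psd_form_degenerate q f b : psd_form q -> q b b = 0 -> q f b = 0.
Proof.
move=> pq b0; apply/eqP/contraT => fb0.
pose r := - (q f f + 1) / (2 * q f b).
have := psd_ge0 pq (f + sc r b); rewrite psd_form_add_scale// b0 mulr0 addr0.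
rewrite (_ : 2 * r * q f b = - (q f f + 1)); last by rewrite /r; field.
lra.
Qed.

(** The Schur complement of [q] after elimination of [b 0], ..., [b m.-1]. The
    quotient is [0] when the pivot vanishes, as the inverse of [0] is [0]. *)
Fixpoint residual (q : V -> V -> R) (b : nat -> V) (m : nat) : V -> V -> R :=
  if m is m'.+1 then let p := residual q b m' in
    fun f g => p f g - p f (b m') * p g (b m') / p (b m') (b m')
  else q.

Variables (q : V -> V -> R) (b : nat -> V).
Hypothesis pq : psd_form q.
Local Notation res := (residual q b).

Lemma residual_psd m : psd_form (res m).
Proof.
elim: m => // m p; split => /=.
- by move=> f g h; rewrite !(psdD p); ring.
- by move=> r f h; rewrite !(psdZ p); ring.
- by move=> f g; rewrite (psdC p f); ring.
move=> f; have [a0|a0] := eqVneq (res m (b m) (b m)) 0.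
  by rewrite a0 invr0 mulr0 subr0 psd_ge0.
have := psd_ge0 p (f + sc (- (res m f (b m) / res m (b m) (b m))) (b m)).
rewrite psd_form_add_scale//.
set x := res m f f; set y := res m f (b m); set z := res m (b m) (b m).
by rewrite (_ : _ + _ = x - y * y / z)//; field.
Qed.

(** A vanishing pivot is harmless: [b m] is then degenerate for the residual form
    ([psd_form_degenerate]), so there is nothing to eliminate. *)
Lemma residual_eq0 m j f : (j < m)%N -> res m f (b j) = 0.
Proof.
elim: m f j => // m ih f j; rewrite ltnS leq_eqVlt => /orP[/eqP->|jm] /=.
  have [a0|a0] := eqVneq (res m (b m) (b m)) 0.
    by rewrite a0 invr0 mulr0 subr0 (psd_form_degenerate _ (residual_psd m)).
  by field.
by rewrite ih// (psdC (residual_psd m) (b j)) (ih _ _ jm) mulr0 mul0r subr0.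
Qed.

(** The row [m] of the Cholesky factor, as a linear form in [f]. *)
Definition chol (m : nat) (f : V) : R :=
  res m f (b m) / Num.sqrt (res m (b m) (b m)).

Lemma cholD m f g : chol m (f + g) = chol m f + chol m g.
Proof. by rewrite /chol (psdD (residual_psd m)) mulrDl. Qed.

Lemma cholZ m r f : chol m (sc r f) = r * chol m f.
Proof. by rewrite /chol (psdZ (residual_psd m)) mulrA. Qed.

Lemma chol_eq0 m j : (j < m)%N -> chol m (b j) = 0.
Proof.
by move=> jm; rewrite /chol (psdC (residual_psd m)) residual_eq0// mul0r.
Qed.

Lemma chol_sum m f g : q f g = \sum_(k < m) chol k f * chol k g + res m f g.
Proof.
elim: m => [|m {1}->]; first by rewrite big_ord0 add0r.
rewrite big_ord_recr/= -addrA; congr (_ + _).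
have s0 : Num.sqrt (res m (b m) (b m)) ^+ 2 = res m (b m) (b m).
  by rewrite sqr_sqrtr// (psd_ge0 (residual_psd m)).
have -> : chol m f * chol m g = res m f (b m) * res m g (b m) / res m (b m) (b m).
  by rewrite -[in RHS]s0 expr2 invfM /chol mulrACA.
ring.
Qed.

Lemma chol0 m : chol m 0 = 0.
Proof. by apply: (addrI (chol m 0)); rewrite -cholD !addr0. Qed.

Lemma chol_lincomb m n (t : nat -> R) :
  chol m (\sum_(j < n) sc (t j) (b j)) = \sum_(j < n) t j * chol m (b j).
Proof.
elim: n => [|n ih]; first by rewrite !big_ord0 chol0.
by rewrite !big_ord_recr/= cholD cholZ ih.
Qed.

Lemma residual_lincomb n (t : nat -> R) f :
  res n (\sum_(j < n) sc (t j) (b j)) f = 0.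
Proof.
have p := residual_psd n.
have p0 g : res n 0 g = 0.
  by apply: (addrI (res n 0 g)); rewrite -(psdD p) !addr0.
have H k : (k <= n)%N -> res n (\sum_(j < k) sc (t j) (b j)) f = 0.
  elim: k => [|k ih] kn; first by rewrite big_ord0 p0.
  rewrite big_ord_recr/= (psdD p) (psdZ p) ih ?(ltnW kn)//.
  by rewrite (psdC p) residual_eq0// mulr0 addr0.
exact: H.
Qed.

(** With [W j] the combination of the noise with coefficients [chol k (b j)],
    which is finite by triangularity, the combination of the [W j] with
    coefficients [t] has noise coefficients [chol k f], whose squares sum to
    [q f f] because the residual of [f] vanishes after [n] steps. *)
Theorem gaussian_process : exists W : nat -> coins -> R,
  (forall j, measurable_fun setT (W j)) /\
  forall n (t : nat -> R), let f := \sum_(j < n) sc (t j) (b j) in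
    gauss_law (@fair_coins R) (fun c => \sum_(j < n) t j * W j c)
      (Num.sqrt (q f f)).
Proof.
pose W j (c : coins) := \sum_(k < j.+1) chol k (b j) * gauss_noise k c.
exists W; split; first by move=> j; exact: (measurable_noise_sum j.+1 (chol ^~ (b j))).
move=> n t f.
have WE j c : (j < n)%N -> W j c = \sum_(k < n) chol k (b j) * gauss_noise k c.
  move=> jn; rewrite /W (big_ord_widen n (fun k => chol k (b j) * gauss_noise k c))//.
  rewrite big_mkcond; apply: eq_bigr => k _; case: ltnP => // jk.
  by rewrite chol_eq0 ?mul0r.
have -> : q f f = \sum_(k < n) chol k f ^+ 2.
  by rewrite (chol_sum n) residual_lincomb addr0; apply: eq_bigr => k _; rewrite expr2.
have -> : (fun c => \sum_(j < n) t j * W j c) =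
          (fun c => \sum_(k < n) chol k f * gauss_noise k c).
  apply/funext => c.
  under eq_bigr => j _ do rewrite WE// mulr_sumr.
  rewrite exchange_big/=; apply: eq_bigr => k _.
  rewrite chol_lincomb mulr_suml; apply: eq_bigr => j _; exact: mulrA.
exact: (gauss_law_noise_sum n (chol ^~ f)).
Qed.

End PsdForms.

(** * Scalars and inner products *)

Section Scalars.
Context {k : scalar_kind} {R : realType}.
Local Notation K := (scalars k R).

Definition ofR : R -> K :=
  match k return R -> scalars k R with
  | RealScalars => id | ComplexScalars => real_complex R end.

(** The square of the modulus, as a real number. *)
Definition absq (z : K) : R := reK (z * conjK z).
End Scalars.

Section ScalarLemmas.
Context {k : scalar_kind} {R : realType}.
Local Notation K := (scalars k R).
Implicit Types (z w : K) (r s : R).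

Lemma conjKD z w : conjK (z + w) = conjK z + conjK w.
Proof. by case: k z w => //= z w; rewrite rmorphD. Qed.

Lemma conjKN z : conjK (- z) = - conjK z.
Proof. by case: k z => //= z; rewrite rmorphN. Qed.

Lemma conjKM z w : conjK (z * w) = conjK z * conjK w.
Proof. by case: k z w => //= z w; rewrite rmorphM. Qed.

Lemma conjKK : involutive (@conjK k R).
Proof. by case: k => //= z; exact: conjCK. Qed.

Lemma conjK0 : conjK (0 : K) = 0.
Proof. by case: k => //=; rewrite rmorph0. Qed.

Lemma conjK1 : conjK (1 : K) = 1.
Proof. by case: k => //=; rewrite rmorph1. Qed.

Lemma conjKR r : conjK (ofR r : K) = ofR r.
Proof. by case: k => //=; exact: conjc_real. Qed.

Lemma reKD z w : reK (z + w) = reK z + reK w.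
Proof. by case: k z w => //= [[a b] [c d]]. Qed.

Lemma reKN z : reK (- z) = - reK z.
Proof. by case: k z => //= [[a b]]. Qed.

Lemma reKB z w : reK (z - w) = reK z - reK w.
Proof. by rewrite reKD reKN. Qed.

Lemma reK0 : reK (0 : K) = 0. Proof. by case: k. Qed.
Lemma reK1 : reK (1 : K) = 1. Proof. by case: k. Qed.
Lemma reK_ofR r : reK (ofR r : K) = r. Proof. by case: k. Qed.

Lemma reK_scale r z : reK (ofR r * z) = r * reK z.
Proof. by case: k z => //= [[a b]] /=; rewrite mul0r subr0. Qed.

Lemma reK_conj z : reK (conjK z) = reK z.
Proof. by case: k z => //= [[a b]]. Qed.

Lemma ofRD r s : (ofR (r + s) : K) = ofR r + ofR s.
Proof. by case: k => //=; exact: rmorphD. Qed.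
Lemma ofRM r s : (ofR (r * s) : K) = ofR r * ofR s.
Proof. by case: k => //=; exact: rmorphM. Qed.
Lemma ofR0 : (ofR 0 : K) = 0. Proof. by case: k. Qed.
Lemma ofR1 : (ofR 1 : K) = 1. Proof. by case: k. Qed.
Lemma ofR_ge0 r : (0 <= (ofR r : K)) = (0 <= r).
Proof. by case: k => //=; rewrite ler0c. Qed.
Lemma ofR_gt0 r : (0 < (ofR r : K)) = (0 < r).
Proof. by case: k => //=; rewrite ltcR. Qed.
Lemma ofR_le r s : ((ofR r : K) <= ofR s) = (r <= s).
Proof. by case: k => //=; rewrite lecR. Qed.
Lemma ofR_lt r s : ((ofR r : K) < ofR s) = (r < s).
Proof. by case: k => //=; rewrite ltcR. Qed.

Lemma ofR_eq0 r : ((ofR r : K) == 0) = (r == 0).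
Proof. by case: k => //=; rewrite -[0]/((0 : R)%:C)%C (inj_eq (@complexI R)). Qed.

Lemma ge0_ofR z : 0 <= z -> z = ofR (reK z).
Proof. by case: k z => //= [[a b]]; rewrite lecE /= => /andP[/eqP -> _]. Qed.

Lemma reK_ge0 z : 0 <= z -> 0 <= reK z.
Proof. by case: k z => //= [[a b]]; rewrite lecE /= => /andP[]. Qed.

Lemma mul_conjK z : z * conjK z = ofR (absq z).
Proof.
rewrite /absq; apply: ge0_ofR; case: k z => /= z; last exact: mulcJ_ge0.
by rewrite -expr2 sqr_ge0.
Qed.

Lemma absq_ge0 z : 0 <= absq z.
Proof.
apply: reK_ge0; case: k z => /= z; last exact: mulcJ_ge0.
by rewrite -expr2 sqr_ge0.
Qed.

Lemma absqM z w : absq (z * w) = absq z * absq w.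
Proof.
apply: (@eq_trans _ _ (reK (ofR (absq z) * ofR (absq w) : K))).
  by rewrite -!mul_conjK /absq conjKM mulrACA.
by rewrite reK_scale reK_ofR.
Qed.

Lemma absq_conj z : absq (conjK z) = absq z.
Proof. by rewrite /absq conjKK mulrC. Qed.

Lemma absq_ofR r : absq (ofR r : K) = r ^+ 2.
Proof. by rewrite /absq conjKR reK_scale reK_ofR. Qed.

Lemma absq0 : absq (0 : K) = 0.
Proof. by rewrite /absq mul0r reK0. Qed.

Lemma absq_eq0 z : absq z = 0 -> z = 0.
Proof.
move=> h; have := mul_conjK z; rewrite h ofR0 => /eqP; rewrite mulf_eq0 => /orP[/eqP //|/eqP h2].
by rewrite -[z]conjKK h2 conjK0.
Qed.

Lemma normK_absq z : `|z| ^+ 2 = ofR (absq z).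
Proof.
rewrite -mul_conjK; case: k z => /= z; last exact: sqr_normc.
by rewrite -expr2 real_normK ?num_real.
Qed.

Lemma reK_sqr_le_absq z : reK z ^+ 2 <= absq z.
Proof.
case: k z => /= [z|[a b]]; rewrite /absq/=; first by rewrite expr2.
nra.
Qed.

End ScalarLemmas.

Section InnerProducts.
Context {k : scalar_kind} {R : realType}.
Local Notation K := (scalars k R).
Context {V : lmodType K}.
Implicit Types (ip : V -> V -> K) (u v w : V).

(** Definiteness is left out because the two forms that matter most, the
    covariance and [dual_ip (A f) g], may be degenerate. *)
Record semi_inner ip : Prop := SemiInner {
  ipD : forall u v w, ip (u + v) w = ip u w + ip v w;
  ipZ : forall a u w, ip (a *: u) w = a * ip u w;
  ipC : forall u v, ip u v = conjK (ip v u);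
  ip_ge0 : forall u, 0 <= ip u u }.

Variables (ip : V -> V -> K) (hip : semi_inner ip).
Local Notation nsq v := (reK (ip v v)).

Lemma ipDr u v w : ip w (u + v) = ip w u + ip w v.
Proof. by rewrite (ipC hip) (ipD hip) conjKD -!(ipC hip). Qed.
Lemma ipZr a u w : ip w (a *: u) = conjK a * ip w u.
Proof. by rewrite (ipC hip) (ipZ hip) conjKM -(ipC hip). Qed.
Lemma ip0l w : ip 0 w = 0.
Proof. by rewrite -(scale0r w) (ipZ hip) mul0r. Qed.
Lemma ip0r w : ip w 0 = 0.
Proof. by rewrite (ipC hip) ip0l conjK0. Qed.
Lemma ipNl u w : ip (- u) w = - ip u w.
Proof. by rewrite -scaleN1r (ipZ hip) mulN1r. Qed.
Lemma ipNr u w : ip w (- u) = - ip w u.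
Proof. by rewrite (ipC hip) ipNl conjKN -(ipC hip). Qed.
Lemma ipBl u v w : ip (u - v) w = ip u w - ip v w.
Proof. by rewrite (ipD hip) ipNl. Qed.
Lemma ipBr u v w : ip w (u - v) = ip w u - ip w v.
Proof. by rewrite ipDr ipNr. Qed.
Lemma ip_suml n (F : 'I_n -> V) w : ip (\sum_(i < n) F i) w = \sum_(i < n) ip (F i) w.
Proof.
by elim/big_rec2: _ => [|i x y _ <-]; [exact: ip0l|rewrite (ipD hip)].
Qed.
Lemma ip_sumr n (F : 'I_n -> V) w : ip w (\sum_(i < n) F i) = \sum_(i < n) ip w (F i).
Proof.
by elim/big_rec2: _ => [|i x y _ <-]; [exact: ip0r|rewrite ipDr].
Qed.

Lemma nsq_ge0 v : 0 <= nsq v. Proof. exact: reK_ge0 (ip_ge0 hip v). Qed.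
Lemma ip_nsq v : ip v v = ofR (nsq v).
Proof. exact: ge0_ofR (ip_ge0 hip v). Qed.
Lemma nsqZ a v : nsq (a *: v) = absq a * nsq v.
Proof. by rewrite (ipZ hip) ipZr mulrA mul_conjK reK_scale. Qed.
Lemma nsqN v : nsq (- v) = nsq v.
Proof. by rewrite ipNl ipNr opprK. Qed.
Lemma nsqD u v : nsq (u + v) = nsq u + nsq v + 2 * reK (ip u v).
Proof.
by rewrite (ipD hip) !ipDr !reKD [ip v u](ipC hip) reK_conj; ring.
Qed.
Lemma nsqB u v : nsq (u - v) = nsq u + nsq v - 2 * reK (ip u v).
Proof. by rewrite nsqD nsqN ipNr reKN mulrN. Qed.

(** The form is non-negative at [u - t <u, v> v] for all real [t]; when [v] is
    null, letting [t] grow forces [<u, v> = 0]. *)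
Lemma cauchy_schwarz u v : absq (ip u v) <= nsq u * nsq v.
Proof.
have key t : 0 <= nsq u - 2 * t * absq (ip u v) + t ^+ 2 * absq (ip u v) * nsq v.
  have := nsq_ge0 (u - (ofR t * ip u v) *: v).
  have e : reK (ip u ((ofR t * ip u v) *: v)) = t * absq (ip u v).
    by rewrite ipZr conjKM conjKR -mulrA [conjK (ip u v) * _]mulrC mul_conjK reK_scale reK_ofR.
  by rewrite nsqB nsqZ absqM absq_ofR e; lra.
have a0 := absq_ge0 (ip u v); have u0 := nsq_ge0 u; have v0 := nsq_ge0 v.
have [v1|v1] := eqVneq (nsq v) 0.
  rewrite v1 mulr0; rewrite leNgt; apply/negP => a1.
  have := key ((nsq u + 1) / (2 * absq (ip u v))); rewrite v1 mulr0 addr0.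
  rewrite (_ : 2 * _ * _ = nsq u + 1); first by lra.
  by field; exact: lt0r_neq0.
have := key (nsq v)^-1.
rewrite (_ : _ + _ = nsq u - absq (ip u v) / nsq v); last by field.
have v2 : 0 < nsq v by rewrite lt_def v1.
by rewrite subr_ge0 ler_pdivrMr.
Qed.

Lemma ip_normE v : ip_norm ip v ^+ 2 = nsq v.
Proof. by rewrite sqr_sqrtr// nsq_ge0. Qed.

Lemma ip_norm_ge0 v : 0 <= ip_norm ip v. Proof. exact: sqrtr_ge0. Qed.

Lemma reK_ip_le u v : `|reK (ip u v)| <= ip_norm ip u * ip_norm ip v.
Proof.
rewrite -ler_sqr ?nnegrE ?mulr_ge0 ?ip_norm_ge0// exprMn !ip_normE.
rewrite real_normK ?num_real//.
exact: le_trans (reK_sqr_le_absq _) (cauchy_schwarz u v).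
Qed.

Lemma ip_normD u v : ip_norm ip (u + v) <= ip_norm ip u + ip_norm ip v.
Proof.
rewrite -ler_sqr ?nnegrE ?addr_ge0 ?ip_norm_ge0// ip_normE nsqD.
have := le_trans (ler_norm _) (reK_ip_le u v).
by rewrite -!ip_normE; nra.
Qed.

Lemma ip_normN v : ip_norm ip (- v) = ip_norm ip v.
Proof. by rewrite /ip_norm nsqN. Qed.

Lemma ip_normB u v : ip_norm ip (u - v) = ip_norm ip (v - u).
Proof. by rewrite -ip_normN opprB. Qed.

End InnerProducts.

(** * Orthonormal systems *)

Section Orthonormal.
Context {k : scalar_kind} {R : realType}.
Local Notation K := (scalars k R).
Context {V : lmodType K}.
Variables (ip : V -> V -> K) (hip : semi_inner ip).
Local Notation nsq v := (reK (ip v v)).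
Implicit Types (u v : V) (e : nat -> V).

Definition orthonormal_upto (n : nat) e : Prop :=
  forall i j, (i < n)%N -> (j < n)%N -> ip (e i) (e j) = (i == j)%:R.

Definition partial_proj e n v : V := \sum_(i < n) ip v (e i) *: e i.

Lemma partial_proj_ext n e e' v : (forall i, (i < n)%N -> e i = e' i) ->
  partial_proj e n v = partial_proj e' n v.
Proof. by move=> h; apply: eq_bigr => i _; rewrite h. Qed.

Lemma ip_lincombl n e (c : nat -> K) j : orthonormal_upto n e -> (j < n)%N ->
  ip (\sum_(i < n) c i *: e i) (e j) = c j.
Proof.
move=> on jn; rewrite ip_suml// (bigD1 (Ordinal jn))//= big1 ?addr0.
  by rewrite (ipZ hip) on// eqxx mulr1.
move=> i ij; rewrite (ipZ hip) on//.
by rewrite (_ : (_ == _) = false) ?mulr0//; apply/negbTE; move: ij; rewrite -val_eqE.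
Qed.

Lemma ip_partial_projl n e v j : orthonormal_upto n e -> (j < n)%N ->
  ip (v - partial_proj e n v) (e j) = 0.
Proof.
move=> on jn; rewrite ipBl// /partial_proj.
by rewrite (ip_lincombl (fun i => ip v (e i)))// subrr.
Qed.

Lemma ip_proj_lincomb n e v (c : nat -> K) : orthonormal_upto n e ->
  ip (v - partial_proj e n v) (\sum_(i < n) c i *: e i) = 0.
Proof.
move=> on; rewrite ip_sumr// big1// => i _.
by rewrite ipZr// ip_partial_projl// mulr0.
Qed.

Lemma nsq_lincomb n e (c : nat -> K) : orthonormal_upto n e ->
  nsq (\sum_(i < n) c i *: e i) = \sum_(i < n) absq (c i).
Proof.
move=> on; rewrite ip_sumr//.
rewrite (eq_bigr (fun i : 'I_n => ofR (absq (c i)))).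
  by elim/big_rec2: _ => [|i x y _ <-]; rewrite ?reK0// reKD reK_ofR.
move=> i _; rewrite ipZr// ip_lincombl// mulrC mul_conjK//.
Qed.

Lemma nsq_proj_dist n e v (c : nat -> K) : orthonormal_upto n e ->
  nsq (v - \sum_(i < n) c i *: e i) = nsq (v - partial_proj e n v) +
    nsq (partial_proj e n v - \sum_(i < n) c i *: e i).
Proof.
move=> on.
rewrite -[in LHS](subrK (partial_proj e n v) v) -addrA [LHS]nsqD//.
suff -> : ip (v - partial_proj e n v) (partial_proj e n v - \sum_(i < n) c i *: e i) = 0.
  by rewrite reK0 mulr0 addr0.
by rewrite ipBr// ip_proj_lincomb// (ip_proj_lincomb v (fun i => ip v (e i)))// subrr.
Qed.

(** Pythagoras: the residual of the projection is orthogonal to the span. *)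
Lemma nsq_proj_best n e v (c : nat -> K) : orthonormal_upto n e ->
  nsq (v - partial_proj e n v) <= nsq (v - \sum_(i < n) c i *: e i).
Proof. by move=> on; rewrite [leRHS]nsq_proj_dist// lerDl nsq_ge0. Qed.

Lemma nsq_proj n e v : orthonormal_upto n e ->
  nsq (v - partial_proj e n v) = nsq v - \sum_(i < n) absq (ip v (e i)).
Proof.
move=> on; have := @nsq_proj_dist n e v (fun=> 0) on.
have -> : \sum_(i < n) 0 *: e i = 0 by apply: big1 => i _; rewrite scale0r.
rewrite !subr0 => ->.
by rewrite /partial_proj (nsq_lincomb (fun i => ip v (e i)))// addrK.
Qed.

Lemma bessel n e v : orthonormal_upto n e ->
  \sum_(i < n) absq (ip v (e i)) <= nsq v.
Proof. by move=> on; rewrite -subr_ge0 -nsq_proj// nsq_ge0. Qed.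

Section Basis.
Variable e : nat -> V.
Hypothesis be : orthonormal_basis ip e.

Lemma basis_upto n : orthonormal_upto n e.
Proof. by move=> i j _ _; exact: be.1. Qed.

Lemma partial_proj_small v (eps : R) : 0 < eps ->
  exists N, forall n, (N <= n)%N -> ip_norm ip (v - partial_proj e n v) < eps.
Proof.
move=> e0; have [N [c hc]] := be.2 v eps e0; exists N => n Nn.
apply: le_lt_trans hc; apply: ler_wsqrtr.
pose c' i := if (i < N)%N then c i else 0.
have -> : \sum_(i < N) c i *: e i = \sum_(i < n) c' i *: e i.
  rewrite (big_ord_widen n (fun i => c i *: e i))// big_mkcond; apply: eq_bigr => i _.
  by rewrite /c'; case: ifP; rewrite ?scale0r.
exact: nsq_proj_best (@basis_upto n).
Qed.

Lemma parseval v : (\sum_(i < n) absq (ip v (e i))) @[n --> \oo] --> (nsq v : R).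
Proof.
apply/cvgrPdist_lt => eps e0.
have [N hN] := partial_proj_small v (eps := Num.sqrt eps) ltac:(by rewrite sqrtr_gt0).
exists N => // n /= Nn; rewrite -nsq_proj; last exact: basis_upto.
rewrite ger0_norm ?nsq_ge0// -ip_normE//.
have := hN n Nn; have h := ip_norm_ge0 ip (v - partial_proj e n v).
by rewrite -ltr_sqr ?nnegrE ?sqrtr_ge0// (sqr_sqrtr (ltW e0)).
Qed.

End Basis.

Section GramSchmidt.
Variable d : nat -> V.
Hypothesis ip_def : forall v, ip v v = 0 -> v = 0.
Hypothesis dense_d : forall v (eps : R), 0 < eps -> exists n, ip_norm ip (v - d n) < eps.
Hypothesis Vinf : infinite_dimensional V.

Definition normalize v : V := ofR (ip_norm ip v)^-1 *: v.

Lemma ip_normalize v : v != 0 -> ip v (normalize v) = ofR (ip_norm ip v) /\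
  ip (normalize v) (normalize v) = 1.
Proof.
move=> v0; have n0 : ip_norm ip v != 0.
  apply: contra_neq v0 => h; apply: ip_def.
  by rewrite ip_nsq// -ip_normE// h expr0n/= ofR0.
rewrite /normalize ipZr// (ipZ hip) ipZr// conjKR ip_nsq// -ip_normE// -!ofRM.
split; first by congr ofR; field.
by rewrite -ofR1; congr ofR; field.
Qed.

(** Gram-Schmidt skips the vectors of [d] that are dependent on the previous ones,
    which are those with residual [0]. *)
Definition first_nonzero (r : nat -> V) : nat :=
  xget 0%N [set j | r j != 0 /\ forall i, (i < j)%N -> r i = 0].

Definition gs_next n e : V :=
  let r j := d j - partial_proj e n (d j) in normalize (r (first_nonzero r)).

Fixpoint gs n : nat -> V :=
  if n is n'.+1 then fun i => if (i < n')%N then gs n' i else gs_next n' (gs n')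
  else fun=> 0.

Definition gs_basis n : V := gs_next n (gs n).

Lemma gsE n i : (i < n)%N -> gs n i = gs_basis i.
Proof.
elim: n => // n ih /=; rewrite ltnS leq_eqVlt; case: ltnP => [ni _|ni].
  exact: ih.
by rewrite orbF => /eqP ->.
Qed.

Lemma gs_basis_next n : gs_basis n = gs_next n gs_basis.
Proof.
suff E : (fun j => d j - partial_proj (gs n) n (d j)) =
             (fun j => d j - partial_proj gs_basis n (d j)).
  exact: (congr1 (fun r => normalize (r (first_nonzero r))) E).
apply/funext => j; congr (_ - _).
by apply: partial_proj_ext => i ni; exact: gsE.
Qed.

Local Notation r n j := (d j - partial_proj gs_basis n (d j)).

(** If every [d j] were in the span of the first [n] basis vectors, that span
    would be dense, hence everything, since projection residuals are minimal. *)
Lemma gs_residual_neq0 n : orthonormal_upto n gs_basis -> exists j, r n j != 0.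
Proof.
move=> on; apply: contrapT => /forallNP h; apply: Vinf.
exists n, (fun i => gs_basis i) => v.
exists (fun i => ip v (gs_basis i)).
apply/eqP; rewrite -subr_eq0 -/(partial_proj gs_basis n v); apply/eqP; apply: ip_def.
rewrite ip_nsq//; apply/eqP; rewrite ofR_eq0.
rewrite -ip_normE// sqrf_eq0 eq_le ip_norm_ge0 andbT.
apply/ler_addgt0Pr => eps e0; rewrite add0r.
have [j hj] := dense_d v e0.
apply: le_trans (ltW hj); apply: ler_wsqrtr.
have -> : d j = partial_proj gs_basis n (d j).
  by apply/eqP; rewrite -subr_eq0; have /negP := h j; rewrite negbK.
exact: (nsq_proj_best v (fun i => ip (d j) (gs_basis i)) on).
Qed.

(** The second part says that the first [n] vectors of [d] lie in the span of
    the first [n] basis vectors, since each step takes care of the first vector not yet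
    in the span; density of [d] then yields the basis property. *)
Lemma gram_schmidt_step n : orthonormal_upto n gs_basis /\
  (forall j, (j < n)%N -> r n j = 0).
Proof.
elim: n => // n [on rn].
have [j0 hj0] := gs_residual_neq0 on.
pose S := [set j | r n j != 0 /\ forall i, (i < j)%N -> r n i = 0].
have [j [rj jmin]] : S !=set0.
  have [j rj jm] := ex_minnP (ex_intro (fun j => r n j != 0) j0 hj0).
  exists j; split=> // i ij; apply/eqP/negP => /negP ri.
  by have := jm i ri; rewrite leqNgt ij.
have bE : gs_basis n = normalize (r n (xget 0%N S)) by rewrite gs_basis_next /gs_next /first_nonzero.
have [rm mmin] : S (xget 0%N S) by apply: xgetPex; exists j.
set m := xget 0%N S in bE rm mmin.
have [n1 n2] := ip_normalize rm.
have orth i : (i < n)%N -> ip (gs_basis n) (gs_basis i) = 0.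
  by move=> ni; rewrite bE /normalize (ipZ hip) ip_partial_projl// mulr0.
have on' : orthonormal_upto n.+1 gs_basis.
  move=> i i'; rewrite !ltnS (leq_eqVlt i) (leq_eqVlt i') => /orP[/eqP->|ni] /orP[/eqP->|ni'].
  - by rewrite eqxx {1 2}bE n2.
  - by rewrite orth// gtn_eqF.
  - by rewrite (ipC hip) orth// conjK0 ltn_eqF.
  - exact: on.
split=> // i.
have rS x : r n.+1 x = r n x - ip (d x) (gs_basis n) *: gs_basis n.
  by rewrite /partial_proj big_ord_recr/= opprD addrA.
have dE x : ip (d x) (gs_basis n) = ip (r n x) (gs_basis n).
  rewrite ipBl// /partial_proj ip_suml// big1 ?subr0// => z _.
  by rewrite (ipZ hip) (ipC hip (gs_basis z)) orth// conjK0 mulr0.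
rewrite rS dE.
have [ri0|ri0] := eqVneq (r n i) 0; first by rewrite ri0 ip0l// scale0r subr0.
rewrite ltnS leq_eqVlt => /orP[/eqP iE|ni]; last by move: ri0; rewrite rn// eqxx.
have mE : m = i.
  apply/eqP; rewrite eqn_leq; apply/andP; split.
    by rewrite leqNgt; apply/negP => im; move: ri0; rewrite mmin// eqxx.
  by rewrite iE leqNgt; apply/negP => im; move: rm; rewrite rn// eqxx.
rewrite mE in bE n1; rewrite bE n1 /normalize scalerA -ofRM.
rewrite divff ?ofR1 ?scale1r ?subrr//.
apply: contra_neq ri0 => h; apply: ip_def.
by rewrite ip_nsq// -ip_normE// h expr0n/= ofR0.
Qed.

Lemma gram_schmidt : orthonormal_basis ip gs_basis.
Proof.
split.
  move=> i j; have [on _] := gram_schmidt_step (maxn i j).+1.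
  by apply: on; rewrite ltnS ?leq_maxl ?leq_maxr.
move=> v eps e0; have [j hj] := dense_d v e0.
exists j.+1, (fun i => ip (d j) (gs_basis i)).
have [_ /(_ j (ltnSn j)) /eqP] := gram_schmidt_step j.+1.
by rewrite subr_eq0 => /eqP dj; rewrite -/(partial_proj gs_basis j.+1 (d j)) -dj.
Qed.

End GramSchmidt.
End Orthonormal.

(** * The Hilbert space and its dual *)

Section Hilbert.
Context {k : scalar_kind} {R : realType}.
Local Notation K := (scalars k R).
Context {H : completeNormedModType K} (ip : {dot H for conjK}).
Hypothesis norm_ip : forall x : H, `|x| ^+ 2 = ip x x.

Lemma dot_semi_inner : semi_inner ip.
Proof.
split.
- by move=> u v w; rewrite linearDl.
- by move=> a u w; rewrite linearZl_LR.
- by move=> u v; rewrite (@hermitian_subproof _ _ _ _ ip) /= mul1r.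
- by move=> u; rewrite -norm_ip exprn_ge0.
Qed.
Local Notation hip := dot_semi_inner.

Lemma dot_def (v : H) : ip v v = 0 -> v = 0.
Proof. by rewrite -norm_ip => /eqP; rewrite sqrf_eq0 normr_eq0 => /eqP. Qed.

Lemma normE (x : H) : `|x| = ofR (ip_norm ip x).
Proof.
apply: (@pexpIrn _ 2) => //; rewrite ?nnegrE ?ofR_ge0 ?ip_norm_ge0//.
by rewrite norm_ip (ip_nsq hip) -(ip_normE hip) expr2 ofRM -expr2.
Qed.

Lemma pos_ofR (e : K) : 0 < e -> exists2 r : R, 0 < r & e = ofR r.
Proof.
move=> e0; exists (reK e); last exact/ge0_ofR/ltW.
by rewrite -(@ofR_gt0 k) -ge0_ofR// ltW.
Qed.

Definition norm_cvg (u : nat -> H) (l : H) : Prop :=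
  forall e : R, 0 < e -> exists N, forall n, (N <= n)%N -> ip_norm ip (u n - l) < e.

Lemma hilbert_complete (u : nat -> H) :
  (forall e : R, 0 < e -> exists N, forall n, (N <= n)%N ->
     ip_norm ip (u N - u n) < e) ->
  exists l, norm_cvg u l.
Proof.
move=> h.
have cu : cauchy (u n @[n --> \oo]).
  apply: cauchy_exP => e e0.
  have [r r0 er] := pos_ofR e0; have [N hN] := h r r0.
  exists (u N), N => // n /= Nn; rewrite -ball_normE /ball_/= er normE ofR_lt.
  exact: hN.
have /cvg_ex[l ul] : cvg (u n @[n --> \oo]) by exact: cauchy_cvg.
exists l => e e0.
have e0' : 0 < (ofR e : K) by rewrite ofR_gt0.
have /cvgrPdist_lt/(_ _ e0')[N _ hN] := ul.
exists N => n Nn; have := hN n Nn.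
by rewrite /= normE ofR_lt (ip_normB hip).
Qed.

Lemma dualD (f g : dual H) x : (f + g) x = f x + g x.
Proof. by rewrite -[LHS]/(\val (f + g) x) raddfD. Qed.

Lemma dualZ a (f : dual H) x : (a *: f) x = a * f x.
Proof. by rewrite -[LHS]/(\val (a *: f) x) linearZ. Qed.

Lemma dual_ext (f g : dual H) : (forall x, f x = g x) -> f = g.
Proof. by move=> h; apply/val_inj/funext. Qed.

Lemma dual_linear (f : dual H) : linear (f : H -> K^o).
Proof. by case: f => f /= /asboolP[]. Qed.

Lemma dualvD (f : dual H) x y : f (x + y) = f x + f y.
Proof. by have := dual_linear f 1 x y; rewrite scale1r => ->; rewrite scale1r. Qed.

Lemma dualv0 (f : dual H) : f 0 = 0.
Proof. by apply: (addrI (f 0)); rewrite -dualvD !addr0. Qed.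

Lemma dualvZ (f : dual H) a x : f (a *: x) = a * f x.
Proof. by have := dual_linear f a x 0; rewrite addr0 => ->; rewrite dualv0 addr0. Qed.

Lemma dualvB (f : dual H) x y : f (x - y) = f x - f y.
Proof. by rewrite dualvD -scaleN1r dualvZ mulN1r. Qed.

Lemma dualv_sum (f : dual H) n (F : 'I_n -> H) : f (\sum_(i < n) F i) = \sum_(i < n) f (F i).
Proof.
by elim/big_rec2: _ => [|i x y _ <-]; [exact: dualv0|rewrite dualvD].
Qed.

(** The bound is squared to stay within the reals. *)
Lemma dual_bounded (f : dual H) :
  exists2 M : R, 0 <= M & forall x, absq (f x) <= M ^+ 2 * reK (ip x x).
Proof.
have cf : continuous (f : H -> K^o) by case: f => f /= /asboolP[].
pose F : {linear H -> K^o} := HB.pack (f : H -> K^o) (GRing.isLinear.Build _ _ _ _ _ (dual_linear f)).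
have /linear_boundedP : bounded_near F (nbhs 0) by apply/linear_bounded_continuous.
move=> /pinfty_ex_gt0[M M0 hM]; have [r r0 Mr] := pos_ofR M0.
exists r => [|x]; first exact: ltW.
have := hM x; rewrite normE Mr -ofRM => h.
rewrite -(@ofR_le k) -normK_absq -(ip_normE hip) -exprMn [X in _ <= X](_ : _ = (ofR (r * ip_norm ip x) : K) ^+ 2).
  by rewrite lerXn2r// nnegrE ofR_ge0 mulr_ge0 ?ip_norm_ge0// ltW.
by rewrite !expr2 -ofRM.
Qed.

Lemma exists_dual (f : H -> K) (M : R) :
  (forall x y, f (x + y) = f x + f y) -> (forall a x, f (a *: x) = a * f x) ->
  (forall x, absq (f x) <= M ^+ 2 * reK (ip x x)) ->
  exists g : dual H, forall x, g x = f x.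
Proof.
move=> fD fZ fM.
have lf : linear (f : H -> K^o) by move=> a x y; rewrite fD fZ.
pose F : {linear H -> K^o} := HB.pack (f : H -> K^o) (GRing.isLinear.Build _ _ _ _ _ lf).
have cf : continuous (f : H -> K^o).
  apply/(linear_bounded_continuous F)/linear_boundedP.
  exists (ofR `|M|); split; first by apply: ger0_real; rewrite ofR_ge0.
  move=> r /= Mr x; apply: (@le_trans _ _ (ofR `|M| * `|x|)); last first.
    by rewrite ler_wpM2r// ltW.
  rewrite normE -ofRM -(@ler_pXn2r _ 2)// ?nnegrE ?ofR_ge0 ?mulr_ge0 ?ip_norm_ge0//.
  rewrite normK_absq expr2 -ofRM -expr2 ofR_le exprMn (ip_normE hip).
  by rewrite real_normK ?num_real.
have ff : (f : H -> K^o) \in @continuous_functional K H by apply/asboolP.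
by exists (Dual ff).
Qed.

Lemma exists_dual_ip (h : H) : exists g : dual H, forall x, g x = ip x h.
Proof.
apply: (@exists_dual (fun x => ip x h) (ip_norm ip h)).
- by move=> x y; rewrite (ipD hip).
- by move=> a x; rewrite (ipZ hip).
- by move=> x; rewrite (ip_normE hip) mulrC; exact: (cauchy_schwarz hip).
Qed.

Definition dual_of (h : H) : dual H := xget 0 [set g : dual H | forall x, g x = ip x h].

Lemma dual_of_ip h x : dual_of h x = ip x h.
Proof.
have [g hg] := exists_dual_ip h.
by have /(_ x) : [set g : dual H | forall x, g x = ip x h] (dual_of h) by apply: xgetPex; exists g.
Qed.

Lemma separable_sequence : separable H ->
  exists d : nat -> H, forall v (e : R), 0 < e -> exists n, ip_norm ip (v - d n) < e.
Proof.
move=> [D [cD dD]].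
have near_D (v : H) (e : R) : 0 < e -> exists2 d, D d & ip_norm ip (v - d) < e.
  move=> e0; have e0' : 0 < (ofR e : K) by rewrite ofR_gt0.
  have [|d [vd Dd]] := dD (ball v (ofR e : K)) _ (ball_open v (ofR e : K)).
    by exists v; exact: ballxx.
  by exists d => //; move: vd; rewrite -ball_normE /ball_/= normE ofR_lt.
have D0 : D !=set0 by have [d Dd _] := near_D 0 1 ltr01; exists d.
have [d dE] : exists d : nat -> H, D `<=` range d by move/pcard_surjP: cD.
exists d => v e e0; have [x Dx vx] := near_D v e e0.
by have [n _ nx] := dE x Dx; exists n; rewrite nx.
Qed.

End Hilbert.

(** * Riesz representation *)

Section Riesz.
Context {k : scalar_kind} {R : realType}.
Local Notation K := (scalars k R).
Context {H : completeNormedModType K} (ip : {dot H for conjK}).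
Hypothesis norm_ip : forall x : H, `|x| ^+ 2 = ip x x.
Local Notation hip := (dot_semi_inner norm_ip).
Local Notation nsq v := (reK (ip v v)).
Local Notation norm_cvg := (norm_cvg ip).

Lemma reK_dual_cvg (f : dual H) (u : nat -> H) (l : H) : norm_cvg u l ->
  reK (f (u n)) @[n --> \oo] --> (reK (f l) : R).
Proof.
move=> ul; have [M M0 hM] := dual_bounded norm_ip f.
apply/cvgrPdist_lt => e e0.
have M1 : 0 < M + 1 by rewrite ltr_wpDl.
have [N hN] := ul (e / (M + 1)) (divr_gt0 e0 M1).
exists N => // n /= Nn; have := hN n Nn; rewrite ltr_pdivlMr// => h.
apply: le_lt_trans h; rewrite -normrN opprB -reKB -dualvB.
have n0 := ip_norm_ge0 ip (u n - l).
rewrite -ler_sqr ?nnegrE ?mulr_ge0 ?(ltW M1)// real_normK ?num_real//.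
apply: le_trans (reK_sqr_le_absq _) _; apply: le_trans (hM _) _.
rewrite exprMn (ip_normE hip) mulrC ler_wpM2l ?(nsq_ge0 hip)//.
by rewrite ler_sqr ?nnegrE ?(ltW M1)// lerDl.
Qed.

Lemma ip_ext h h' : (forall x, ip x h = ip x h') -> h = h'.
Proof.
move=> E; apply/eqP; rewrite -subr_eq0; apply/eqP; apply: (dot_def norm_ip).
by rewrite (ipBr hip) E subrr.
Qed.

Section Basis.
Variable e : nat -> H.
Hypothesis be : orthonormal_basis ip e.

(** The difference is bounded and vanishes on the span of the basis, which is
    dense. *)
Lemma dual_eq_basis (f g : dual H) : (forall i, f (e i) = g (e i)) -> f = g.
Proof.
move=> fg; apply: dual_ext => x; apply/eqP; rewrite -subr_eq0; apply/eqP.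
have fgD : f - g = f + (-1) *: g by rewrite scaleN1r.
have fgE y : (f - g) y = f y - g y by rewrite fgD dualD dualZ mulN1r.
rewrite -fgE; apply: absq_eq0; apply/eqP; rewrite eq_le absq_ge0 andbT.
have [M M0 hM] := dual_bounded norm_ip (f - g).
have M1 : 0 < M + 1 by rewrite ltr_wpDl.
apply/ler_addgt0Pr => eps e0; rewrite add0r.
have s0 : 0 < Num.sqrt eps / (M + 1) by rewrite divr_gt0 ?sqrtr_gt0.
have [N hN] := partial_proj_small hip be x s0; have := hN N (leqnn N).
set p := partial_proj ip e N x => hp.
have -> : (f - g) x = (f - g) (x - p).
  rewrite dualvB [(f - g) p](_ : _ = 0) ?subr0//.
  rewrite fgE /p /partial_proj !dualv_sum -sumrB big1// => i _.
  by rewrite !dualvZ fg subrr.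
apply: le_trans (hM _) _; rewrite -(ip_normE hip) -exprMn -[leRHS](sqr_sqrtr (ltW e0)).
rewrite ler_sqr ?nnegrE ?sqrtr_ge0 ?mulr_ge0 ?ip_norm_ge0//.
move: hp; rewrite ltr_pdivlMr// => hp; apply: le_trans (ltW hp).
by rewrite mulrC ler_wpM2l ?ip_norm_ge0// lerDl.
Qed.

(** The partial sums are Cauchy since the square norm of a difference is a
    difference of partial sums of a convergent real series. *)
Lemma riesz_fischer (c : nat -> K) (B : R) :
  (forall n, \sum_(i < n) absq (c i) <= B) ->
  exists2 l, norm_cvg (fun n => \sum_(i < n) c i *: e i) l &
             forall i, ip l (e i) = c i.
Proof.
move=> cB; pose s n : H := \sum_(i < n) c i *: e i.
pose S n : R := \sum_(i < n) absq (c i).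
have on n : orthonormal_upto ip n e by exact: basis_upto.
have nS n : nsq (s n) = S n by exact: (nsq_lincomb hip _ (on n)).
have S_le m n : (m <= n)%N -> S m <= S n.
  move=> mn; rewrite /S (big_ord_widen n (fun i => absq (c i)) mn) big_mkcond.
  by apply: ler_sum => i _; case: ifP => // _; exact: absq_ge0.
have ipsS m n : (m <= n)%N -> reK (ip (s m) (s n)) = S m.
  move=> mn; rewrite /s /S (ip_suml hip) (eq_bigr (fun i : 'I_m => ofR (absq (c i)))).
    by elim/big_rec2: _ => [|i x y _ <-]; rewrite ?reK0// reKD reK_ofR.
  move=> i _; rewrite (ipZ hip) (ipC hip) (ip_lincombl hip c (on n)) ?mul_conjK//.
  exact: leq_trans (ltn_ord i) mn.
have Sc : cvgn S.
  apply: nondecreasing_is_cvgn => [m n mn|]; first exact: S_le.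
  by exists B => _ [n _ <-]; exact: cB.
have [|l sl] := @hilbert_complete _ _ _ ip norm_ip s.
  move=> eps e0.
  have e2 : 0 < eps ^+ 2 by rewrite exprn_gt0.
  have /cvgrPdist_lt/(_ _ e2)[N _ hN] := Sc.
  exists N => n Nn; rewrite -ltr_sqr ?nnegrE ?ip_norm_ge0 ?(ltW e0)// (ip_normE hip).
  rewrite (nsqB hip) !nS ipsS//.
  have Sn : S n <= limn S.
    by apply: nondecreasing_cvgn_le => // m n' mn; exact: S_le.
  have := hN N (leqnn N); rewrite /= ltr_norml => /andP[_ h]; lra.
exists l => // i.
apply/eqP; rewrite -subr_eq0; apply/eqP; apply: absq_eq0.
apply/eqP; rewrite eq_le absq_ge0 andbT; apply/ler_addgt0Pr => eps e0; rewrite add0r.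
have s0 : 0 < Num.sqrt eps by rewrite sqrtr_gt0.
have [N hN] := sl _ s0.
pose n := maxn N i.+1; have := hN n (leq_maxl _ _) => hn.
have -> : ip l (e i) - c i = ip (l - s n) (e i).
  by rewrite (ipBl hip) (ip_lincombl hip c (on n)) ?leq_maxr.
apply: le_trans (cauchy_schwarz hip _ _) _.
rewrite be.1 eqxx reK1 mulr1 -(ip_normE hip) (ip_normB hip) -[leRHS](sqr_sqrtr (ltW e0)).
by rewrite ler_sqr ?nnegrE ?sqrtr_ge0 ?ip_norm_ge0// ltW.
Qed.

(** The coefficients of the representative must be the conjugates of [f (e i)].
    Evaluating [f] on the partial sums shows that they are square summable. *)
Lemma riesz_exists (f : dual H) : exists h, forall x, f x = ip x h.
Proof.
have [M M0 hM] := dual_bounded norm_ip f.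
pose c i := conjK (f (e i)).
have on n : orthonormal_upto ip n e by exact: basis_upto.
have [|h _ hE] := @riesz_fischer c (M ^+ 2).
  move=> n; set S := \sum_(i < n) _.
  have S0 : 0 <= S by rewrite sumr_ge0// => i _; exact: absq_ge0.
  have := hM (\sum_(i < n) c i *: e i); rewrite (nsq_lincomb hip _ (on n)) -/S.
  rewrite dualv_sum (_ : \sum_(i < n) f (c i *: e i) = ofR S).
    rewrite absq_ofR expr2; have [->|S1] := eqVneq S 0; first by rewrite sqr_ge0.
    by rewrite ler_pM2r// lt_def S1.
  rewrite /S; elim: (n) => [|m ih]; first by rewrite !big_ord0 ofR0.
  rewrite !big_ord_recr/= ih ofRD dualvZ; congr (_ + _).
  by rewrite absq_conj mulrC mul_conjK.
exists h => x; rewrite -(dual_of_ip norm_ip)//; congr (dual_fun _ _).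
apply: dual_eq_basis => i; rewrite (dual_of_ip norm_ip)// (ipC hip) hE /c.
by rewrite conjKK.
Qed.

Lemma rieszE (f : dual H) x : f x = ip x (riesz ip f).
Proof.
have h := riesz_exists f.
by have /(_ x) : [set h | forall x, f x = ip x h] (riesz ip f) by exact: xgetPex.
Qed.

Lemma riesz_unique (f : dual H) h : (forall x, f x = ip x h) -> riesz ip f = h.
Proof. by move=> E; apply: ip_ext => x; rewrite -rieszE. Qed.

Lemma riesz_dual_of h : riesz ip (dual_of ip h) = h.
Proof. by apply: riesz_unique => x; exact: (dual_of_ip norm_ip). Qed.

Lemma dual_of_riesz (f : dual H) : dual_of ip (riesz ip f) = f.
Proof. by apply: dual_ext => x; rewrite (dual_of_ip norm_ip) -rieszE. Qed.

Lemma rieszD (f g : dual H) : riesz ip (f + g) = riesz ip f + riesz ip g.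
Proof. by apply: riesz_unique => x; rewrite dualD (ipDr hip) -!rieszE. Qed.

Lemma rieszZ a (f : dual H) : riesz ip (a *: f) = conjK a *: riesz ip f.
Proof. by apply: riesz_unique => x; rewrite dualZ (ipZr hip) conjKK -rieszE. Qed.

Lemma dual_semi_inner : semi_inner (dual_ip ip).
Proof.
rewrite /dual_ip; split.
- by move=> f g h; rewrite rieszD (ipDr hip).
- by move=> a f g; rewrite rieszZ (ipZr hip) conjKK.
- by move=> f g; rewrite (ipC hip).
- by move=> f; exact: ip_ge0 hip _.
Qed.

Lemma dual_ip_def (f : dual H) : dual_ip ip f f = 0 -> f = 0.
Proof.
move=> /(dot_def norm_ip) f0; rewrite -[LHS]dual_of_riesz f0.
apply: dual_ext => x; rewrite (dual_of_ip norm_ip) (ip0r hip).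
by apply/esym; apply: (addrI ((0 : dual H) x)); rewrite -dualD !addr0.
Qed.

Lemma dual_ip_norm (f : dual H) : ip_norm (dual_ip ip) f = ip_norm ip (riesz ip f).
Proof. by []. Qed.

Lemma dual_ipE (f g : dual H) : dual_ip ip f g = f (riesz ip g).
Proof. by rewrite rieszE. Qed.

Lemma riesz_sum n (F : 'I_n -> dual H) :
  riesz ip (\sum_(i < n) F i) = \sum_(i < n) riesz ip (F i).
Proof.
elim/big_rec2: _ => [|i x y _ <-]; last by rewrite rieszD.
by apply: (addrI (riesz ip 0)); rewrite -rieszD !addr0.
Qed.

Lemma rieszB (f g : dual H) : riesz ip (f - g) = riesz ip f - riesz ip g.
Proof. by rewrite rieszD -scaleN1r rieszZ conjKN conjK1 scaleN1r. Qed.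

Lemma dual_basis_of (b : nat -> H) : orthonormal_basis ip b ->
  orthonormal_basis (dual_ip ip) (fun n => dual_of ip (b n)).
Proof.
move=> [on dn]; split.
  by move=> i j; rewrite /dual_ip !riesz_dual_of on eq_sym.
move=> f eps e0; have [n [c hc]] := dn (riesz ip f) eps e0.
exists n, (fun i => conjK (c i)); rewrite dual_ip_norm rieszB riesz_sum.
by under eq_bigr do rewrite rieszZ conjKK riesz_dual_of.
Qed.

Lemma basis_of_dual (b : nat -> dual H) : orthonormal_basis (dual_ip ip) b ->
  orthonormal_basis ip (fun n => riesz ip (b n)).
Proof.
move=> [on dn]; split.
  by move=> i j; have := on j i; rewrite /dual_ip eq_sym.
move=> v eps e0; have [n [c hc]] := dn (dual_of ip v) eps e0.
exists n, (fun i => conjK (c i)); move: hc; rewrite dual_ip_norm rieszB riesz_sum riesz_dual_of.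
by under eq_bigr do rewrite rieszZ.
Qed.

End Basis.
End Riesz.

(** * Uniqueness of non-negative square roots *)

Section SquareRoots.
Context {k : scalar_kind} {R : realType}.
Local Notation K := (scalars k R).
Context {V : lmodType K}.
Variables (ip : V -> V -> K) (hip : semi_inner ip).
Hypothesis ip_def : forall v, ip v v = 0 -> v = 0.
Local Notation nsq v := (reK (ip v v)).

Lemma operator_semi_inner (A : {linear V -> V}) :
  self_adjoint ip A -> nonnegative_operator ip A ->
  semi_inner (fun u v => ip (A u) v).
Proof.
move=> sA nA; split=> [u v w|a u w|u v|u].
- by rewrite linearD (ipD hip).
- by rewrite linearZ (ipZ hip).
- by rewrite sA (ipC hip).
- exact: nA.
Qed.

Lemma bounded_operator_pos (A : V -> V) : bounded_operator ip A ->
  exists2 a : R, 0 < a & forall v, ip_norm ip (A v) <= a * ip_norm ip v.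
Proof.
move=> [M hM]; exists (`|M| + 1); first by rewrite ltr_wpDl.
move=> v; apply: le_trans (hM v) _; apply: ler_wpM2r; first exact: ip_norm_ge0.
by rewrite (le_trans (ler_norm _))// lerDl.
Qed.

(** Cauchy-Schwarz for the form [<A u, v>] at [v] and [A v]. *)
Lemma nsq_operator_le (A : {linear V -> V}) (a : R) :
  self_adjoint ip A -> nonnegative_operator ip A -> 0 < a ->
  (forall v, ip_norm ip (A v) <= a * ip_norm ip v) ->
  forall v, nsq (A v) <= a * reK (ip (A v) v).
Proof.
move=> sA nA a0 hA v.
have hA' := operator_semi_inner sA nA.
have cs := cauchy_schwarz hA' v (A v).
have e1 : absq (ip (A v) (A v)) = nsq (A v) ^+ 2.
  by rewrite (ip_nsq hip) absq_ofR reK_ofR.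
have al0 : 0 <= reK (ip (A v) v) by apply: reK_ge0; exact: nA.
have n0 := nsq_ge0 hip (A v).
have e2 : reK (ip (A (A v)) (A v)) <= a * nsq (A v).
  apply: le_trans (le_trans (ler_norm _) (reK_ip_le hip _ _)) _.
  rewrite -(ip_normE hip) expr2 mulrA; apply: ler_wpM2r; first exact: ip_norm_ge0.
  exact: hA.
have [n1|n1] := eqVneq (nsq (A v)) 0; first by rewrite n1 mulr_ge0// ltW.
have n2 : 0 < nsq (A v) by rewrite lt_def n1.
rewrite -(ler_pM2r n2) -expr2 -e1; apply: le_trans cs _.
rewrite [leRHS](_ : _ = reK (ip (A v) v) * (a * nsq (A v))); last by ring.
exact: ler_wpM2l.
Qed.

(** Let [D] be the difference of the two roots. The identity [A D = - D B] makes
    [<A v, D^2 v>] non-positive, so [A v] is small wherever [v] is nearly an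
    eigenvector of [D^2] for a positive eigenvalue [mu]. The same holds for
    [B v], hence for [D v], whereas [|D v|^2] is about [mu |v|^2] there. *)
Section TwoRoots.
Variables A B : {linear V -> V}.
Hypothesis sA : self_adjoint ip A.
Hypothesis nA : nonnegative_operator ip A.
Hypothesis sB : self_adjoint ip B.
Hypothesis nB : nonnegative_operator ip B.
Hypothesis AB : forall v, A (A v) = B (B v).
Variable a : R.
Hypothesis a0 : 0 < a.
Hypothesis hA : forall v, ip_norm ip (A v) <= a * ip_norm ip v.

Let D v := A v - B v.

Lemma root_diff_adjoint u v : ip (D u) v = ip u (D v).
Proof. by rewrite /D (ipBl hip) sA sB (ipBr hip). Qed.

Lemma root_diff_anticomm v : A (D v) = - D (B v).
Proof. by rewrite /D linearB /= AB opprB. Qed.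

Lemma root_defect (mu : R) v : 0 <= mu ->
  mu ^+ 2 * nsq (A v) <= a ^+ 2 * nsq (D (D v) - ofR mu *: v).
Proof.
move=> mu0; set w := D (D v); set eta := nsq (w - _).
set al := reK (ip (A v) v).
have al0 : 0 <= al by apply: reK_ge0; exact: nA.
have h1 : reK (ip (A v) w) <= 0.
  rewrite -(reK_conj (ip (A v) w)) -(ipC hip) -sA root_diff_anticomm (ipNl hip) reKN.
  rewrite oppr_le0 root_diff_adjoint; apply: reK_ge0; exact: nB.
have h2 : reK (ip (A v) (w - ofR mu *: v)) = reK (ip (A v) w) - mu * al.
  by rewrite (ipBr hip) (ipZr hip) conjKR reKB reK_scale.
have nAv : nsq (A v) <= a * al := nsq_operator_le sA nA a0 hA v.
have eta0 : 0 <= eta by exact: nsq_ge0.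
have h3 : (mu * al) ^+ 2 <= a * al * eta.
  apply: (@le_trans _ _ (nsq (A v) * eta)); last exact: ler_wpM2r.
  apply: (le_trans _ (cauchy_schwarz hip (A v) (w - ofR mu *: v))).
  apply: (le_trans _ (reK_sqr_le_absq _)); rewrite h2 -[leRHS]sqrrN.
  by rewrite ler_sqr ?nnegrE ?opprB; nra.
have h4 : mu ^+ 2 * al <= a * eta.
  have [->|al1] := eqVneq al 0; first by rewrite mulr0 mulr_ge0// ltW.
  have al2 : 0 < al by rewrite lt_def al1.
  rewrite -(ler_pM2r al2); move: h3; rewrite exprMn; lra.
apply: (@le_trans _ _ (mu ^+ 2 * (a * al))).
  by apply: ler_wpM2l => //; exact: sqr_ge0.
rewrite mulrCA [a ^+ 2]expr2 -mulrA; apply: ler_wpM2l => //; exact: ltW.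
Qed.

(** Vectors on which [D] nearly attains the bound [mu] are nearly eigenvectors
    of [D^2]. *)
Lemma root_diff_eigen_defect (mu : R) v :
  (forall u, nsq (D u) <= mu * nsq u) ->
  nsq (D (D v) - ofR mu *: v) <= mu * (mu * nsq v - nsq (D v)).
Proof.
move=> h; rewrite (nsqB hip) (nsqZ hip) absq_ofR (ipZr hip) conjKR reK_scale.
rewrite (root_diff_adjoint (D v) v).
have := h (D v); lra.
Qed.

End TwoRoots.

Lemma bounded_operator_nsq (A : V -> V) (a : R) : 0 < a ->
  (forall v, ip_norm ip (A v) <= a * ip_norm ip v) ->
  forall v, nsq (A v) <= a ^+ 2 * nsq v.
Proof.
move=> a0 h v; rewrite -!(ip_normE hip) -exprMn ler_sqr ?nnegrE ?ip_norm_ge0//.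
by rewrite mulr_ge0 ?ip_norm_ge0// ltW.
Qed.

(** If [|D v|^2 <= mu |v|^2] for all [v] with [mu > 0], then [root_defect] and
    [root_diff_eigen_defect] combine with [|D v|^2 <= 2 |A v|^2 + 2 |B v|^2]
    into the same bound with the strictly smaller constant
    [4 a^2 mu / (mu + 4 a^2)]. So the best constant is [0]. *)
Theorem nonnegative_root_unique (A B : {linear V -> V}) :
  bounded_operator ip A -> self_adjoint ip A -> nonnegative_operator ip A ->
  bounded_operator ip B -> self_adjoint ip B -> nonnegative_operator ip B ->
  (forall v, A (A v) = B (B v)) -> forall v, A v = B v.
Proof.
move=> /bounded_operator_pos[a1 a10 hA1] sA nA /bounded_operator_pos[b1 b10 hB1] sB nB AB.
pose a := a1 + b1.
have a0 : 0 < a by rewrite addr_gt0.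
have hA v : ip_norm ip (A v) <= a * ip_norm ip v.
  by rewrite (le_trans (hA1 v))// ler_wpM2r ?ip_norm_ge0// lerDl ltW.
have hB v : ip_norm ip (B v) <= a * ip_norm ip v.
  by rewrite (le_trans (hB1 v))// ler_wpM2r ?ip_norm_ge0// lerDr ltW.
pose D v := A v - B v.
have D_le v : nsq (D v) <= 2 * nsq (A v) + 2 * nsq (B v).
  have := nsq_ge0 hip (A v + B v).
  rewrite (nsqD hip) /D (nsqB hip); lra.
have step mu : 0 < mu -> (forall v, nsq (D v) <= mu * nsq v) ->
    forall v, nsq (D v) <= 4 * a ^+ 2 * mu / (mu + 4 * a ^+ 2) * nsq v.
  move=> mu0 hmu v.
  have dA := root_defect sA nA sB nB AB a0 hA v (ltW mu0).
  have hmu' u : nsq (B u - A u) <= mu * nsq u by rewrite -opprB (nsqN hip); exact: hmu.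
  have dB := root_defect sB nB sA nA (fun v => esym (AB v)) a0 hB v (ltW mu0).
  have eA := root_diff_eigen_defect sA sB v hmu.
  have eB := root_diff_eigen_defect sB sA v hmu'.
  have DE : nsq (B v - A v) = nsq (D v) by rewrite -opprB (nsqN hip).
  rewrite DE in eB.
  have a2 : 0 < a ^+ 2 by rewrite exprn_gt0.
  have sA' := ler_wpM2l (ltW a2) eA; have sB' := ler_wpM2l (ltW a2) eB.
  have key : mu * (mu * nsq (D v)) <= mu * (4 * a ^+ 2 * (mu * nsq v - nsq (D v))).
    have := ler_wpM2l (sqr_ge0 mu) (D_le v).
    rewrite -/(D v) in sA' dA; lra.
  rewrite ler_pM2l// in key.
  have m4 : 0 < mu + 4 * a ^+ 2 by rewrite addr_gt0// mulr_gt0.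
  rewrite mulrAC ler_pdivlMr//; lra.
pose M := [set mu : R | 0 <= mu /\ forall v, nsq (D v) <= mu * nsq v].
have Ma : M (4 * a ^+ 2).
  split; first by rewrite mulr_ge0// sqr_ge0.
  move=> v; apply: le_trans (D_le v) _.
  have := bounded_operator_nsq a0 hA v; have := bounded_operator_nsq a0 hB v; lra.
have hi : has_inf M by split; [exists (4 * a ^+ 2)|exists 0 => x []].
have i0 : 0 <= inf M by apply: lb_le_inf; [exists (4 * a ^+ 2)|move=> x []].
have Mi : M (inf M).
  split=> // v; apply/ler_addgt0Pr => eps e0.
  have n0 := nsq_ge0 hip v.
  have n1 : 0 < nsq v + 1 by rewrite ltr_wpDl.
  have [m [m0 hm] mi] := inf_adherent (divr_gt0 e0 n1) hi.
  apply: le_trans (hm v) _; apply: le_trans (ler_wpM2r n0 (ltW mi)) _.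
  rewrite mulrDl lerD2l -mulrA ger_pMr// mulrC ler_pdivrMr// mul1r; lra.
have iE : inf M = 0.
  apply/eqP; rewrite eq_le i0 andbT leNgt; apply/negP => i1.
  have a2 : 0 < a ^+ 2 by rewrite exprn_gt0.
  have m4 : 0 < inf M + 4 * a ^+ 2 by rewrite addr_gt0// mulr_gt0.
  have : inf M <= 4 * a ^+ 2 * inf M / (inf M + 4 * a ^+ 2).
    apply: ge_inf; first exact: hi.2.
    split; first by rewrite divr_ge0 ?(ltW m4)// mulr_ge0// mulr_ge0// ltW.
    exact: step Mi.2.
  rewrite ler_pdivlMr// mulrDr [X in _ + X]mulrC gerDr -expr2.
  by rewrite leNgt exprn_gt0.
move=> v; apply/eqP; rewrite -subr_eq0; apply/eqP; apply: ip_def.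
rewrite (ip_nsq hip); apply/eqP; rewrite ofR_eq0 eq_le nsq_ge0// andbT.
by have := Mi.2 v; rewrite iE mul0r.
Qed.

(** The square of the absolute value of [A] is [A^2] as [A] is self-adjoint, so
    this absolute value is [A], by uniqueness of non-negative roots. *)
Theorem trace_class_nonneg (A : {linear V -> V}) :
  self_adjoint ip A -> nonnegative_operator ip A -> trace_class ip A ->
  exists e : nat -> V, orthonormal_basis ip e /\
    (\sum_(0 <= n <oo) (reK (ip (A (e n)) (e n)))%:E < +oo)%E.
Proof.
move=> sA nA [bA [B [e [[bB sB nB [A' [adA BB]]] be tr]]]].
exists e; split=> //.
have A'E v : A' v = A v.
  apply/eqP; rewrite -subr_eq0; apply/eqP; apply: ip_def.
  by rewrite (ipBr hip) -adA sA subrr.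
have AB : forall v, A v = B v.
  by apply: nonnegative_root_unique => // v; rewrite BB A'E.
by under eq_eseriesr do rewrite AB.
Qed.

End SquareRoots.

(** * The covariance form of a symmetric field *)

Section RealParts.
Context {k : scalar_kind} {R : realType}.
Local Notation K := (scalars k R).

(** The real coordinates of [z] are the [reK (u * z)] for [u] in [units]: since
    [- i * z] has real part [Im z], the second entry is [- i]. *)
Definition units : seq K :=
  match k return seq (scalars k R) with
  | RealScalars => [:: 1]
  | ComplexScalars => [:: 1; Complex 0 (-1)]
  end.

Lemma absq_units (z : K) : absq z = \sum_(u <- units) reK (u * z) ^+ 2.
Proof.
rewrite /units /absq; case: k z => /= [z|[a b]].
  by rewrite big_seq1 mul1r expr2.
by rewrite big_cons big_seq1 /=; ring.
Qed.

Lemma reK_mul_conj_units (z w : K) :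
  reK (z * conjK w) = \sum_(u <- units) reK (u * z) * reK (u * w).
Proof.
rewrite /units; case: k z w => /= [z w|[a b] [c d]].
  by rewrite big_seq1 !mul1r.
by rewrite big_cons big_seq1 /=; ring.
Qed.

Lemma units_expand (z : K) : z = \sum_(u <- units) conjK u * ofR (reK (u * z)).
Proof.
rewrite /units; case: k z => /= [z|[a b]].
  by rewrite big_seq1 !mul1r.
by rewrite big_cons big_seq1 /=; apply/eqP; rewrite eq_complex/=; apply/andP; split; apply/eqP; ring.
Qed.

Lemma units_expand_conj (z : K) : z = \sum_(u <- units) ofR (reK (conjK u * z)) * u.
Proof.
rewrite /units; case: k z => /= [z|[a b]].
  by rewrite big_seq1 mulr1 mul1r.
by rewrite big_cons big_seq1 /=; apply/eqP; rewrite eq_complex/=; apply/andP; split; apply/eqP; ring.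
Qed.

Lemma absq_unit u : u \in units -> absq u = 1.
Proof.
rewrite /units /absq; case: k u => /= u.
  by rewrite inE => /eqP ->; rewrite mulr1.
rewrite !inE => /orP[] /eqP -> /=; ring.
Qed.

(** Equality of scalars is reduced to equality of real integrals by this
    criterion, which spares a case distinction on [k]. *)
Lemma reK_ext (z w : K) : (forall a, reK (a * z) = reK (a * w)) -> z = w.
Proof.
by move=> h; rewrite [z]units_expand [w]units_expand; apply: eq_bigr => u _; rewrite h.
Qed.

End RealParts.

Section ExpectationK.
Context {k : scalar_kind} {R : realType} {d : measure_display} {T : measurableType d}.
Variable P : probability T R.
Local Notation K := (scalars k R).

Definition integrableK (Z : T -> K) : Prop :=
  forall a, P.-integrable setT (fun w => (reK (a * Z w))%:E).

Lemma reK_expectationK (Z : T -> K) a : integrableK Z ->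
  reK (a * expectationK P Z) = fine (\int[P]_w (reK (a * Z w))%:E).
Proof.
move: Z a; rewrite /integrableK /expectationK; case: k => /= Z a iZ.
  have i1 : P.-integrable setT (fun w => (Z w)%:E) by under eq_fun do rewrite -[Z _]mul1r.
  rewrite unlock; under [in RHS]eq_integral do rewrite EFinM.
  by rewrite integralZl// fineM//; exact: integrable_fin_num.
have iR : P.-integrable setT (fun w => (complex.Re (Z w))%:E).
  by have := iZ 1; under eq_fun do rewrite mul1r.
have iI : P.-integrable setT (fun w => (complex.Im (Z w))%:E).
  rewrite (_ : (fun w => _) = (fun w => (complex.Re (Complex 0 (-1) * Z w))%:E)).
    exact: iZ.
  by apply/funext => w; congr EFin; case: (Z w) => x y /=; ring.
rewrite !unlock; case: a => x y /=.
transitivity (fine (\int[P]_w (x%:E * (complex.Re (Z w))%:E + (- y)%:E * (complex.Im (Z w))%:E)))%E.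
  rewrite integralD//; [|exact: integrableZl|exact: integrableZl].
  have fR := integrable_fin_num measurableT iR; have fI := integrable_fin_num measurableT iI.
  by rewrite !integralZl// -(fineK fR) -(fineK fI) -!EFinM -EFinD /= mulNr.
congr fine; apply: eq_integral => w _; case: (Z w) => p q /=.
by rewrite -!EFinM -EFinD mulNr.
Qed.

Lemma expectationK_ge0 (Z : T -> K) : integrableK Z ->
  (forall w, 0 <= Z w) -> 0 <= expectationK P Z.
Proof.
move: Z; rewrite /integrableK /expectationK; case: k => /= Z iZ Z0.
  by rewrite fine_ge0// unlock integral_ge0// => w _; rewrite lee_fin.
rewrite lecE /=; apply/andP; split; last first.
  rewrite fine_ge0// unlock integral_ge0// => w _; rewrite lee_fin.
  by have := Z0 w; rewrite lecE => /andP[].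
rewrite unlock (eq_integral (cst 0%E)) ?integral0// => w _.
by have := Z0 w; rewrite lecE /= => /andP[/eqP -> _].
Qed.

Lemma symmetric_gaussian_reK (Z : T -> K) : gaussian P Z -> symmetric_rv P Z ->
  exists2 s, 0 <= s & gauss_law P (fun w => reK (Z w)) s.
Proof.
move: Z; rewrite /gaussian /symmetric_rv; case: k => /= Z.
  by move=> rg E0; exact: real_gaussian_centered.
move=> jg [E0 _]; apply: real_gaussian_centered.
  by have := jg 1 0; under eq_fun do rewrite mul1r mul0r addr0.
by move: E0 => [].
Qed.

Lemma symmetric_mean0 (Z : T -> K) : symmetric_rv P Z -> expectationK P Z = 0.
Proof. by move: Z; rewrite /symmetric_rv; case: k => //= Z []. Qed.

End ExpectationK.

Section Covariance.
Context {k : scalar_kind} {R : realType}.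
Local Notation K := (scalars k R).
Context {H : completeNormedModType K} (ip : {dot H for conjK}).
Hypothesis norm_ip : forall x : H, `|x| ^+ 2 = ip x x.
Context {d : measure_display} {T : measurableType d} (P : probability T R).
Variable X : T -> H.
Hypothesis symX : symmetric_gaussian_field P X.

Lemma symmetric_field_law (f : dual H) :
  exists2 s, 0 <= s & gauss_law P (fun w => reK (f (X w))) s.
Proof.
have [[_ gX] sX] := symX; exact: symmetric_gaussian_reK.
Qed.

Lemma field_square_integrable (f : dual H) :
  square_integrable P (fun w => reK (f (X w))).
Proof. by have [s _] := symmetric_field_law f; exact: gauss_law_square_integrable. Qed.

Lemma field_mean0 (f : dual H) : expectationK P (fun w => f (X w)) = 0.
Proof.
by have [_ sX] := symX; exact: symmetric_mean0.
Qed.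

Lemma covariance_functionE (f g : dual H) : covariance_function P X f g =
  expectationK P (fun w => f (X w) * conjK (g (X w))).
Proof.
rewrite /covariance_function /covarianceK !field_mean0.
by under eq_fun do rewrite !subr0.
Qed.

Lemma field_integrableK (f g : dual H) :
  integrableK P (fun w => f (X w) * conjK (g (X w))).
Proof.
move=> a; under eq_fun => w do rewrite mulrA -dualZ reK_mul_conj_units -sumEFin.
apply: integrable_sum => // u _.
under eq_fun do rewrite -!dualZ.
by apply: square_integrableM; exact: field_square_integrable.
Qed.

Definition field_cov (f g : dual H) : K := expectationK P (fun w => f (X w) * conjK (g (X w))).

Lemma field_cov_semi_inner : semi_inner field_cov.
Proof.
split.
- move=> f g h; apply: reK_ext => a; rewrite mulrDr reKD !reK_expectationK; try exact: field_integrableK.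
  rewrite -fineD ?integrable_fin_num//; try exact: field_integrableK.
  rewrite -integralD//; try exact: field_integrableK.
  by congr fine; apply: eq_integral => w _; rewrite dualD mulrDl mulrDr reKD.
- move=> b f h; apply: reK_ext => a; rewrite mulrA !reK_expectationK; try exact: field_integrableK.
  by congr fine; apply: eq_integral => w _; rewrite dualZ !mulrA.
- move=> f g; apply: reK_ext => a.
  rewrite -[RHS]reK_conj conjKM conjKK !reK_expectationK; try exact: field_integrableK.
  congr fine; apply: eq_integral => w _.
  by rewrite -[in RHS]reK_conj !conjKM !conjKK [conjK (g _) * _]mulrC.
- move=> f; apply: expectationK_ge0; first exact: field_integrableK.
  by move=> w; rewrite mul_conjK ofR_ge0 absq_ge0.
Qed.

Lemma field_varE (f : dual H) : ((reK (field_cov f f))%:E = \int[P]_w (absq (f (X w)))%:E)%E.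
Proof.
rewrite -[field_cov f f]mul1r reK_expectationK; last exact: field_integrableK.
rewrite fineK; last by apply: integrable_fin_num => //; exact: field_integrableK.
by apply: eq_integral => w _; rewrite mul1r.
Qed.

End Covariance.

(** * Gaussian sequences bounded in square sum *)

Section GaussianTightness.
Context {R : realType} {d : measure_display} {T : measurableType d}.
Variable P : probability T R.

Lemma probability_tail_small (Q : T -> R) (dl : R) : measurable_fun setT Q -> 0 < dl ->
  exists M : nat, (P [set w | (M%:R < Q w)%R] < dl%:E)%E.
Proof.
move=> mQ dl0.
have mQ' : @measurable_fun _ _ T (measurableTypeR R) setT Q by exact: mQ.
pose m := distribution P (@mfun_of _ _ T (measurableTypeR R) Q mQ').
have [M hM] := cdf_of_large m dl0.
exists M; have mE : measurable (Q @^-1` `]-oo, M%:R]%classic).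
  by rewrite -[X in measurable X]setTI; exact: mQ.
have -> : [set w | M%:R < Q w] = ~` (Q @^-1` `]-oo, M%:R]%classic).
  by apply/seteqP; split=> w /=; rewrite in_itv/= ltNge => /negP.
rewrite probability_setC//.
have -> : P (Q @^-1` `]-oo, M%:R]%classic) = (cdf_of m M%:R)%:E by rewrite -cdf_ofE.
by rewrite -EFinD lte_fin; lra.
Qed.

(** Outside the event [Q > M], of probability at most [dl], bound the sum of
    squares by [M]; on it, use [y^2 <= y^4 / (2 la w) + la w / 2]. As the fourth
    moment of [Y i] is a multiple of [s i ^+ 4], taking [w] close to [s i ^+ 2]
    makes each term contribute at most about a quarter of the expected sum of
    squares, for suitable [la] and [dl]; both are absorbed into the left-hand side. *)
Lemma gaussian_square_sums_bounded (Y : nat -> T -> R) (s : nat -> R) (Q : T -> R) :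
  (forall i, gauss_law P (Y i) (s i)) -> measurable_fun setT Q ->
  (forall n w, \sum_(i < n) Y i w ^+ 2 <= Q w) ->
  exists B, forall n, \sum_(i < n) s i ^+ 2 <= B.
Proof.
move=> lY mQ YQ.
have c2 := @normal_moment2_gt0 R; have c4 := @normal_moment4_ge0 R.
set a2 : R := normal_moment2 in c2; set a4 : R := normal_moment4 in c4.
(* the choices of la and dl give a4 / (2 * la) <= a2 / 4 and
   la * dl / 2 = a2 / 4 *)
pose la := 2 * (a4 + 1) / a2.
have a41 : 0 < a4 + 1 by rewrite ltr_wpDl.
have la0 : 0 < la by rewrite divr_gt0// mulr_gt0.
pose dl := a2 / (2 * la).
have dl0 : 0 < dl by rewrite divr_gt0// mulr_gt0.
have [M hM] := probability_tail_small mQ dl0.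
set E := [set w | M%:R < Q w] in hM.
have mE : measurable E.
  rewrite (_ : E = Q @^-1` `]M%:R, +oo[%classic).
    by rewrite -[X in measurable X]setTI; exact: mQ.
  by apply/seteqP; split=> w; rewrite /E/= in_itv/= andbT.
exists (2 * M%:R / a2 + 1) => n.
pose Ss := \sum_(i < n) s i ^+ 2.
have Ss0 : 0 <= Ss by rewrite sumr_ge0// => i _; rewrite sqr_ge0.
(* the weights have to be positive even when s i = 0; the n corrections add
   up to at most 1 *)
pose w_ i := s i ^+ 2 + (n.+1%:R)^-1.
have w0 i : 0 < w_ i by rewrite ltr_wpDl ?sqr_ge0// invr_gt0.
pose W := \sum_(i < n) w_ i.
have W1 : W <= Ss + 1.
  rewrite /W /w_ big_split/= lerD2l sumr_const card_ord -[_ *+ n]mulr_natl.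
  by rewrite ler_pdivrMr// mul1r ler_nat.
have mY i : measurable_fun setT (Y i) by case: (lY i).
have lw i : 0 < 2 * la * w_ i by rewrite mulr_gt0// mulr_gt0.
have c0 i : 0 <= (2 * la * w_ i)^-1.
  by rewrite invr_ge0 mulr_ge0 ?(ltW (w0 i))// mulr_ge0 ?(ltW la0).
have pt x : \sum_(i < n) Y i x ^+ 2 <=
    M%:R + \sum_(i < n) ((2 * la * w_ i)^-1 * Y i x ^+ 4) + (la * W / 2) * \1_E x.
  have t0 i : 0 <= (2 * la * w_ i)^-1 * Y i x ^+ 4.
    by rewrite mulr_ge0 ?exprn_even_ge0.
  rewrite indicE; have [xE|xE] := boolP (x \in E); rewrite /= ?mulr1 ?mulr0 ?addr0; last first.
    apply: le_trans (YQ n x) _; move: xE; rewrite notin_setE /E/= => /negP.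
    by rewrite -leNgt => h; rewrite (le_trans h)// lerDl sumr_ge0.
  apply: (@le_trans _ _ (\sum_(i < n) ((2 * la * w_ i)^-1 * Y i x ^+ 4 + la * w_ i / 2))).
    apply: ler_sum => i _; rewrite -[Y i x ^+ 4]/(Y i x ^+ (2 * 2)%N) exprM.
    rewrite (_ : _ + _ = Y i x ^+ 2 + (Y i x ^+ 2 - la * w_ i) ^+ 2 / (2 * la * w_ i)).
      by rewrite lerDl divr_ge0 ?sqr_ge0// (ltW (lw i)).
    by field; rewrite !lt0r_neq0.
  rewrite big_split/= (_ : \sum_(i < n) la * w_ i / 2 = la * W / 2).
    by rewrite lerD2r lerDr ler0n.
  by rewrite /W mulr_sumr mulr_suml.
have W0 : 0 <= W by rewrite sumr_ge0// => i _; exact: ltW.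
have mY4 i : measurable_fun setT (fun x => (Y i x ^+ 4)%:E).
  by apply/measurable_EFinP; exact: measurable_funX.
have mE4 : measurable_fun setT (fun x : T => (\1_E x)%:E : \bar R).
  by apply/measurable_EFinP; exact: measurable_indic.
have ES : (\int[P]_x (\sum_(i < n) Y i x ^+ 2)%:E = (a2 * Ss)%:E)%E.
  under eq_integral do rewrite -sumEFin.
  rewrite ge0_integral_sum//; last 2 first.
  - by move=> i; apply/measurable_EFinP; exact: measurable_funX.
  - by move=> i x _; rewrite lee_fin sqr_ge0.
  under eq_bigr do rewrite (gauss_law_moment2 (lY _)).
  by rewrite sumEFin /Ss mulr_sumr; congr EFin; apply: eq_bigr => i _; rewrite mulrC.
have E4 : (\int[P]_x (\sum_(i < n) ((2 * la * w_ i)^-1 * Y i x ^+ 4))%:E =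
    (\sum_(i < n) ((2 * la * w_ i)^-1 * (s i ^+ 4 * a4)))%:E)%E.
  under eq_integral do rewrite -sumEFin.
  rewrite ge0_integral_sum//; last 2 first.
  - by move=> i; apply/measurable_EFinP; apply: measurable_funM => //; exact: measurable_funX.
  - by move=> i x _; rewrite lee_fin mulr_ge0 ?exprn_even_ge0.
  rewrite -sumEFin; apply: eq_bigr => i _.
  under eq_integral do rewrite EFinM.
  rewrite ge0_integralZl//.
  - by rewrite (gauss_law_moment4 (lY _)).
  - by move=> x _; rewrite lee_fin exprn_even_ge0.
  - by rewrite lee_fin.
have key : a2 * Ss <= M%:R + \sum_(i < n) ((2 * la * w_ i)^-1 * (s i ^+ 4 * a4)) + la * W / 2 * dl.
  rewrite -lee_fin -ES.
  apply: (@le_trans _ _ (\int[P]_x ((cst M%:R%:E x + (\sum_(i < n) ((2 * la * w_ i)^-1 * Y i x ^+ 4))%:E) +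
       (la * W / 2)%:E * (\1_E x)%:E))%E).
    apply: ge0_le_integral => //.
    - by move=> x _; rewrite lee_fin sumr_ge0// => i _; rewrite sqr_ge0.
    - by apply/measurable_EFinP; apply: measurable_sum => i; exact: measurable_funX.
    - apply: emeasurable_funD; last exact: emeasurable_funM.
      apply: emeasurable_funD => //; apply/measurable_EFinP; apply: measurable_sum => i.
      by apply: measurable_funM => //; exact: measurable_funX.
    - by move=> x _; rewrite -EFinM -!EFinD lee_fin; exact: pt.
  have lW : 0 <= la * W / 2 by rewrite divr_ge0// mulr_ge0 ?(ltW la0).
  have m4 : measurable_fun setT (fun x => (\sum_(i < n) ((2 * la * w_ i)^-1 * Y i x ^+ 4))%:E).
    apply/measurable_EFinP; apply: measurable_sum => i.
    by apply: measurable_funM => //; exact: measurable_funX.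
  have p4 x : (0 <= (\sum_(i < n) ((2 * la * w_ i)^-1 * Y i x ^+ 4))%:E)%E.
    by rewrite lee_fin sumr_ge0// => i _; rewrite mulr_ge0 ?exprn_even_ge0.
  rewrite ge0_integralD//; last 4 first.
  - by move=> x _; rewrite adde_ge0// lee_fin ler0n.
  - exact: emeasurable_funD.
  - by move=> x _; rewrite mule_ge0// lee_fin.
  - exact: emeasurable_funM.
  rewrite ge0_integralD//; last by move=> x _; rewrite lee_fin ler0n.
  rewrite integral_cst//= [X in (_ * X)%E]probability_setT mule1 E4.
  rewrite ge0_integralZl//.
  rewrite integral_indic// setIT 2!EFinD; apply: leeD => //.
  rewrite [leRHS]EFinM; apply: lee_wpmul2l; first by rewrite lee_fin.
  exact: ltW.
have b4 : \sum_(i < n) ((2 * la * w_ i)^-1 * (s i ^+ 4 * a4)) <= a2 / 4 * Ss.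
  rewrite /Ss mulr_sumr; apply: ler_sum => i _.
  rewrite mulrC ler_pdivrMr//.
  have s2 : s i ^+ 2 <= w_ i by rewrite /w_ lerDl invr_ge0.
  have -> : s i ^+ 4 = s i ^+ 2 * s i ^+ 2 by rewrite -exprD.
  have e1 : a2 / 4 * s i ^+ 2 * (2 * la * w_ i) = s i ^+ 2 * w_ i * (a4 + 1).
    by rewrite /la; field; exact: lt0r_neq0.
  rewrite e1; apply: ler_pM => //; first by rewrite mulr_ge0 ?sqr_ge0.
    by apply: ler_wpM2l => //; exact: sqr_ge0.
  by rewrite lerDl.
have b5 : la * W / 2 * dl <= a2 / 4 * (Ss + 1).
  have -> : la * W / 2 * dl = a2 / 4 * W.
    by rewrite /dl; field; exact: lt0r_neq0.
  by apply: ler_wpM2l => //; rewrite divr_ge0// ltW.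
have fin : a2 / 2 * Ss <= M%:R + a2 / 4.
  have e0 : a2 * Ss = a2 / 2 * Ss + (a2 / 4 * Ss + a2 / 4 * Ss) by field.
  rewrite mulrDr mulr1 in b5; lra.
rewrite -/Ss -(ler_pM2l (divr_gt0 c2 (ltr0n R 2))) (le_trans fin)//.
rewrite (_ : a2 / 2 * _ = M%:R + a2 / 2); first lra.
by field; exact: lt0r_neq0.
Qed.

End GaussianTightness.

(** * The covariance operator *)

Lemma nneseries_bounded (R : realType) (u : nat -> R) (B : R) :
  (forall n, 0 <= u n) -> (forall n, \sum_(i < n) u i <= B) ->
  (\sum_(0 <= n <oo) (u n)%:E < +oo)%E.
Proof.
move=> u0 uB; apply: (@le_lt_trans _ _ B%:E); last exact: ltry.
apply: lime_le; first by apply: is_cvg_nneseries => n _ _; rewrite lee_fin.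
by apply: nearW => n; rewrite big_mkord sumEFin lee_fin.
Qed.

Section CovarianceOperator.
Context {k : scalar_kind} {R : realType}.
Local Notation K := (scalars k R).
Context {H : completeNormedModType K} (ip : {dot H for conjK}).
Hypothesis norm_ip : forall x : H, `|x| ^+ 2 = ip x x.
Local Notation hip := (dot_semi_inner norm_ip).
Local Notation nsq v := (reK (ip v v)).
Variable e : nat -> H.
Hypothesis be : orthonormal_basis ip e.
Context {d : measure_display} {T : measurableType d} (P : probability T R).
Variable X : T -> H.
Hypothesis symX : symmetric_gaussian_field P X.
Local Notation cov := (field_cov P X).

Lemma dual_ofD (x y : H) : dual_of ip (x + y) = dual_of ip x + dual_of ip y.
Proof. by apply: dual_ext => z; rewrite dualD !(dual_of_ip norm_ip) (ipDr hip). Qed.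

Lemma dual_ofZ a (x : H) : dual_of ip (a *: x) = conjK a *: dual_of ip x.
Proof. by apply: dual_ext => z; rewrite dualZ !(dual_of_ip norm_ip) (ipZr hip). Qed.

Lemma measurable_reK_field (f : dual H) : measurable_fun setT (fun w => reK (f (X w))).
Proof. by have [m _] := field_square_integrable symX f. Qed.

Lemma measurable_absq_field (f : dual H) : measurable_fun setT (fun w => absq (f (X w))).
Proof.
rewrite (_ : (fun _ => _) = (fun w => \sum_(u <- units) reK ((u *: f) (X w)) ^+ 2)).
  by apply: measurable_sum => u; apply: measurable_funX; exact: measurable_reK_field.
by apply/funext => w; rewrite absq_units; apply: eq_bigr => u _; rewrite dualZ.
Qed.

Lemma measurable_nsq_field : measurable_fun setT (fun w => nsq (X w)).
Proof.
apply: (@measurable_fun_cvg _ _ _ _ (fun n w => \sum_(i < n) absq (ip (X w) (e i)))).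
- move=> n; apply: measurable_sum => i.
  rewrite (_ : (fun _ => _) = (fun w => absq (dual_of ip (e i) (X w)))).
    exact: measurable_absq_field.
  by apply/funext => w; rewrite (dual_of_ip norm_ip).
- by move=> w _; exact: (parseval hip be).
Qed.

(** The real coordinates [reK (u * <X, e i>)] are, for each of the finitely many
    [u], centred Gaussian with square sums at most [|X|^2]. *)
Lemma field_trace_bounded : exists B, forall n,
  \sum_(i < n) reK (cov (dual_of ip (e i)) (dual_of ip (e i))) <= B.
Proof.
have [s sP] : {s : dual H -> R & forall f : dual H, gauss_law P (fun w => reK (f (X w))) (s f)}.
  apply: (@choice _ _ (fun (f : dual H) s => gauss_law P (fun w => reK (f (X w))) s)) => f.
  by have [s _ h] := symmetric_field_law symX f; exists s.
have covE (f : dual H) : reK (cov f f) = normal_moment2 * \sum_(u <- units) s (u *: f) ^+ 2.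
  apply: EFin_inj; rewrite (field_varE symX).
  under eq_integral do rewrite absq_units -sumEFin.
  rewrite ge0_integral_sum//; last 2 first.
  - move=> u; apply/measurable_EFinP; apply: measurable_funX.
    by under eq_fun do rewrite -dualZ; exact: measurable_reK_field.
  - by move=> u w _; rewrite lee_fin sqr_ge0.
  rewrite mulr_sumr -sumEFin; apply: eq_bigr => u _.
  under eq_integral do rewrite -dualZ.
  by rewrite (gauss_law_moment2 (sP _)) mulrC.
have Bu (us : seq K) : {subset us <= units} -> exists B, forall n,
    \sum_(i < n) \sum_(u <- us) s (u *: dual_of ip (e i)) ^+ 2 <= B.
  elim: us => [_|u us ih sub].
    by exists 0 => n; rewrite big1// => i _; rewrite big_nil.
  have [|B hB] := ih; first by move=> v vu; apply: sub; rewrite inE vu orbT.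
  have uu : u \in units by apply: sub; rewrite inE eqxx.
  have [|B' hB'] := @gaussian_square_sums_bounded _ _ _ P _ _ _
     (fun i => sP (u *: dual_of ip (e i))) measurable_nsq_field.
    move=> n w; apply: (le_trans _ (bessel hip _ (basis_upto be (n := n)))).
    apply: ler_sum => i _; apply: le_trans (reK_sqr_le_absq _) _.
    by rewrite dualZ absqM absq_unit// mul1r (dual_of_ip norm_ip).
  exists (B' + B) => n; under eq_bigr do rewrite big_cons.
  by rewrite big_split/=; apply: lerD; [exact: hB'|exact: hB].
have [B hB] := Bu units (fun _ => id).
exists (normal_moment2 * B) => n; under eq_bigr do rewrite covE.
by rewrite -mulr_sumr ler_pM2l ?normal_moment2_gt0.
Qed.

(** Monotone convergence and the identity of Parseval. *)
Lemma field_norm_moment : exists2 tau, 0 <= tau &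
  (\int[P]_w (nsq (X w))%:E <= tau%:E)%E.
Proof.
have [B hB] := field_trace_bounded.
have B0 : 0 <= B by have := hB 0%N; rewrite big_ord0.
exists B => //.
pose g n (w : T) : \bar R := (\sum_(i < n) absq (ip (X w) (e i)))%:E.
have mabs i : measurable_fun setT (fun w => absq (ip (X w) (e i))).
  rewrite (_ : (fun _ => _) = (fun w => absq (dual_of ip (e i) (X w)))).
    exact: measurable_absq_field.
  by apply/funext => w; rewrite (dual_of_ip norm_ip).
have mg n : measurable_fun setT (g n).
  by apply/measurable_EFinP; apply: measurable_sum => i.
have g0 n w : setT w -> (0 <= g n w)%E.
  by move=> _; rewrite lee_fin sumr_ge0// => i _; exact: absq_ge0.
have ndg w : setT w -> nondecreasing_seq (g ^~ w).
  move=> _ m n mn; rewrite lee_fin (big_ord_widen n (fun i => absq (ip (X w) (e i))) mn).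
  rewrite big_mkcond; apply: ler_sum => i _; case: ifP => // _; exact: absq_ge0.
have h : (\int[P]_w g n w @[n --> \oo] --> \int[P]_w limn (g ^~ w))%E.
  exact: (cvg_monotone_convergence measurableT mg g0 ndg).
have -> : (\int[P]_w (nsq (X w))%:E = limn (fun n => \int[P]_w g n w))%E.
  apply/esym; rewrite (cvg_lim _ h)//; apply: eq_integral => w _.
  apply/cvg_lim => //; apply: cvg_EFin; first exact: nearW.
  exact: (parseval hip be).
apply: lime_le; first by apply/cvg_ex; eexists; exact: h.
apply: nearW => n; rewrite /g.
under eq_integral do rewrite -sumEFin.
rewrite ge0_integral_sum//; last 2 first.
- by move=> i; apply/measurable_EFinP.
- by move=> i w _; rewrite lee_fin absq_ge0.
apply: le_trans (_ : (\sum_(i < n) reK (cov (dual_of ip (e i)) (dual_of ip (e i))))%:E <= _)%E; last first.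
  by rewrite lee_fin.
rewrite -sumEFin; apply: lee_sum => i _; rewrite (field_varE symX).
by under [leRHS]eq_integral do rewrite (dual_of_ip norm_ip).
Qed.

(** [|f (X)| <= |f| |X|], integrated. *)
Lemma field_cov_bounded : exists2 tau, 0 <= tau &
  forall f : dual H, reK (cov f f) <= tau * reK (dual_ip ip f f).
Proof.
have [tau t0 ht] := field_norm_moment; exists tau => // f.
rewrite -lee_fin (field_varE symX) mulrC EFinM.
have r0 : 0 <= reK (dual_ip ip f f) := nsq_ge0 hip _.
apply: (@le_trans _ _ (\int[P]_w ((reK (dual_ip ip f f))%:E * (nsq (X w))%:E))%E); last first.
  rewrite ge0_integralZl//.
  - by apply: lee_wpmul2l => //; rewrite lee_fin.
  - by apply/measurable_EFinP; exact: measurable_nsq_field.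
  - by move=> w _; rewrite lee_fin (nsq_ge0 hip).
apply: ge0_le_integral => //.
- by move=> w _; rewrite lee_fin absq_ge0.
- by apply/measurable_EFinP; exact: measurable_absq_field.
- by apply: emeasurable_funM => //; apply/measurable_EFinP; exact: measurable_nsq_field.
- move=> w _; rewrite -EFinM lee_fin mulrC (rieszE norm_ip be f (X w)).
  exact: (cauchy_schwarz hip).
Qed.

(** By [field_cov_bounded] and Cauchy-Schwarz, the covariance of [f] with the
    functional of [y] is a bounded linear function of [y], taken to be [A f]. The
    resulting operator is non-negative and self-adjoint, hence is its own
    absolute value, and its trace is the sum bounded by
    [field_trace_bounded]. *)
Theorem covariance_operator : exists A : {linear dual H -> dual H},
  [/\ nonnegative_operator (dual_ip ip) A, self_adjoint (dual_ip ip) A,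
      trace_class (dual_ip ip) A &
      forall f g : dual H, covariance_function P X f g = dual_ip ip (A f) g].
Proof.
have hcov : semi_inner cov := field_cov_semi_inner symX.
have hd := dual_semi_inner norm_ip be.
have [tau t0 ht] := field_cov_bounded.
have exA (f : dual H) : exists g : dual H, forall y, g y = cov f (dual_of ip y).
  apply: (@exists_dual _ _ _ ip norm_ip (fun y => cov f (dual_of ip y))
           (Num.sqrt (reK (cov f f) * tau))).
  - by move=> x y; rewrite dual_ofD (ipDr hcov).
  - by move=> a x; rewrite dual_ofZ (ipZr hcov) conjKK.
  move=> x; rewrite sqr_sqrtr ?mulr_ge0 ?(nsq_ge0 hcov)//.
  apply: le_trans (cauchy_schwarz hcov _ _) _; rewrite -mulrA.
  apply: ler_wpM2l; first exact: nsq_ge0 hcov _.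
  by have := ht (dual_of ip x); rewrite /dual_ip (riesz_dual_of norm_ip be).
have [A0 A0E] := choice exA.
have linA : linear A0.
  move=> a f g; apply: dual_ext => y; rewrite dualD dualZ !A0E.
  by rewrite (ipD hcov) (ipZ hcov).
pose A : {linear dual H -> dual H} := HB.pack A0 (GRing.isLinear.Build _ _ _ _ _ linA).
have AE (f g : dual H) : dual_ip ip (A f) g = cov f g.
  by rewrite (dual_ipE norm_ip be) A0E (dual_of_riesz norm_ip be).
have nA : nonnegative_operator (dual_ip ip) A.
  by move=> f; rewrite AE; exact: ip_ge0 hcov f.
have sA : self_adjoint (dual_ip ip) A.
  by move=> f g; rewrite AE (ipC hd) AE (ipC hcov).
have bA : bounded_operator (dual_ip ip) A.
  exists tau => f; rewrite -ler_sqr ?nnegrE ?mulr_ge0 ?ip_norm_ge0//.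
  rewrite exprMn !(ip_normE hd).
  have n0 := nsq_ge0 hd (A f); have f0 := nsq_ge0 hd f.
  have [->|n1] := eqVneq (reK (dual_ip ip (A f) (A f))) 0.
    by rewrite mulr_ge0 ?sqr_ge0.
  have n2 : 0 < reK (dual_ip ip (A f) (A f)) by rewrite lt_def n1.
  rewrite -(ler_pM2r n2).
  have cs := cauchy_schwarz hcov f (A f).
  have e1 : absq (cov f (A f)) = reK (dual_ip ip (A f) (A f)) ^+ 2.
    by rewrite -AE (ip_nsq hd) absq_ofR reK_ofR.
  rewrite -expr2 -e1; apply: le_trans cs _.
  apply: le_trans (ler_pM (nsq_ge0 hcov f) (nsq_ge0 hcov (A f)) (ht f) (ht (A f))) _.
  by rewrite le_eqVlt; apply/orP; left; apply/eqP; ring.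
exists A; split => //.
- split=> //; exists A, (fun n => dual_of ip (e n)); split.
  + by split=> //; exists A.
  + exact: (dual_basis_of norm_ip be be).
  + have [B hB] := field_trace_bounded.
    apply: (@nneseries_bounded _ _ B).
      by move=> n; apply: reK_ge0; exact: nA.
    by move=> n; under eq_bigr do rewrite AE.
- by move=> f g; rewrite (covariance_functionE symX) AE.
Qed.

End CovarianceOperator.

(** * Proper Gaussian variables from their real parts *)

Lemma sum_blocks (V : nmodType) (m N : nat) (F : nat -> V) :
  \sum_(j < m * N) F j = \sum_(n < N) \sum_(t < m) F (m * n + t)%N.
Proof.
elim: N => [|N ih]; first by rewrite muln0 !big_ord0.
by rewrite mulnS addnC big_split_ord/= ih big_ord_recr.
Qed.

Section Units.
Context {k : scalar_kind} {R : realType}.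
Local Notation K := (scalars k R).
Local Notation us := (@units k R).

Lemma absq_unit_comb (W : nat -> R) :
  absq (\sum_(t < size us) conjK us`_t * ofR (W t)) = \sum_(t < size us) W t ^+ 2.
Proof.
rewrite /units /absq; case: k => /=.
  by rewrite !big_ord_recl !big_ord0 /= mul1r addr0 expr2 addr0.
by rewrite !big_ord_recl !big_ord0 /=; ring.
Qed.

Lemma unit_expand_ord (z : K) :
  z = \sum_(t < size us) ofR (reK (conjK us`_t * z)) * us`_t.
Proof.
rewrite [LHS]units_expand_conj (big_nth 0) big_mkord.
by [].
Qed.

Lemma size_units_gt0 : (0 < size us)%N.
Proof. by rewrite /units; case: k. Qed.

End Units.

Section ProperGaussian.
Context {k : scalar_kind} {R : realType} {d : measure_display} {T : measurableType d}.
Variable P : probability T R.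
Local Notation K := (scalars k R).

(** Rotation invariance of the real parts gives real and imaginary parts of equal
    variance. They are uncorrelated because the variance of their sum, obtained
    at [a = 1 - i], is twice that variance. So [Z ^+ 2] has mean [0]. *)
Lemma gaussian_of_real_parts (Z : T -> K) (s : R) : 0 <= s ->
  (forall a, gauss_law P (fun w => reK (a * Z w)) (Num.sqrt (absq a) * s)) ->
  gaussian P Z /\ symmetric_rv P Z.
Proof.
move: Z; rewrite /gaussian /symmetric_rv /absq; case: k => /= Z s0 lZ.
  have l1 := lZ 1; rewrite !mulr1 sqrtr1 mul1r in l1.
  have {}l1 : gauss_law P Z s by move: l1; under eq_fun do rewrite mul1r.
  split; first exact: gauss_law_real_gaussian l1.
  by rewrite unlock (gauss_law_mean l1).
have l a b : gauss_law P (fun w => a * complex.Re (Z w) + b * complex.Im (Z w))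
    (Num.sqrt (a ^+ 2 + b ^+ 2) * s).
  have := lZ (Complex a (- b)).
  rewrite /= (_ : a * a - - b * - - b = a ^+ 2 + b ^+ 2); last by ring.
  rewrite (_ : (fun w => complex.Re (Complex a (- b) * Z w)) =
    (fun w => a * complex.Re (Z w) + b * complex.Im (Z w)))//.
  by apply/funext => w; case: (Z w) => x y /=; ring.
have l10 : gauss_law P (fun w => complex.Re (Z w)) s.
  have := l 1 0; rewrite expr1n expr0n/= addr0 sqrtr1 mul1r.
  by under eq_fun do rewrite mul1r mul0r addr0.
have l01 : gauss_law P (fun w => complex.Im (Z w)) s.
  have := l 0 1; rewrite expr1n expr0n/= add0r sqrtr1 mul1r.
  by under eq_fun do rewrite mul1r mul0r add0r.
have l11 : gauss_law P (fun w => complex.Re (Z w) + complex.Im (Z w)) (Num.sqrt 2 * s).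
  have := l 1 1; rewrite expr1n.
  by under eq_fun do rewrite !mul1r.
split.
  move=> a b; apply: gauss_law_real_gaussian (l a b).
  by rewrite mulr_ge0 ?sqrtr_ge0.
have q10 := gauss_law_square_integrable l10.
have q01 := gauss_law_square_integrable l01.
split.
  by rewrite !unlock (gauss_law_mean l10) (gauss_law_mean l01).
have m10 := gauss_law_moment2 l10; have m01 := gauss_law_moment2 l01.
have m11 := gauss_law_moment2 l11.
have i10 : P.-integrable setT (fun w => (complex.Re (Z w) ^+ 2)%:E).
  by have := square_integrableM q10 q10; under eq_fun do rewrite -expr2.
have i01 : P.-integrable setT (fun w => (complex.Im (Z w) ^+ 2)%:E).
  by have := square_integrableM q01 q01; under eq_fun do rewrite -expr2.
have iM := square_integrableM q10 q01.
congr (Complex _ _); rewrite unlock.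
  transitivity (fine (\int[P]_w ((complex.Re (Z w) ^+ 2)%:E - (complex.Im (Z w) ^+ 2)%:E)))%E.
    congr fine; apply: eq_integral => w _; case: (Z w) => x y /=.
    by rewrite -EFinB; congr EFin; ring.
  by rewrite integralB// m10 m01 subee.
transitivity (fine (\int[P]_w (2%:E * (complex.Re (Z w) * complex.Im (Z w))%:E)))%E.
  congr fine; apply: eq_integral => w _; case: (Z w) => x y /=.
  by rewrite -EFinM; congr EFin; ring.
have i2 : P.-integrable setT (fun w => (2%:E * (complex.Re (Z w) * complex.Im (Z w))%:E))%E.
  exact: integrableZl.
have E : (\int[P]_w (2%:E * (complex.Re (Z w) * complex.Im (Z w))%:E) +
   ((s ^+ 2 * normal_moment2)%:E + (s ^+ 2 * normal_moment2)%:E) = (2 * (s ^+ 2 * normal_moment2))%:E)%E.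
  rewrite -{1}m10 -m01 -integralD// -integralD//; last exact: integrableD.
  transitivity (\int[P]_w ((complex.Re (Z w) + complex.Im (Z w)) ^+ 2)%:E)%E.
    apply: eq_integral => w _; rewrite -EFinM -!EFinD; congr EFin; ring.
  by rewrite m11 exprMn sqr_sqrtr// mulrA.
have f2 := integrable_fin_num measurableT i2.
move: E; rewrite -(fineK f2) -!EFinD => -[] E.
by move: E; lra.
Qed.

End ProperGaussian.

Section Polarization.
Context {k : scalar_kind} {R : realType}.
Local Notation K := (scalars k R).
Context {V : lmodType K}.

(** Compare the values at [a u + v] for all scalars [a]. *)
Lemma semi_inner_polarization (p q : V -> V -> K) : semi_inner p -> semi_inner q ->
  (forall v, reK (p v v) = reK (q v v)) -> forall u v, p u v = q u v.
Proof.
move=> hp hq pq u v; apply: reK_ext => a; rewrite -(ipZ hp) -(ipZ hq).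
have := pq (a *: u + v); rewrite (nsqD hp) (nsqD hq) !pq; lra.
Qed.

Lemma semi_inner_psd_form (q : V -> V -> K) (c : R) : semi_inner q -> 0 <= c ->
  psd_form (fun r (v : V) => (ofR r : K) *: v) (fun u v => c * reK (q u v)).
Proof.
move=> hq c0; split.
- by move=> f g h; rewrite (ipD hq) reKD mulrDr.
- by move=> r f h; rewrite (ipZ hq) reK_scale mulrCA.
- by move=> f g; rewrite (ipC hq) reK_conj.
- by move=> f; rewrite mulr_ge0// (nsq_ge0 hq).
Qed.

End Polarization.

(** * A field with a given covariance operator *)

Section FieldMeasurability.
Context {k : scalar_kind} {R : realType}.
Local Notation K := (scalars k R).
Context {H : completeNormedModType K} (ip : {dot H for conjK}).
Hypothesis norm_ip : forall x : H, `|x| ^+ 2 = ip x x.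
Hypothesis H_separable : separable H.
Local Notation hip := (dot_semi_inner norm_ip).
Local Notation nsq v := (reK (ip v v)).
Context {d : measure_display} {T : measurableType d}.

(** An open set is the union of the balls that it contains with centre in a
    countable dense set and radius [1 / j]; the preimage of such a ball is an
    event about [|X|^2] and one functional. *)
Lemma random_field_of_functionals (X : T -> H) :
  measurable_fun setT (fun w => nsq (X w)) ->
  (forall h, measurable_fun setT (fun w => reK (ip (X w) h))) ->
  random_field X.
Proof.
move=> mX mXh; have [D hD] := separable_sequence norm_ip H_separable.
apply: (@measurability _ _ T (g_sigma_algebraType (@open H)) setT X (@open H)) => //.
move=> _ [U oU <-]; rewrite setTI.
pose rad (j : nat) : R := (j.+1%:R)^-1.
have rad0 j : 0 < rad j by rewrite invr_gt0.
pose good n j := forall y, ip_norm ip (D n - y) < rad j -> U y.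
have mball n j : measurable [set w | ip_norm ip (D n - X w) < rad j].
  rewrite (_ : [set _ | _] = (fun w => nsq (X w) + nsq (D n) - 2 * reK (ip (X w) (D n)))
     @^-1` `]-oo, rad j ^+ 2[%classic).
    rewrite -[X in measurable X]setTI.
    have m : measurable_fun setT (fun w => nsq (X w) + nsq (D n) - 2 * reK (ip (X w) (D n))).
      by apply: measurable_funB; [exact: measurable_funD|exact: measurable_funM].
    exact: m.
  apply/seteqP; split=> w /=; rewrite in_itv/= -(nsqB hip) -(ip_normE hip) (ip_normB hip (D n)).
    by rewrite ltr_sqr ?nnegrE ?ip_norm_ge0// (ltW (rad0 j)).
  by rewrite ltr_sqr ?nnegrE ?ip_norm_ge0// (ltW (rad0 j)).
rewrite (_ : X @^-1` U = \bigcup_n \bigcup_(j in [set j | good n j])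
    [set w | ip_norm ip (D n - X w) < rad j]).
  apply: bigcup_measurable => n _; apply: bigcup_measurable => j _; exact: mball.
apply/seteqP; split=> w /=; last by move=> [n _ [j gj hj]]; exact: gj hj.
move=> UXw.
have /nbhs_ballP[e e0 hU] : nbhs (X w) U by apply: open_nbhs_nbhs.
have [r r0 er] := pos_ofR e0.
have [j hj] : exists j, 2 * rad j < r.
  exists (Num.truncn (2 / r)); rewrite /rad ltr_pdivrMr// mulrC -ltr_pdivrMr//.
  exact: truncnS_gt.
have [n hn] := hD (X w) (rad j) (rad0 j).
exists n => //; exists j; last by rewrite /= (ip_normB hip).
move=> y hy; apply: hU; rewrite er -ball_normE /ball_/= (normE norm_ip) ofR_lt.
have -> : X w - y = (X w - D n) + (D n - y) by rewrite addrA subrK.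
apply: le_lt_trans (ip_normD hip _ _) _; lra.
Qed.

End FieldMeasurability.

Section Construction.
Context {k : scalar_kind} {R : realType}.
Local Notation K := (scalars k R).
Context {H : completeNormedModType K} (ip : {dot H for conjK}).
Hypothesis norm_ip : forall x : H, `|x| ^+ 2 = ip x x.
Hypothesis H_separable : separable H.
Local Notation hip := (dot_semi_inner norm_ip).
Local Notation nsq v := (reK (ip v v)).
Local Notation us := (@units k R).
Local Notation m := (size us).
Local Notation fair_coins := (@fair_coins R).
Variable eps : nat -> dual H.
Variable e0 : nat -> H.
Hypothesis be0 : orthonormal_basis ip e0.
Hypothesis beps : orthonormal_basis (dual_ip ip) eps.
Variable A : {linear dual H -> dual H}.
Hypothesis sA : self_adjoint (dual_ip ip) A.
Hypothesis nA : nonnegative_operator (dual_ip ip) A.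
Hypothesis bA : bounded_operator (dual_ip ip) A.
Hypothesis trA : (\sum_(0 <= n <oo) (reK (dual_ip ip (A (eps n)) (eps n)))%:E < +oo)%E.

Let hd : semi_inner (dual_ip ip) := dual_semi_inner norm_ip be0.
Let q (f g : dual H) : K := dual_ip ip (A f) g.
Let hq : semi_inner q := operator_semi_inner hd sA nA.
Let e n : H := riesz ip (eps n).
Let be : orthonormal_basis ip e := basis_of_dual norm_ip be0 beps.

Let kap : R := (m%:R * normal_moment2)^-1.
Let kap_gt0 : 0 < kap.
Proof. by rewrite invr_gt0 mulr_gt0 ?normal_moment2_gt0// ltr0n size_units_gt0. Qed.

Let sc (r : R) (f : dual H) : dual H := (ofR r : K) *: f.
Let Q (f g : dual H) : R := kap * reK (q f g).
Let pQ : psd_form sc Q := semi_inner_psd_form hq (ltW kap_gt0).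
Let b (j : nat) : dual H := us`_(j %% m) *: eps (j %/ m).

Let bE n t : (t < m)%N -> b (m * n + t) = us`_t *: eps n.
Proof.
move=> tm; rewrite /b mulnC modnMDl modn_small// divnMDl ?size_units_gt0//.
by rewrite divn_small// addn0.
Qed.

(** The family [b] lists the real directions [u *: eps n] for [u] in [units]. With
    [W] the Gaussian process over [b] for the real form [Q], the coordinate [Xc n]
    is assembled from the values of [W] at the directions above [eps n], in such a
    way that [reK (f x)] for [x] the partial sum of the series is exactly the
    combination of the [W j] attached to the projection of [f]. Thus it has
    variance [Q] at that projection, up to the factor [normal_moment2], and
    [Q] is continuous. The constant [kap] makes the total variance of [f (X)],
    the sum over [units] of those of the real parts of [u * f (X)], equal to
    [<A f, f>]. *)
Theorem exists_gaussian_field :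
  exists X : coins -> H, symmetric_gaussian_field fair_coins X /\
    forall f g : dual H, covariance_function fair_coins X f g = dual_ip ip (A f) g.
Proof.
have [W [mW lW]] := gaussian_process b pQ.
pose Xc n (c : coins) : K := \sum_(t < m) conjK us`_t * ofR (W (m * n + t)%N c).
have absX n c : absq (Xc n c) = \sum_(t < m) W (m * n + t)%N c ^+ 2.
  exact: (absq_unit_comb (fun t => W (m * n + t)%N c)).
have lWj j : gauss_law fair_coins (W j) (Num.sqrt (Q (b j) (b j))).
  have := lW j.+1 (fun i => (i == j)%:R).
  have -> : \sum_(i < j.+1) sc (i == j :> nat)%:R (b i) = b j.
    rewrite big_ord_recr/= eqxx /sc ofR1 scale1r big1 ?add0r// => i _.
    by rewrite ltn_eqF// ofR0 scale0r.
  rewrite (_ : (fun c => _) = W j)//; apply/funext => c.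
  rewrite big_ord_recr/= eqxx mul1r big1 ?add0r// => i _.
  by rewrite ltn_eqF// mul0r.
have QbE n t : (t < m)%N -> Q (b (m * n + t)%N) (b (m * n + t)%N) = kap * reK (q (eps n) (eps n)).
  move=> tm; rewrite bE// /Q (nsqZ hq) absq_unit ?mul1r//.
  exact: mem_nth.
have mX2 n : measurable_fun setT (fun c => absq (Xc n c)).
  rewrite (_ : (fun c => _) = (fun c => \sum_(t < m) W (m * n + t)%N c ^+ 2)); last first.
    by apply/funext => c; exact: absX.
  by apply: measurable_sum => t; exact: measurable_funX.
have EX n : (\int[fair_coins]_c (absq (Xc n c))%:E = (reK (q (eps n) (eps n)))%:E)%E.
  under eq_integral do rewrite absX -sumEFin.
  rewrite ge0_integral_sum//; last 2 first.
  - by move=> t; apply/measurable_EFinP; exact: measurable_funX.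
  - by move=> t c _; rewrite lee_fin sqr_ge0.
  rewrite (eq_bigr (fun=> (m%:R^-1 * reK (q (eps n) (eps n)))%:E)); last first.
    move=> t _; rewrite (gauss_law_moment2 (lWj _)) sqr_sqrtr ?(psd_ge0 pQ)//.
    rewrite QbE// /kap; congr EFin; field.
    by rewrite pnatr_eq0 -lt0n size_units_gt0 (lt0r_neq0 normal_moment2_gt0).
  rewrite sumEFin sumr_const card_ord -[X in X%:E]mulr_natl mulrA divff ?mul1r//.
  by rewrite pnatr_eq0 -lt0n size_units_gt0.
(* the paths along which the series of the field converges *)
pose G : set coins := [set c | exists M : nat, forall N, \sum_(n < N) absq (Xc n c) <= M%:R].
have mG : measurable G.
  rewrite (_ : G = \bigcup_M \bigcap_N [set c | \sum_(n < N) absq (Xc n c) <= M%:R]).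
    apply: bigcup_measurable => M _; apply: bigcap_measurable => // N _.
    have mS : measurable_fun setT (fun c => \sum_(n < N) absq (Xc n c)).
      by apply: measurable_sum => n.
    rewrite (_ : [set _ | _] = setT `&` (fun c => \sum_(n < N) absq (Xc n c)) @^-1` `]-oo, M%:R]%classic).
      exact: mS.
    by rewrite setTI; apply/seteqP; split=> c /=; rewrite in_itv.
  by apply/seteqP; split=> c [M]; [move=> h; exists M => // N _; exact: h|move=> _ h; exists M => N; exact: h].
have aeG : {ae fair_coins, forall c, G c}.
  pose S (c : coins) : \bar R := (\sum_(0 <= n <oo) (absq (Xc n c))%:E)%E.
  have nn n c : (0 <= (absq (Xc n c))%:E)%E by rewrite lee_fin absq_ge0.
  have iS : fair_coins.-integrable setT S.
    apply/integrableP; split.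
      by apply: ge0_emeasurable_sum => n; [move=> c _ _|move=> _; apply/measurable_EFinP].
    under eq_integral => c _ do rewrite gee0_abs ?nneseries_ge0//.
    rewrite integral_nneseries//; last by move=> n; apply/measurable_EFinP.
    by under eq_eseriesr do rewrite EX.
  have := integrable_ae measurableT iS; apply: filterS => c /(_ I) fS.
  exists (Num.truncn (fine (S c))).+1 => N.
  apply: (@le_trans _ _ (fine (S c))); last exact/ltW/truncnS_gt.
  rewrite -lee_fin fineK// -sumEFin -(big_mkord xpredT (fun n => (absq (Xc n c))%:E)).
  by apply: nneseries_lim_ge.
(* killing the noise outside G makes the convergence hold everywhere *)
pose Wg j c := \1_G c * W j c.
have mWg j : measurable_fun setT (Wg j).
  by apply: measurable_funM => //; exact: measurable_indic.
pose Xg n c : K := \sum_(t < m) conjK us`_t * ofR (Wg (m * n + t)%N c).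
have XgE n c : Xg n c = ofR (\1_G c) * Xc n c.
  by rewrite /Xg /Xc mulr_sumr; apply: eq_bigr => t _; rewrite ofRM mulrCA.
have absXg n c : absq (Xg n c) = \sum_(t < m) Wg (m * n + t)%N c ^+ 2.
  exact: (absq_unit_comb (fun t => Wg (m * n + t)%N c)).
have exX c : exists x, norm_cvg ip (fun N => \sum_(n < N) Xg n c *: e n) x /\
                       forall n, ip x (e n) = Xg n c.
  have [B hB] : exists B, forall N, \sum_(n < N) absq (Xg n c) <= B.
    have [Gc|Gc] := boolP (c \in G).
      have [M hM] : G c by rewrite inE in Gc.
      exists M%:R => N; apply: le_trans (hM N); apply: ler_sum => n _.
      by rewrite XgE indicE Gc ofR1 mul1r.
    exists 0 => N; rewrite big1// => n _.
    by rewrite XgE indicE (negbTE Gc) ofR0 mul0r absq0.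
  by have [x h1 h2] := @riesz_fischer _ _ _ _ norm_ip _ be (fun n => Xg n c) _ hB; exists x.
have [X XP] := choice exX.
exists X.
have lawX (f : dual H) : gauss_law fair_coins (fun c => reK (f (X c))) (Num.sqrt (Q f f)).
  pose tf j : R := reK (conjK us`_(j %% m) * f (e (j %/ m))).
  have tfE n t : (t < m)%N -> tf (m * n + t)%N = reK (conjK us`_t * f (e n)).
    move=> tm; rewrite /tf mulnC modnMDl modn_small// divnMDl ?size_units_gt0//.
    by rewrite divn_small// addn0.
  pose fN N := partial_proj (dual_ip ip) eps N f.
  have fNE N : \sum_(j < m * N) sc (tf j) (b j) = fN N.
    rewrite (sum_blocks m N (fun j => sc (tf j) (b j))); apply: eq_bigr => n _.
    rewrite (dual_ipE norm_ip be0) -/(e n) [f (e n)]unit_expand_ord scaler_suml.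
    by apply: eq_bigr => t _; rewrite bE// tfE// /sc scalerA.
  have UE N c : reK (f (\sum_(n < N) Xg n c *: e n)) = \sum_(j < m * N) tf j * Wg j c.
    rewrite dualv_sum (sum_blocks m N (fun j => tf j * Wg j c)).
    transitivity (\sum_(n < N) reK (f (Xg n c *: e n))).
      by elim/big_rec2: _ => [|i x y _ <-]; rewrite ?reK0// reKD.
    apply: eq_bigr => n _; rewrite dualvZ /Xg mulr_suml.
    transitivity (\sum_(t < m) reK (conjK us`_t * ofR (Wg (m * n + t)%N c) * f (e n))).
      by elim/big_rec2: _ => [|i x y _ <-]; rewrite ?reK0// reKD.
    by apply: eq_bigr => t _; rewrite mulrAC mulrC reK_scale tfE// mulrC.
  have lU N : gauss_law fair_coins (fun c => reK (f (\sum_(n < N) Xg n c *: e n)))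
      (Num.sqrt (Q (fN N) (fN N))).
    have := lW (m * N)%N tf; rewrite fNE => l.
    apply: (gauss_law_ae l).
      rewrite (_ : (fun c => _) = (fun c => \sum_(j < m * N) tf j * Wg j c)); last first.
        by apply/funext => c; exact: UE.
      by apply: measurable_sum => j; exact: measurable_funM.
    apply: filterS aeG => c Gc; rewrite UE; apply: eq_bigr => j _.
    by rewrite /Wg indicE mem_set// mul1r.
  have cU c : reK (f (\sum_(n < N) Xg n c *: e n)) @[N --> \oo] --> (reK (f (X c)) : R).
    exact: (reK_dual_cvg norm_ip (f := f) (XP c).1).
  have mU : measurable_fun setT (fun c => reK (f (X c))).
    apply: (@measurable_fun_cvg _ _ _ _ (fun N c => reK (f (\sum_(n < N) Xg n c *: e n)))).
    - by move=> N; case: (lU N).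
    - by move=> c _; exact: cU.
  apply: (gauss_law_cvg lU mU cU).
  have [a a0 ha] := bounded_operator_pos bA.
  have qle (g : dual H) : ip_norm q g <= Num.sqrt a * ip_norm (dual_ip ip) g.
    rewrite -ler_sqr ?nnegrE ?mulr_ge0 ?sqrtr_ge0 ?ip_norm_ge0//.
    rewrite exprMn (ip_normE hq) (sqr_sqrtr (ltW a0)).
    apply: le_trans (le_trans (ler_norm _) (reK_ip_le hd _ _)) _.
    rewrite expr2 mulrA; apply: ler_wpM2r; [exact: ip_norm_ge0|exact: ha].
  have sqE (g : dual H) : Num.sqrt (Q g g) = Num.sqrt kap * ip_norm q g.
    by rewrite /Q sqrtrM// ltW.
  rewrite sqE; under eq_fun do rewrite sqE.
  apply: cvgM; first exact: cvg_cst.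
  apply/cvgrPdist_lt => ee ee0.
  have sa0 : 0 < Num.sqrt a by rewrite sqrtr_gt0.
  have [N hN] := partial_proj_small hd beps f (divr_gt0 ee0 sa0).
  exists N => // n /= Nn; have := hN n Nn; rewrite ltr_pdivlMr// => h.
  apply: (@le_lt_trans _ _ (ip_norm q (f - fN n))).
    rewrite ler_norml; apply/andP; split.
      have := ip_normD hq (fN n - f) f; rewrite subrK (ip_normB hq (fN n)); lra.
    have := ip_normD hq (f - fN n) (fN n); rewrite subrK; lra.
  by apply: le_lt_trans h; rewrite mulrC; exact: qle.
have nsqX c : (\sum_(n < N) absq (Xg n c)) @[N --> \oo] --> (nsq (X c) : R).
  have := parseval hip be (v := X c).
  by under eq_fun => N do under eq_bigr => n _ do rewrite (XP c).2.
have mnsq : measurable_fun setT (fun c => nsq (X c)).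
  apply: (@measurable_fun_cvg _ _ _ _ (fun N c => \sum_(n < N) absq (Xg n c))).
  - move=> N; apply: measurable_sum => n.
    rewrite (_ : (fun c => _) = (fun c => \sum_(t < m) Wg (m * n + t)%N c ^+ 2)); last first.
      by apply/funext => c; exact: absXg.
    by apply: measurable_sum => t; apply: measurable_funX; exact: mWg.
  - by move=> c _; exact: nsqX.
have rX : random_field X.
  apply: (random_field_of_functionals norm_ip H_separable mnsq) => h.
  rewrite (_ : (fun c => _) = (fun c => reK (dual_of ip h (X c)))); last first.
    by apply/funext => c; rewrite (dual_of_ip norm_ip).
  by case: (lawX (dual_of ip h)).
have gs (f : dual H) : gaussian fair_coins (fun c => f (X c)) /\
                       symmetric_rv fair_coins (fun c => f (X c)).
  apply: (gaussian_of_real_parts (s := Num.sqrt (Q f f))); first exact: sqrtr_ge0.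
  move=> a; have := lawX (a *: f).
  rewrite (_ : Q (a *: f) (a *: f) = absq a * Q f f); last by rewrite /Q (nsqZ hq) mulrCA.
  by rewrite sqrtrM ?absq_ge0.
have symX : symmetric_gaussian_field fair_coins X.
  by split; [split=> // f; case: (gs f)|move=> f; case: (gs f)].
split=> // f g; rewrite (covariance_functionE symX) -/(field_cov fair_coins X f g) -/(q f g).
apply: (semi_inner_polarization (field_cov_semi_inner symX) hq) => {f g} f.
apply: EFin_inj; rewrite (field_varE symX).
under eq_integral do rewrite absq_units -sumEFin.
rewrite ge0_integral_sum//; last 2 first.
- move=> u; apply/measurable_EFinP; apply: measurable_funX.
  rewrite (_ : (fun c => _) = (fun c => reK ((u *: f) (X c)))); last first.
    by apply/funext => c; rewrite dualZ.
  by case: (lawX (u *: f)).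
- by move=> u w _; rewrite lee_fin sqr_ge0.
rewrite (eq_big_seq (fun=> (m%:R^-1 * reK (q f f))%:E)); last first.
  move=> u uu; under eq_integral do rewrite -dualZ.
  rewrite (gauss_law_moment2 (lawX _)) sqr_sqrtr ?(psd_ge0 pQ)//.
  rewrite /Q (nsqZ hq) absq_unit// mul1r /kap; congr EFin; field.
  by rewrite pnatr_eq0 -lt0n size_units_gt0 (lt0r_neq0 normal_moment2_gt0).
rewrite sumEFin big_const_seq count_predT iter_addr_0 -[X in X%:E]mulr_natl mulrA divff ?mul1r//.
by rewrite pnatr_eq0 -lt0n size_units_gt0.
Qed.

End Construction.

(** * Covariances of symmetric Gaussian fields *)

Theorem theorem3p1 (R : realType) (k : scalar_kind)
    (H : completeNormedModType (scalars k R)) (ip : {dot H for conjK})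
    (norm_ip : forall x : H, `|x| ^+ 2 = ip x x)
    (H_infinite : infinite_dimensional H) (H_separable : separable H) :
  [/\ forall (d : measure_display) (Omega : measurableType d)
        (P : probability Omega R) (X : Omega -> H),
        symmetric_gaussian_field P X ->
        exists A : {linear dual H -> dual H},
          [/\ nonnegative_operator (dual_ip ip) A,
              self_adjoint (dual_ip ip) A,
              trace_class (dual_ip ip) A &
              forall f g : dual H,
                covariance_function P X f g = dual_ip ip (A f) g],
      forall A : {linear dual H -> dual H},
        nonnegative_operator (dual_ip ip) A ->
        self_adjoint (dual_ip ip) A ->
        trace_class (dual_ip ip) A ->
        exists (d : measure_display) (Omega : measurableType d)
          (P : probability Omega R) (X : Omega -> H),
          symmetric_gaussian_field P X /\
          forall f g : dual H,
            covariance_function P X f g = dual_ip ip (A f) g &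
      forall (d : measure_display) (Omega : measurableType d)
        (P : probability Omega R) (X : Omega -> H)
        (A : {linear dual H -> dual H}),
        symmetric_gaussian_field P X ->
        nonnegative_operator (dual_ip ip) A ->
        self_adjoint (dual_ip ip) A ->
        trace_class (dual_ip ip) A ->
        (forall f g : dual H,
          covariance_function P X f g = dual_ip ip (A f) g) ->
        (nondegenerate_field P X <-> positive_operator (dual_ip ip) A)].
Proof.
have [D dD] := separable_sequence norm_ip H_separable.
have be := gram_schmidt (dot_semi_inner norm_ip) (dot_def norm_ip) dD H_infinite.
split.
- by move=> d Omega P X symX; apply: (covariance_operator norm_ip be symX).
- move=> A nA sA tA.
  have [eps [beps trA]] := trace_class_nonneg (dual_semi_inner norm_ip be)
    (dual_ip_def norm_ip be) sA nA tA.
  have [X [symX cX]] := exists_gaussian_field norm_ip H_separable be beps sA nA tA.1 trA.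
  by exists _, coins, fair_coins, X.
- move=> d Omega P X A _ _ _ _ cX.
  by split=> h f f0; have := h f f0; rewrite cX.
Qed.
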